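(* There exist universal constants $c_1, C, C'>0$ such that the following holds. Let $\bm{M}^\star=\lambda^\star\bm{u}^\star\bm{v}^{\star\top}\in\mathbb{R}^{n_1\times n_2}$ be a rank-1 matrix with leading singular value $\lambda^\star>0$ and incoherence parameter $\mu$, where $\|\bm{u}^\star\|_2=\|\bm{v}^\star\|_2=1$. Put $n=n_1+n_2$ and fix unit vectors $\bm{a}\in\mathbb{R}^{n_1}$, $\bm{b}\in\mathbb{R}^{n_2}$. Let $\bm{M}_1=\bm{M}^\star+\bm{H}_1$ and $\bm{M}_2=\bm{M}^\star+\bm{H}_2$, where $\bm{H}_1,\bm{H}_2\in\mathbb{R}^{n_1\times n_2}$ are independent random matrices each satisfying the noise assumption with parameters $\sigma,B$, and let $\bm{u},\bm{v}$ be the estimates of $\bm{u}^\star,\bm{v}^\star$ built from $\bm{M}_1,\bm{M}_2$ by the dilation procedure (see context). If $$\frac{\max\{\sigma\sqrt{n\log n},\,B\log n\}}{\lambda^\star}\le c_1,$$ then with probability at least $1-C'n^{-10}$ all of the following hold: $$\max\big\{\min\|\bm{u}\pm\bm{u}^\star\|_2,\ \min\|\bm{v}\pm\bm{v}^\star\|_2\big\}\le C\,\frac{\max\{\sigma\sqrt{n\log n},\,B\log n\}}{\lambda^\star},$$ $$\max\big\{\min\|\bm{u}\pm\bm{u}^\star\|_\infty,\ \min\|\bm{v}\pm\bm{v}^\star\|_\infty\big\}\le C\,\frac{\max\{\sigma\sqrt{n\log n},\,B\log n\}}{\lambda^\star}\sqrt{\frac{\mu}{n}},$$ $$\min\big\{|\bm{a}^\top(\bm{u}-\bm{u}^\star)|,\,|\bm{a}^\top(\bm{u}+\bm{u}^\star)|\big\}\le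 C\left(|\bm{a}^\top\bm{u}^\star|+\sqrt{\frac{\mu}{n}}\right)\frac{\max\{\sigma\sqrt{n\log n},\,B\log n\}}{\lambda^\star},$$ $$\min\big\{|\bm{b}^\top(\bm{v}-\bm{v}^\star)|,\,|\bm{b}^\top(\bm{v}+\bm{v}^\star)|\big\}\le C\left(|\bm{b}^\top\bm{v}^\star|+\sqrt{\frac{\mu}{n}}\right)\frac{\max\{\sigma\sqrt{n\log n},\,B\log n\}}{\lambda^\star}.$$
   Context: Notation: $\min\|\bm{x}\pm\bm{y}\|=\min\{\|\bm{x}-\bm{y}\|,\|\bm{x}+\bm{y}\|\}$ for either norm. Noise assumption with parameters $\sigma\ge 0$, $B>0$ on a random matrix $\bm{H}=[H_{ij}]\in\mathbb{R}^{n_1\times n_2}$ (with $n=n_1+n_2$): (1) the entries are independent (not necessarily identically distributed); (2) $\mathbb{E}[H_{ij}]=0$; (3) $\mathrm{Var}(H_{ij})\le\sigma^2$; (4) each $H_{ij}$ satisfies either (a) $|H_{ij}|\le B$, or (b) $H_{ij}$ has a symmetric distribution with $\mathbb{P}\{|H_{ij}|>B\}\le c_{\mathrm b}n^{-12}$, where $c_{\mathrm b}>0$ is a fixed universal constant. Dilation procedure: let $\bm{M}_{\mathsf d}=\begin{bmatrix}\bm{0}&\bm{M}_1\\ \bm{M}_2^\top&\bm{0}\end{bmatrix}\in\mathbb{R}^{n\times n}$. Let $\lambda_1^{\mathsf d},\lambda_2^{\mathsf d}$ be its two eigenvalues of largest modulus, labelled in decreasing order of real part (so $\lambda_1^{\mathsf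 d}\ge\lambda_2^{\mathsf d}$ when they are real), and let $\bm{u}_1^{\mathsf d}$ be a unit-norm (right) eigenvector of $\bm{M}_{\mathsf d}$ associated with $\lambda_1^{\mathsf d}$, taken real whenever $\lambda_1^{\mathsf d}$ is real. Write $\bm{u}_1^{\mathsf d}=\binom{\bm{u}_{1,1}^{\mathsf d}}{\bm{u}_{1,2}^{\mathsf d}}$ with $\bm{u}_{1,1}^{\mathsf d}$ having $n_1$ coordinates and $\bm{u}_{1,2}^{\mathsf d}$ having $n_2$ coordinates. The estimates are $\bm{u}=\bm{u}_{1,1}^{\mathsf d}/\|\bm{u}_{1,1}^{\mathsf d}\|_2$ and $\bm{v}=\bm{u}_{1,2}^{\mathsf d}/\|\bm{u}_{1,2}^{\mathsf d}\|_2$. Incoherence parameter $\mu$: the smallest number such that all entries of the eigenvectors $\frac{1}{\sqrt2}\binom{\bm{u}^\star}{\bm{v}^\star}$ and $\frac{1}{\sqrt2}\binom{\bm{u}^\star}{-\bm{v}^\star}$ of the symmetric rank-2 matrix $\begin{bmatrix}\bm{0}&\bm{M}^\star\\ \bm{M}^{\star\top}&\bm{0}\end{bmatrix}$ (associated with its eigenvalues $\lambda^\star$ and $-\lambda^\star$) are at most $\sqrt{\mu/n}$ in magnitude. *)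

(* Defs.v *)
From HB Require Import structures.
From mathcomp Require Export all_boot all_order all_algebra.
From mathcomp Require Export all_classical all_reals all_analysis.
From mathcomp Require Export complex.

Set Implicit Arguments.
Unset Strict Implicit.
Unset Printing Implicit Defensive.

Export Order.TTheory GRing.Theory Num.Theory.
Export numFieldNormedType.Exports.

#[global] Open Scope classical_set_scope.
#[global] Open Scope ring_scope.

Section Vectors.
Variable R : realType.

(* Eigenvectors of a real nonsymmetric matrix may be complex, so all vectors
   are measured in R[i]^m; real ones are embedded by [cplx]. *)
Definition cplx m p (A : 'M[R]_(m, p)) : 'M[R[i]]_(m, p) :=
  map_mx (real_complex R) A.

Definition cmod (z : R[i]) : R := ComplexField.Normc.normc z.

Definition norm2 m (x : 'cV[R[i]]_m) : R :=
  Num.sqrt (\sum_i cmod (x i 0) ^+ 2).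

Definition norminf m (x : 'cV[R[i]]_m) : R :=
  \big[Num.max/0]_i cmod (x i 0).

Definition dot m (a : 'cV[R]_m) (x : 'cV[R[i]]_m) : R[i] :=
  ((cplx a)^T *m x) 0 0.

Definition min_pm m (N : 'cV[R[i]]_m -> R) (x : 'cV[R[i]]_m) (y : 'cV[R]_m)
    : R :=
  Num.min (N (x - cplx y)) (N (x + cplx y)).

Definition normalize m (x : 'cV[R[i]]_m) : 'cV[R[i]]_m :=
  ((norm2 x)^-1)%:C%C *: x.

End Vectors.

Section Dilation.
Variable R : realType.

Definition dilation n1 n2 (M1 M2 : 'M[R]_(n1, n2)) : 'M[R]_(n1 + n2) :=
  block_mx 0 M1 M2^T 0.

(* The eigenvalues are counted with algebraic multiplicity.  Ties in modulus
   or in real part are not broken: every admissible choice is related. *)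
Definition top_two_eigenvalues n (A : 'M[R[i]]_n) (l1 l2 : R[i]) : Prop :=
  exists s : seq R[i],
    [/\ char_poly A = \prod_(z <- [:: l1, l2 & s]) ('X - z%:P),
        forall z, z \in s -> cmod z <= cmod l1 /\ cmod z <= cmod l2
      & complex.Re l2 <= complex.Re l1].

(* Right eigenvectors, whereas the library's [eigenspace] is for row vectors. *)
Definition dilation_estimate n1 n2 (M1 M2 : 'M[R]_(n1, n2))
    (u : 'cV[R[i]]_n1) (v : 'cV[R[i]]_n2) : Prop :=
  let Md := cplx (dilation M1 M2) in
  exists (l1 l2 : R[i]) (w : 'cV[R[i]]_(n1 + n2)),
    [/\ top_two_eigenvalues Md l1 l2,
        Md *m w = l1 *: w,
        norm2 w = 1,
        complex.Im l1 = 0 -> forall i, complex.Im (w i 0) = 0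
      & u = normalize (usubmx w) /\ v = normalize (dsubmx w)].

Definition incoherence_bound n1 n2 (us : 'cV[R]_n1) (vs : 'cV[R]_n2) (m : R)
    : Prop :=
  let bounded (w : 'cV[R]_(n1 + n2)) :=
    forall i, `|w i 0| <= Num.sqrt (m / (n1 + n2)%:R) in
  [/\ 0 <= m,
      bounded ((Num.sqrt 2)^-1 *: col_mx us vs)
    & bounded ((Num.sqrt 2)^-1 *: col_mx us (- vs))].

Definition is_incoherence n1 n2 (us : 'cV[R]_n1) (vs : 'cV[R]_n2) (mu : R)
    : Prop :=
  incoherence_bound us vs mu /\
  forall m, incoherence_bound us vs m -> mu <= m.

Definition noise_level (sigma B : R) (n : nat) : R :=
  Num.max (sigma * Num.sqrt (n%:R * ln n%:R)) (B * ln n%:R).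

End Dilation.

Section Probability.
Context (R : realType) (d : measure_display) (T : measurableType d).
Variable P : probability T R.

Definition mutually_independent (I : finType) (X : I -> {RV P >-> R}) : Prop :=
  forall (J : {set I}) (U : I -> set R), (forall i, measurable (U i)) ->
  P (\bigcap_(i in [set j | j \in J]) (X i @^-1` U i)) =
  (\prod_(i in J) P (X i @^-1` U i))%E.

Definition sigma_of (I : Type) (X : I -> {RV P >-> R}) : set (set T) :=
  <<s [set A | exists i (U : set R), measurable U /\ A = X i @^-1` U] >>.

Definition independent_families (I J : Type)
    (X : I -> {RV P >-> R}) (Y : J -> {RV P >-> R}) : Prop :=
  forall A B, sigma_of X A -> sigma_of Y B ->
  P (A `&` B) = (P A * P B)%E.

Definition symmetric_law (X : {RV P >-> R}) : Prop :=
  forall U : set R, measurable U ->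
  P (X @^-1` U) = P ((fun w => - X w) @^-1` U).

Definition entries n1 n2 (H : 'I_n1 -> 'I_n2 -> {RV P >-> R})
    (ij : 'I_n1 * 'I_n2) : {RV P >-> R} := H ij.1 ij.2.

Definition random_mx n1 n2 (H : 'I_n1 -> 'I_n2 -> {RV P >-> R}) (w : T)
    : 'M[R]_(n1, n2) := \matrix_(i, j) H i j w.

(* ['E_P[X] = 0] also forces integrability: the library's integral is the
   difference of the integrals of the positive and negative parts, and
   [+oo - +oo = -oo] in [\bar R]. *)
Definition noise_assumption (cb sigma B : R) n1 n2
    (H : 'I_n1 -> 'I_n2 -> {RV P >-> R}) : Prop :=
  [/\ mutually_independent (entries H),
      forall i j, ('E_P[H i j] = 0)%E,
      forall i j, ('V_P[H i j] <= (sigma ^+ 2)%:E)%E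
    & forall i j,
        {ae P, forall w, `|H i j w| <= B} \/
        (symmetric_law (H i j) /\
         (P [set w | (B < `|H i j w|)%R] <=
            (cb / (n1 + n2)%:R ^+ 12)%:E)%E)].

(* No measurability is required of the event [E] itself. *)
Definition with_probability_at_least (p : R) (E : set T) : Prop :=
  exists A, [/\ measurable A, A `<=` E & (p%:E <= P A)%E].

End Probability.

(* Main.v *)
(** Write the dilation as [S + H], where [S] is symmetric of rank two with
    eigenvalues [lam] and [- lam] and [H] has independent entries.  The noise is
    first truncated at [B].

    In the expectation of [(a^T H^k x) ^ N], expanded over [N]-tuples of directed
    walks, only tuples in which every directed edge is repeated survive.  Given
    which steps share an edge, such a tuple is determined by the heads of the
    distinct edges and by the starting points of the edge classes that consist
    of initial steps only; each of these classes has at least two elements, so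
    its starting point is summed against [a i ^ 2] and costs nothing.  With
    [m = N k] of order [log n] this yields
    [|a^T H^k x| <= (C nu)^k max |x i|] for all [k] up to [log n], and the same
    count for alternating closed walks bounds the trace of a power of [H H^T],
    hence the operator norm of [H].

    On this event a Bauer-Fike bound, an intermediate value argument for
    [det (x - S - t H)] in [t], and the simplicity of the eigenvalue near [lam]
    show that the top eigenvalue is real and that its eigenvector is close to
    that of [S].  Its linear forms are then read off the truncated Neumann
    series [w = sum_k r^-(k+1) H^k S w + r^-K H^K w]. *)
Require Import Defs.
From mathcomp Require Import ring lra zify measurable_realfun.

Set Implicit Arguments.
Unset Strict Implicit.
Unset Printing Implicit Defensive.

(** * Bounded random variables and their expectations *)

Section BoundedMeasurable.
Context (R : realType) (d : measure_display) (T : measurableType d).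
Implicit Types f g : T -> R.

(** The eigenvector [w] depends on the noise, so no moment bound applies to [a^T H^k w] itself. In
    the Neumann series the powers of [H] act on [S w], a random combination of two fixed vectors;
    hence only [a^T H^k x] with deterministic [a] and [x] has to be controlled, and [max |x i|] is
    then the incoherence level.

    Opposite positions of the dilation carry independent entries, so only an edge traversed again in
    the same direction is a repetition.

    Truncation keeps the means zero under either alternative of the noise assumption. Randomness is
    confined to one measurable event, on which the bounds hold for every admissible choice of
    eigenvector; so [u] and [v] may be arbitrary functions of the outcome.

    Thresholds are twice the root of the moment bound and the moments have order at least
    [14 log_2 n]; each application of Markov's inequality thus gains a factor [n^-14]. *)

Definition bounded_measurable f :=
  measurable_fun setT f /\ exists M, forall x, `|f x| <= M.

Lemma measurable_set_le f g : measurable_fun setT f -> measurable_fun setT g ->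
  measurable [set x | f x <= g x].
Proof. by move=> mf mg; rewrite -[X in measurable X]setTI; exact: measurable_fun_le. Qed.

Lemma measurable_set_lt f g : measurable_fun setT f -> measurable_fun setT g ->
  measurable [set x | f x < g x].
Proof.
move=> mf mg; have -> : [set x | f x < g x] = ~` [set x | g x <= f x].
  by apply/seteqP; split => x /=; rewrite real_ltNge ?num_real// => /negP.
by apply: measurableC; exact: measurable_set_le.
Qed.

Lemma bm_cst r : bounded_measurable (cst r).
Proof. by split => //; exists `|r|. Qed.

Lemma bmD f g : bounded_measurable f -> bounded_measurable g ->
  bounded_measurable (fun x => f x + g x).
Proof.
move=> [mf [M hM]] [mg [N hN]]; split; first exact: measurable_funD.
by exists (M + N) => x; apply: le_trans (ler_normD _ _) (lerD _ _).
Qed.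

Lemma bmM f g : bounded_measurable f -> bounded_measurable g ->
  bounded_measurable (fun x => f x * g x).
Proof.
move=> [mf [M hM]] [mg [N hN]]; split; first exact: measurable_funM.
by exists (M * N) => x; rewrite normrM ler_pM.
Qed.

Lemma bm_sum (J : Type) (s : seq J) (Q : pred J) (F : J -> T -> R) :
  (forall j, Q j -> bounded_measurable (F j)) ->
  bounded_measurable (fun x => \sum_(j <- s | Q j) F j x).
Proof.
move=> h; elim: s => [|j s IH].
  by under eq_fun do rewrite big_nil; exact: bm_cst.
have [Qj|Qj] := boolP (Q j).
  by under eq_fun do rewrite big_cons Qj; apply: bmD => //; exact: h.
by under eq_fun do rewrite big_cons (negbTE Qj).
Qed.

Lemma bm_prod (J : Type) (s : seq J) (Q : pred J) (F : J -> T -> R) :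
  (forall j, Q j -> bounded_measurable (F j)) ->
  bounded_measurable (fun x => \prod_(j <- s | Q j) F j x).
Proof.
move=> h; elim: s => [|j s IH].
  by under eq_fun do rewrite big_nil; exact: bm_cst.
have [Qj|Qj] := boolP (Q j).
  by under eq_fun do rewrite big_cons Qj; apply: bmM => //; exact: h.
by under eq_fun do rewrite big_cons (negbTE Qj).
Qed.

Lemma bmX f n : bounded_measurable f -> bounded_measurable (fun x => f x ^+ n).
Proof.
move=> h; elim: n => [|n IH]; first by under eq_fun do rewrite expr0; exact: bm_cst.
by under eq_fun do rewrite exprS; exact: bmM.
Qed.

Lemma bm_indic (A : set T) : measurable A -> bounded_measurable (\1_A : T -> R).
Proof.
move=> mA; split; first exact: measurable_indic.
by exists 1 => x; rewrite indicE; case: (_ \in _); rewrite ?normr0 ?normr1.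
Qed.

Lemma bm_norm f : bounded_measurable f -> bounded_measurable (fun x => `|f x|).
Proof.
move=> [mf [M hM]]; split; first exact: measurableT_comp.
by exists M => x; rewrite normr_id.
Qed.

Variable P : probability T R.

(** Real-valued, so that later estimates are ordinary inequalities in [R]; on bounded measurable
    functions it agrees with the extended-real expectation. *)
Definition Ex f : R := \int[P]_x f x.

Lemma bm_integrable f : bounded_measurable f -> P.-integrable setT (EFin \o f).
Proof.
move=> [mf [M hM]]; apply: measurable_bounded_integrable => //.
  by rewrite (le_lt_trans (probability_le1 P measurableT)) ?ltry.
by exists M; split; [exact: num_real | move=> y My x _; apply: le_trans (hM x) (ltW My)].
Qed.

Lemma ExE f : bounded_measurable f -> ('E_P[f] = (Ex f)%:E)%E.
Proof.
move=> bf; rewrite /Ex /Rintegral fineK ?unlock//.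
exact: integrable_fin_num (bm_integrable bf).
Qed.

Lemma ExD f g : bounded_measurable f -> bounded_measurable g ->
  Ex (fun x => f x + g x) = Ex f + Ex g.
Proof. by move=> bf bg; rewrite /Ex RintegralD//; exact: bm_integrable. Qed.

Lemma ExZ r f : bounded_measurable f -> Ex (fun x => r * f x) = r * Ex f.
Proof. by move=> bf; rewrite /Ex RintegralZl//; exact: bm_integrable. Qed.

Lemma Ex_cst r : Ex (fun=> r) = r.
Proof.
have := Rintegral_cst P (@measurableT _ T) r; rewrite /Ex => ->.
by rewrite (_ : fine _ = 1) ?mulr1//; apply: (congr1 fine (probability_setT P)).
Qed.

Lemma Ex_sum (J : Type) (s : seq J) (Q : pred J) (F : J -> T -> R) :
  (forall j, Q j -> bounded_measurable (F j)) ->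
  Ex (fun x => \sum_(j <- s | Q j) F j x) = \sum_(j <- s | Q j) Ex (F j).
Proof.
move=> h; elim: s => [|j s IH].
  by under eq_fun do rewrite big_nil; rewrite big_nil Ex_cst.
have [Qj|Qj] := boolP (Q j).
  under eq_fun do rewrite big_cons Qj; rewrite big_cons Qj ExD ?IH//; first exact: h.
  exact: bm_sum.
by under eq_fun do rewrite big_cons (negbTE Qj); rewrite big_cons (negbTE Qj).
Qed.

Lemma Ex_le f g : bounded_measurable f -> bounded_measurable g ->
  (forall x, f x <= g x) -> Ex f <= Ex g.
Proof. by move=> bf bg h; apply: le_Rintegral => //; exact: bm_integrable. Qed.

Lemma Ex_norm f : bounded_measurable f -> `|Ex f| <= Ex (fun x => `|f x|).
Proof. by move=> bf; apply: le_normr_Rintegral => //; exact: bm_integrable. Qed.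

Lemma Ex_indic (A : set T) : measurable A -> P A = (Ex \1_A)%:E.
Proof. by move=> mA; rewrite -(ExE (bm_indic mA)) expectation_indic. Qed.

Lemma Ex_dist f g eps : bounded_measurable f -> bounded_measurable g ->
  (forall x, `|f x - g x| <= eps) -> `|Ex f - Ex g| <= eps.
Proof.
move=> bf bg h.
have bh : bounded_measurable (fun x => f x + -1 * g x).
  by apply: bmD => //; apply: bmM => //; exact: bm_cst.
have -> : Ex f - Ex g = Ex (fun x => f x + -1 * g x).
  rewrite ExD ?ExZ ?mulN1r//; by apply: bmM => //; exact: bm_cst.
apply: le_trans (Ex_norm bh) _; rewrite -[leRHS]Ex_cst; apply: Ex_le.
- exact: bm_norm.
- exact: bm_cst.
- by move=> x; rewrite mulN1r.
Qed.

Lemma markov_nonneg (f : T -> R) theta : bounded_measurable f -> (forall w, 0 <= f w) ->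
  0 < theta -> (P [set w | (theta < f w)%R] <= (Ex f / theta)%:E)%E.
Proof.
move=> bf f0 t0.
have mA : measurable [set w | theta < f w] by apply: measurable_set_lt => //; case: bf.
rewrite Ex_indic// lee_fin ler_pdivlMr// mulrC -ExZ; last exact: bm_indic.
apply: Ex_le => //; first by apply: bmM; [exact: bm_cst|exact: bm_indic].
move=> w; rewrite indicE; have [|_] := boolP (w \in _); last by rewrite mulr0.
by rewrite inE /= mulr1 => h; exact: ltW.
Qed.

Lemma markov_pow f N theta : bounded_measurable f -> ~~ odd N -> 0 < theta ->
  (P [set x | (theta < `|f x|)%R] <= (Ex (fun x => f x ^+ N) / theta ^+ N)%:E)%E.
Proof.
move=> bf eN t0.
have mA : measurable [set x | theta < `|f x|].
  by apply: measurable_set_lt => //; have [] := bm_norm bf.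
rewrite Ex_indic// lee_fin ler_pdivlMr ?exprn_gt0// mulrC -ExZ; last exact: bm_indic.
apply: Ex_le.
- by apply: bmM; [exact: bm_cst|exact: bm_indic].
- exact: bmX.
move=> x; rewrite indicE; have [|_] := boolP (x \in _); last first.
  by rewrite mulr0 exprn_even_ge0.
rewrite inE /= mulr1 => h; rewrite -[leRHS]ger0_norm ?exprn_even_ge0// normrX.
by rewrite lerXn2r// ?nnegrE ltW.
Qed.
End BoundedMeasurable.

(** * Product rule for bounded functions of independent variables *)

Section Factorization.
Context (R : realType) (d : measure_display) (T : measurableType d).
Variable P : probability T R.

Lemma bm_comp (X : T -> R) (f : R -> R) : measurable_fun setT X ->
  bounded_measurable f -> bounded_measurable (f \o X).
Proof.
move=> mX [mf [M hM]]; split; first exact: measurableT_comp.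
by exists M => x; exact: hM.
Qed.

Lemma sum_ltn_natr (K t : nat) : (t <= K)%N ->
  \sum_(k < K) ((k < t)%N)%:R = t%:R :> R.
Proof.
move=> tK; rewrite -natr_sum; congr _%:R.
rewrite -(big_mkord xpredT (fun k => nat_of_bool (k < t)%N)) (big_cat_nat (n := t)) //=.
rewrite [X in (X + _)%N](eq_big_nat _ _ (F2 := fun=> 1%N)); last first.
  by move=> i /andP[_ ->].
rewrite sum_nat_const_nat subn0 muln1 big_nat big1 ?addn0// => i /andP[ti _].
by rewrite ltnNge ti.
Qed.

(* Layer-cake approximation: [truncn (N * f y) / N] is a finite combination of
   indicators of superlevel sets. *)
Lemma Ex_indep_step (Z : T -> R) (X : T -> R) (f : R -> R) :
  bounded_measurable Z -> measurable_fun setT X -> bounded_measurable f ->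
  (forall U, measurable U -> Ex P (fun x => Z x * \1_U (X x)) =
                             Ex P Z * Ex P (fun x => \1_U (X x))) ->
  Ex P (fun x => Z x * f (X x)) = Ex P Z * Ex P (fun x => f (X x)).
Proof.
move=> bZ mX bf hU.
have bfX := bm_comp mX bf; have [mf [M hM]] := bf.
have M0 : 0 <= M by apply: le_trans (hM 0).
have [_ [MZ hZ]] := bZ.
have MZ0 : 0 <= MZ by apply: le_trans (normr_ge0 _) (hZ point).
have b1 (U : set R) : measurable U -> bounded_measurable (fun x => \1_U (X x) : R).
  move=> mU; exact: (bm_comp mX (bm_indic R mU)).
suff h (N : nat) : (0 < N)%N -> `|Ex P (fun x => Z x * f (X x)) - Ex P Z * Ex P (fun x => f (X x))|
    <= 2 * MZ / N%:R.
  apply/eqP; rewrite -subr_eq0 -normr_le0; apply/ler_addgt0Pl => e e0.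
  rewrite addr0.
  have := h (Num.truncn (2 * MZ / e)).+1 isT => /le_trans; apply.
  rewrite ler_pdivrMr ?ltr0n// [e * _]mulrC -ler_pdivrMr//.
  by apply/ltW; have := truncnS_gt (2 * MZ / e).
move=> N0; have NR : 0 < N%:R :> R by rewrite ltr0n.
(* The shift by [M] makes the argument of [truncn] nonnegative, and [K] bounds the number of
   levels. *)
pose U k := [set y : R | (k.+1%:R <= N%:R * (f y + M))].
have mU k : measurable (U k).
  apply: measurable_set_le => //.
  by apply: measurable_funM => //; apply: measurable_funD.
pose K := Num.truncn (N%:R * (2 * M)).
pose q y : R := (\sum_(k < K) \1_(U k) y) / N%:R - M.
have qf y : `|f y - q y| <= N%:R^-1.
  have h0 : 0 <= f y + M by have := hM y; rewrite ler_norml => /andP[? ?]; lra.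
  have h1 : f y + M <= 2 * M by have := hM y; rewrite ler_norml => /andP[? ?]; lra.
  have h2 : 0 <= N%:R * (f y + M) by rewrite mulr_ge0// ltW.
  set t := Num.truncn (N%:R * (f y + M)).
  have tK : (t <= K)%N by apply: le_truncn; rewrite ler_wpM2l// ltW.
  have -> : q y = t%:R / N%:R - M.
    rewrite /q -(sum_ltn_natr tK); congr (_ / _ - _); apply: eq_bigr => k _.
    rewrite indicE; congr (nat_of_bool _)%:R; rewrite /t truncn_gt_nat.
    by apply/idP/idP; rewrite inE.
  have := truncn_itv h2 => /andP[]; rewrite -/t => ht1 ht2.
  have -> : f y - (t%:R / N%:R - M) = (N%:R * (f y + M) - t%:R) / N%:R.
    by field; rewrite gt_eqF.
  rewrite normrM normfV [X in _ / X]gtr0_norm// ler_pdivrMr// mulVf ?gt_eqF//.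
  rewrite ger0_norm ?subr_ge0//; move: ht2; rewrite -natr1; lra.
have bq : bounded_measurable q.
  apply: bmD; last exact: bm_cst.
  apply: bmM; last exact: bm_cst.
  by apply: bm_sum => k _; exact: bm_indic.
have bqX := bm_comp mX bq.
have Eq : Ex P (fun x => Z x * q (X x)) = Ex P Z * Ex P (fun x => q (X x)).
  have -> : (fun x => Z x * q (X x)) =
      (fun x => N%:R^-1 * (\sum_(k < K) Z x * \1_(U k) (X x)) + (- M) * Z x).
    by apply/funext => x; rewrite /q -mulr_sumr; ring.
  have -> : (fun x => q (X x)) = (fun x => N%:R^-1 * (\sum_(k < K) \1_(U k) (X x)) + (- M) * 1).
    by apply/funext => x; rewrite /q; ring.
  have bs : bounded_measurable (fun x => \sum_(k < K) Z x * \1_(U k) (X x)).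
    by apply: bm_sum => k _; apply: bmM => //; exact: b1.
  have bs' : bounded_measurable (fun x => \sum_(k < K) \1_(U k) (X x) : R).
    by apply: bm_sum => k _; exact: b1.
  have bc (r : R) : bounded_measurable (fun _ : T => r) by exact: bm_cst.
  rewrite !ExD; do ?[by apply: bmM => //; exact: bm_cst].
  rewrite !ExZ//; do ?[exact: bm_cst].
  rewrite !Ex_sum; last 2 first.
    by move=> k _; exact: b1.
    by move=> k _; apply: bmM => //; exact: b1.
  rewrite Ex_cst mulrDr; under eq_bigr do rewrite hU//.
  by rewrite -mulr_sumr; ring.
have d1 : `|Ex P (fun x => Z x * f (X x)) - Ex P (fun x => Z x * q (X x))| <= MZ / N%:R.
  apply: Ex_dist; [exact: bmM|exact: bmM|move=> x].
  by rewrite -mulrBr normrM ler_pM.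
have d2 : `|Ex P (fun x => f (X x)) - Ex P (fun x => q (X x))| <= N%:R^-1.
  by apply: Ex_dist => // x; exact: qf.
have d3 : `|Ex P Z| <= MZ.
  apply: le_trans (Ex_norm P bZ) _; rewrite -[leRHS](Ex_cst P); apply: Ex_le => //.
    exact: bm_norm.
  exact: bm_cst.
have -> : Ex P (fun x => Z x * f (X x)) - Ex P Z * Ex P (fun x => f (X x)) =
  (Ex P (fun x => Z x * f (X x)) - Ex P (fun x => Z x * q (X x))) -
  Ex P Z * (Ex P (fun x => f (X x)) - Ex P (fun x => q (X x))).
  by rewrite Eq; ring.
apply: le_trans (ler_normB _ _) _.
have -> : 2 * MZ / N%:R = MZ / N%:R + MZ / N%:R by ring.
by rewrite lerD// normrM ler_pM.
Qed.

(** Indicators are replaced by bounded functions one index at a time: outside the list [s] every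
    [g i] is still an indicator, and [Ex_indep_step] frees the index at the head of the list. *)
Lemma Ex_prod_indep (I : finType) (X : I -> T -> R) (g : I -> R -> R) :
  (forall i, measurable_fun setT (X i)) ->
  (forall U : I -> set R, (forall i, measurable (U i)) ->
     Ex P (fun x => \prod_i \1_(U i) (X i x)) =
     \prod_i Ex P (fun x => \1_(U i) (X i x))) ->
  (forall i, bounded_measurable (g i)) ->
  Ex P (fun x => \prod_i g i (X i x)) = \prod_i Ex P (fun x => g i (X i x)).
Proof.
move=> mX h0.
suff H (s : seq I) : forall g : I -> R -> R, (forall i, bounded_measurable (g i)) ->
    (forall i, i \notin s -> exists2 U, measurable U & g i = \1_U) ->
    Ex P (fun x => \prod_i g i (X i x)) = \prod_i Ex P (fun x => g i (X i x)).
  by move=> bg; apply: (H (enum I)) => // i; rewrite mem_enum.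
elim: s => [|i0 s IH] {}g bg hg.
  have /choice[U hU] : forall i, exists U, measurable U /\ g i = \1_U.
    by move=> i; have [U mU gU] := hg i isT; exists U.
  have eU i : g i = \1_(U i) by have [] := hU i.
  have := h0 U (fun i => (hU i).1); rewrite (eq_bigr (fun i => Ex P (fun x => g i (X i x)))); last first.
    by move=> i _; rewrite eU.
  by move=> <-; congr Ex; apply/funext => x; apply: eq_bigr => i _; rewrite eU.
pose g' U i := if i == i0 then \1_U else g i.
have bgX i : bounded_measurable (fun x => g i (X i x)) by exact: (bm_comp (mX i) (bg i)).
have bZ : bounded_measurable (fun x => \prod_(i | i != i0) g i (X i x)).
  by apply: bm_prod => i _.
have key U : measurable U ->
    Ex P (fun x => (\prod_(i | i != i0) g i (X i x)) * \1_U (X i0 x)) =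
    (\prod_(i | i != i0) Ex P (fun x => g i (X i x))) * Ex P (fun x => \1_U (X i0 x)).
  move=> mU.
  have b' i : bounded_measurable (g' U i).
    by rewrite /g'; case: ifP => // _; exact: bm_indic.
  have i' i : i \notin s -> exists2 V, measurable V & g' U i = \1_V.
    move=> ns; rewrite /g'; case: ifP => [_|/negbT ni]; first by exists U.
    by apply: hg; rewrite inE negb_or ni.
  have e0 : g' U i0 = \1_U by rewrite /g' eqxx.
  have e1 i : i != i0 -> g' U i = g i by rewrite /g' => /negbTE ->.
  have := IH _ b' i'; rewrite (bigD1 i0) //= e0 [in RHS]mulrC.
  rewrite (eq_bigr (fun i => Ex P (fun x => g i (X i x)))); last first.
    by move=> i ni; rewrite e1.
  move=> <-; congr Ex; apply/funext => x; rewrite [RHS](bigD1 i0) //= e0 [RHS]mulrC.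
  by congr (_ * _); apply: eq_bigr => i ni; rewrite e1.
have EZ : Ex P (fun x => \prod_(i | i != i0) g i (X i x)) =
    \prod_(i | i != i0) Ex P (fun x => g i (X i x)).
  (* With the whole line as event, the factor at [i0] becomes 1 and the rule for the other indices
     remains. *)
  have := key setT measurableT; rewrite indicT /= Ex_cst mulr1 => <-.
  by congr Ex; apply/funext => x; rewrite mulr1.
rewrite [RHS](bigD1 i0)//= mulrC -EZ -Ex_indep_step//.
- by congr Ex; apply/funext => x; rewrite (bigD1 i0)//= mulrC.
- by move=> U mU; rewrite key// EZ.
Qed.

End Factorization.

(** * Counting repetition patterns of walks *)

Local Close Scope classical_set_scope.

Section PatternSum.
Variables (R : realFieldType) (F S I : finType) (ord : S -> nat).
Hypothesis ord_inj : injective ord.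

(** A partition of the slots into blocks of at least two elements, encoded by the map that sends a
    slot to the earliest one of its block. That the representative comes earlier is what lets an
    alternating walk be reconstructed step by step. *)
Definition is_pattern (rho : {ffun S -> S}) : bool :=
  [forall s, [&& rho (rho s) == rho s, (ord (rho s) <= ord s)%N &
     [exists s', (s' != s) && (rho s' == rho s)]]].

Definition reps (rho : {ffun S -> S}) : {set S} := [set s | rho s == s].

Definition first_slot (x : S -> I) : {ffun S -> S} :=
  [ffun s => [arg min_(s' < s | x s' == x s) ord s']%N].

Lemma first_slotP (x : S -> I) s :
  x (first_slot x s) = x s /\
  (forall s', x s' = x s -> (ord (first_slot x s) <= ord s')%N).
Proof.
rewrite ffunE; case: arg_minnP => [|s0 /eqP e0 h]; first by [].
by split=> // s' /eqP; apply: h.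
Qed.

Lemma first_slot_eq (x : S -> I) s s' :
  (first_slot x s == first_slot x s') = (x s == x s').
Proof.
have [e1 h1] := first_slotP x s; have [e2 h2] := first_slotP x s'.
apply/eqP/eqP => [e|e]; first by rewrite -e1 e e2.
apply: ord_inj; apply/eqP; rewrite eqn_leq h1 ?e2 ?e// h2// e1 e//.
Qed.

Definition repeated (x : S -> I) : bool :=
  [forall s, exists s', (s' != s) && (x s' == x s)].

Lemma first_slot_pattern (x : S -> I) :
  repeated x -> is_pattern (first_slot x).
Proof.
move=> /forallP rx; apply/forallP => s.
have [e h] := first_slotP x s.
rewrite first_slot_eq e eqxx h//=.
have /existsP[s' /andP[n e']] := rx s.
by apply/existsP; exists s'; rewrite n first_slot_eq.
Qed.

Lemma card_reps_first_slot (x : S -> I) :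
  #|reps (first_slot x)| = #|[set x s | s : S]|.
Proof.
rewrite -(card_in_imset (f := x) (D := reps (first_slot x))); last first.
  move=> s s'; rewrite !inE => /eqP es /eqP es' e.
  by rewrite -es -es'; apply/eqP; rewrite first_slot_eq e.
congr #|pred_of_set _|; apply/setP => y; apply/imsetP/imsetP => -[s _ ->].
  by exists s.
exists (first_slot x s); last by have [->] := first_slotP x s.
by rewrite inE first_slot_eq; have [->] := first_slotP x s.
Qed.

(** Each representative is the image of another slot of its block, so there are at least as many
    non-representatives as representatives. *)
Lemma is_pattern_card rho : is_pattern rho -> (2 * #|reps rho| <= #|S|)%N.
Proof.
move=> /forallP p.
have p1 s : rho (rho s) = rho s by have /and3P[/eqP] := p s.
have inR s : rho s \in reps rho by rewrite inE p1.
rewrite mul2n -addnn -[X in (_ <= X)%N](cardsC (reps rho)) leq_add2l.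
have sub : reps rho \subset [set rho s | s in ~: reps rho].
  apply/fintype.subsetP => r; rewrite inE => /eqP er.
  have /and3P[_ _ /existsP[s /andP[ns /eqP es]]] := p r.
  apply/imsetP; exists s; last by rewrite es er.
  by rewrite !inE es er eq_sym.
by apply: leq_trans (subset_leq_card sub) (leq_imset_card _ _).
Qed.

(** Bound for the mixed moment of the centred entries listed by [x]: two occurrences of each
    distinct entry are charged to its second moment and the others to the uniform bound [B]; an
    entry listed once makes the moment vanish. *)
Definition repeated_weight (sg2 B : R) (x : S -> I) : R :=
  if repeated x then
    sg2 ^+ #|[set x s | s : S]| * B ^+ (#|S| - 2 * #|[set x s | s : S]|)
  else 0.

(* The number of patterns with [t] representatives is at most
   ['C(m, t) * t ^ (m - t)]: choose the set of representatives, then map every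
   other slot to one of them. *)
Lemma sum_patterns (nR sg2 B L : R) :
  0 <= nR -> 0 <= sg2 -> 0 <= B -> 0 <= L ->
  #|S|%:R * nR * sg2 <= L ^+ 2 -> #|S|%:R * B <= L ->
  \sum_(rho : {ffun S -> S} | is_pattern rho)
     nR ^+ #|reps rho| * (sg2 ^+ #|reps rho| * B ^+ (#|S| - 2 * #|reps rho|))
  <= (2 * L) ^+ #|S|.
Proof.
move=> n0 s0 B0 L0 hL1 hL2.
(* Non-representatives may be sent anywhere in [S], at a cost of [m ^ (m - t)] for [t]
   representatives. Since [m - t = t + (m - 2 * t)], each of these factors [m] joins one [nR * sg2]
   or one [B], as the two conditions on [L] require. The choice of [A] gives the factor [2 ^ m]. *)
pose G (A : {set S}) s : {set S} := if s \in A then [set s] else [set: S].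
pose c t := nR ^+ t * (sg2 ^+ t * B ^+ (#|S| - 2 * t)).
have c0 t : 0 <= c t by rewrite !mulr_ge0 ?exprn_ge0.
have cG A : #|family (G A)| = (#|S| ^ (#|S| - #|A|))%N.
  rewrite card_family foldrE big_map big_enum /= (bigID (mem A)) /=.
  rewrite big1 ?mul1n; last by move=> s sA; rewrite /G sA cards1.
  rewrite (eq_bigr (fun=> #|S|)); last first.
    by move=> s /negbTE sA; rewrite /G sA cardsT.
  rewrite prod_nat_const; congr (_ ^ _)%N.
  by rewrite -(cardsC A) addKn; apply: eq_card => s; rewrite !inE.
have step1 : \sum_(rho : {ffun S -> S} | is_pattern rho) c #|reps rho| <=
   \sum_(A : {set S} | (2 * #|A| <= #|S|)%N)
     \sum_(rho in family (G A)) c #|A|.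
  rewrite (partition_big reps (fun A => (2 * #|A| <= #|S|)%N)) /=; last first.
    exact: is_pattern_card.
  apply: ler_sum => A hA; rewrite big_mkcond [leRHS]big_mkcond.
  apply: ler_sum => rho _; case: ifP => [/andP[p /eqP eA]|_]; last by case: ifP.
  rewrite eA; case: ifP => // /negP[]; apply/familyP => s.
  by rewrite -eA /G inE; case: ifP; rewrite inE.
apply: le_trans step1 _.
have step2 : \sum_(A : {set S} | (2 * #|A| <= #|S|)%N)
     \sum_(rho in family (G A)) c #|A| <= \sum_(A : {set S}) L ^+ #|S|.
  rewrite [leLHS]big_mkcond; apply: ler_sum => A _; case: ifP => hA; last first.
    by rewrite exprn_ge0.
  rewrite sumr_const cG -mulr_natl natrX /c.
  set t := #|A| in hA *; set m := #|S| in hA hL1 hL2 *.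
  have -> : (m - t = t + (m - 2 * t))%N by lia.
  have -> : m%:R ^+ (t + (m - 2 * t)) * (nR ^+ t * (sg2 ^+ t * B ^+ (m - 2 * t)))
    = (m%:R * nR * sg2) ^+ t * (m%:R * B) ^+ (m - 2 * t).
    by rewrite exprD !exprMn; ring.
  rewrite [leRHS](_ : _ = L ^+ (2 * t + (m - 2 * t))); last by congr (_ ^+ _); lia.
  rewrite exprD exprM; apply: ler_pM.
  - by rewrite exprn_ge0// !mulr_ge0.
  - by rewrite exprn_ge0// mulr_ge0.
  - by rewrite lerXn2r// nnegrE ?exprn_ge0// !mulr_ge0.
  - by rewrite lerXn2r// nnegrE ?exprn_ge0// !mulr_ge0.
apply: le_trans step2 _.
have -> : \sum_(A : {set S}) L ^+ #|S| = (2 ^ #|S|)%:R * L ^+ #|S|.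
  rewrite sumr_const -[LHS]mulr_natl; congr (_%:R * _).
  rewrite -[in RHS]cardsT -card_powerset.
  by apply: eq_card => A; rewrite powersetT inE.
by rewrite natrX exprMn.
Qed.

(** Configurations are sorted by the coincidences among their entries. The counting hypothesis
    admits all configurations compatible with [rho], also those with further coincidences, so that
    no distinctness has to be tracked when it is verified. *)
Lemma pattern_sum (e : F -> S -> I) (W : F -> R) (W0 nR sg2 B L : R) :
  (forall f, 0 <= W f) -> 0 <= W0 ->
  0 <= nR -> 0 <= sg2 -> 0 <= B -> 0 <= L ->
  #|S|%:R * nR * sg2 <= L ^+ 2 -> #|S|%:R * B <= L ->
  (forall rho : {ffun S -> S}, is_pattern rho ->
     \sum_(f | [forall s, e f (rho s) == e f s]) W f
       <= W0 * nR ^+ #|reps rho|) ->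
  \sum_f W f * repeated_weight sg2 B (e f) <= W0 * (2 * L) ^+ #|S|.
Proof.
move=> Wge0 W00 n0 s0 B0 L0 hL1 hL2 h.
pose c t := (sg2 ^+ t * B ^+ (#|S| - 2 * t)).
have c0 t : 0 <= c t by rewrite !mulr_ge0 ?exprn_ge0.
apply: (@le_trans _ _ (\sum_(rho | is_pattern rho) W0 * (nR ^+ #|reps rho| * c #|reps rho|))); last first.
  rewrite -mulr_sumr ler_wpM2l// sum_patterns//.
rewrite (bigID (fun f => repeated (e f))) /= [X in _ + X]big1 ?addr0; last first.
  by move=> f /negbTE nr; rewrite /repeated_weight nr mulr0.
rewrite (partition_big (fun f => first_slot (e f)) is_pattern) /=; last first.
  by move=> f; apply: first_slot_pattern.
apply: ler_sum => rho prho; rewrite mulrA.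
apply: le_trans (ler_wpM2r (c0 _) (h _ prho)).
rewrite mulr_suml big_mkcond [leRHS]big_mkcond; apply: ler_sum => f _.
case: ifP => [/andP[rf /eqP ef]|_]; last by case: ifP => // _; rewrite mulr_ge0.
rewrite /repeated_weight rf -card_reps_first_slot ef -/(c _).
case: ifP => // /negP[]; apply/forallP => s.
by rewrite -ef; have [->] := first_slotP (e f) s.
Qed.

End PatternSum.

Lemma eq_repeated_weight (R : realFieldType) (S I J : finType) (sg2 B : R)
    (x : S -> I) (y : S -> J) :
  (forall s s', (x s == x s') = (y s == y s')) ->
  repeated_weight sg2 B x = repeated_weight sg2 B y.
Proof.
move=> e; have rinj : injective (fun s : S => enum_rank s : nat).
  by move=> s s' /val_inj/enum_rank_inj.
rewrite /repeated_weight -!(card_reps_first_slot rinj).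
have -> : first_slot (fun s : S => enum_rank s : nat) x =
          first_slot (fun s : S => enum_rank s : nat) y.
  apply/ffunP => s; rewrite !ffunE.
  by have -> : (fun s' => x s' == x s) = (fun s' => y s' == y s) by apply/funext.
congr (if _ then _ else _); apply: eq_forallb => s; apply: eq_existsb => s'.
by rewrite e.
Qed.

Section InjSum.
Lemma sum_le_inj (R : realFieldType) (F G : finType) (A : pred F) (h : F -> G)
    (B : pred G) (W : F -> R) (W' : G -> R) :
  {in A &, injective h} -> (forall f, A f -> B (h f)) ->
  (forall f, A f -> W f <= W' (h f)) -> (forall g, 0 <= W' g) ->
  \sum_(f | A f) W f <= \sum_(g | B g) W' g.
Proof.
move=> hi hB hW W0.
apply: le_trans (ler_sum _ hW) _.
have -> : \sum_(f | A f) W' (h f) = \sum_(g in h @: [set f | A f]) W' g.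
  rewrite big_imset /=; first by apply: eq_bigl => f; rewrite inE.
  by move=> f f'; rewrite !inE; apply: hi.
rewrite big_mkcond [leRHS]big_mkcond; apply: ler_sum => g _.
case: ifP => [/imsetP[f]|_]; last by case: ifP.
by rewrite inE => /hB Bf ->; rewrite Bf.
Qed.
End InjSum.

Section OpenWalks.
Variables (R : realFieldType) (V : finType) (v0 : V) (N k : nat).
Variable alpha : V -> R.
Hypothesis alpha0 : forall v, 0 <= alpha v.
Hypothesis alpha2 : \sum_v alpha v ^+ 2 <= 1.

Local Notation slot := ('I_N * 'I_k.+1)%type.
Local Notation walks := {ffun 'I_N -> {ffun 'I_k.+2 -> V}}.

Definition walk_edge (f : walks) (s : slot) : V * V :=
  (f s.1 (widen_ord (leqnSn _) s.2), f s.1 (lift ord0 s.2)).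

Definition slot_rank (s : slot) : nat := enum_rank s.

Let alpha1 v : alpha v <= 1.
Proof.
rewrite -(@ler_pXn2r _ 2) ?nnegrE// expr1n; apply: le_trans alpha2.
by rewrite (bigD1 v) //= lerDl sumr_ge0 // => i _; rewrite exprn_ge0.
Qed.

Lemma prod_le1 (J : finType) (P : pred J) (g : J -> V) :
  0 <= \prod_(j | P j) alpha (g j) <= 1.
Proof.
rewrite prodr_ge0//= prodr_ile1// => j _; by rewrite alpha0 alpha1.
Qed.

(* Every step of a walk whose edge class contains a non-initial slot has its
   tail equal to the head of the preceding step, so the only free starting
   points are those of classes made of initial slots only; such a class has at
   least two elements, hence contributes [\sum_v alpha v ^+ 2]. *)
Lemma sum_open_walks (rho : {ffun slot -> slot}) :
  is_pattern slot_rank rho ->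
  \sum_(f : walks | [forall s, walk_edge f (rho s) == walk_edge f s])
     \prod_l alpha (f l ord0) <= #|V|%:R ^+ #|reps rho|.
Proof.
move=> /forallP prho.
have p1 s : rho (rho s) = rho s by have /and3P[/eqP] := prho s.
have p2 s : exists2 s', s' != s & rho s' = rho s.
  by have /and3P[_ _ /existsP[s' /andP[ns /eqP es]]] := prho s; exists s'.
pose initial r := (r \in reps rho) && [forall s, (rho s == r) ==> (s.2 == ord0)].
pose Q r (y : V * V) := if r \in reps rho then initial r || (y.2 == v0)
                       else y == (v0, v0).
pose w r (y : V * V) : R := if initial r then alpha y.2 ^+ 2 else 1.
(* The code of a walk tuple. At a representative it stores the head and then the starting point, the
   reverse of the order in [walk_edge]; [v0] fills the coordinates that carry no information. *)
pose G (f : walks) : {ffun slot -> V * V} := [ffun r =>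
  if r \in reps rho then ((walk_edge f r).2,
       if initial r then (walk_edge f r).1 else v0) else (v0, v0)].
have w0 r y : 0 <= w r y by rewrite /w; case: ifP => // _; rewrite exprn_ge0.
apply: (@le_trans _ _ (\sum_(g in family Q) \prod_r w r (g r))); last first.
  rewrite -bigA_distr_big_dep /=.
  apply: (@le_trans _ _ (\prod_(r in reps rho) #|V|%:R)); last first.
    by rewrite prodr_const.
  rewrite [leRHS]big_mkcond; apply: ler_prod => r _.
  rewrite sumr_ge0 //=; case: ifP => rr; last first.
    rewrite (big_pred1 (v0, v0)); last by move=> y; rewrite /Q rr.
    by rewrite /w /initial rr.
  have [ir|ir] := boolP (initial r).
    rewrite (eq_bigl xpredT); last by move=> y; rewrite /Q rr ir.
    rewrite -(pair_bigA _ (fun a b => w r (a, b))) /=.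
    rewrite (eq_bigr (fun=> \sum_v alpha v ^+ 2)); last first.
      by move=> i _; apply: eq_bigr => j _; rewrite /w ir.
    by rewrite sumr_const -[leLHS]mulr_natl ler_piMr.
  rewrite (eq_bigl (fun y => true && (y.2 == v0))); last first.
    by move=> y; rewrite /Q rr (negbTE ir).
  rewrite -(pair_big xpredT (pred1 v0) (fun a b => w r (a, b))) /=.
  rewrite (eq_bigr (fun=> 1)) ?sumr_const// => a _.
  by rewrite big_pred1_eq /w (negbTE ir).
apply: (@sum_le_inj _ _ _ _ G).
- move=> f f' /forallP cf /forallP cf' /ffunP eG.
  have rr s : rho s \in reps rho by rewrite inE p1.
  have heads s : (walk_edge f s).2 = (walk_edge f' s).2.
    rewrite -(eqP (cf s)) -(eqP (cf' s)).
    by have := eG (rho s); rewrite !ffunE rr => -[].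
  have tails l : (walk_edge f (l, ord0)).1 = (walk_edge f' (l, ord0)).1.
    have [ir|] := boolP (initial (rho (l, ord0))).
      rewrite -(eqP (cf (l, ord0))) -(eqP (cf' (l, ord0))).
      by have := eG (rho (l, ord0)); rewrite !ffunE rr ir => -[].
    rewrite /initial rr andTb => /forallPn[s']; rewrite negb_imply => /andP[/eqP es ns].
    rewrite -(eqP (cf (l, ord0))) -(eqP (cf' (l, ord0))) -es.
    rewrite (eqP (cf s')) (eqP (cf' s')).
    case: (unliftP ord0 s'.2) ns => [j ej|->]; last by rewrite eqxx.
    move=> _; have := heads (s'.1, widen_ord (leqnSn _) j).
    rewrite /walk_edge /= ej; set x := lift _ _; set y := widen_ord _ _.
    by have -> : x = y by apply: val_inj.
  apply/ffunP => l; apply/ffunP => i.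
  case: (unliftP ord0 i) => [j ->|->]; first exact: (heads (l, j)).
  have := tails l; rewrite /walk_edge /=.
  by have -> : widen_ord (leqnSn k.+1) ord0 = ord0 by apply: val_inj.
- move=> f _; apply/familyP => r; rewrite ffunE.
  have -> y : (y \in Q r) = Q r y by [].
  rewrite /Q; have [_|_] := boolP (r \in reps rho); last by rewrite eqxx.
  by have [_|_] := boolP (initial r); rewrite //= eqxx.
- move=> f /forallP cf.
  rewrite (partition_big (fun l => rho (l, ord0)) xpredT) //=.
  apply: ler_prod => r _; have /andP[-> /= le1] := prod_le1 (fun l => rho (l, ord0) == r) (fun l => f l ord0).
  rewrite /w; case: ifP => // ir; rewrite ffunE ir.
  have /andP[rr /forallP init] := ir; rewrite rr /=.
  have er : rho r = r by move: rr; rewrite inE => /eqP.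
  have [s' ns es] := p2 r.
  have r0 : r.2 = ord0 by have /implyP/(_ _)/eqP-> := init r; rewrite // er.
  have s0 : s'.2 = ord0 by have /implyP/(_ _)/eqP-> := init s'; rewrite // es er.
  have er1 : r = (r.1, ord0) by rewrite -r0; case: (r).
  have es1 : s' = (s'.1, ord0) by rewrite -s0; case: (s').
  have nl : s'.1 != r.1 by apply: contra ns => /eqP e; rewrite es1 er1 e.
  have ealpha l : rho (l, ord0) = r -> f l ord0 = (walk_edge f r).1.
    move=> e; rewrite -e (eqP (cf (l, ord0))) /walk_edge /=.
    by have -> : widen_ord (leqnSn k.+1) ord0 = ord0 by apply: val_inj.
  (* An initial class contains two different walks, [r.1] and [s'.1], with the same starting point;
     they supply the square, and all other factors are at most 1. *)
  rewrite (bigD1 r.1) /=; last by rewrite -er1 er.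
  rewrite (bigD1 s'.1) /=; last by rewrite -es1 es er eqxx.
  rewrite !ealpha -?er1 -?es1 ?es// mulrA -expr2 ler_piMr ?exprn_ge0//.
  by have /andP[] := prod_le1 (fun l => (rho (l, ord0) == r) && (l != r.1) && (l != s'.1)) (fun l => f l ord0).
- by move=> g; apply: prodr_ge0.
Qed.
End OpenWalks.

Section AlternatingWalks.
Variables (R : realFieldType) (V : finType) (m : nat).

(** Odd steps are taken by [H^T], so they use the entry of [H] at the reversed pair. *)
Definition alt_edge (f : {ffun 'I_m.+1 -> V}) (s : 'I_m) : V * V :=
  let x := f (widen_ord (leqnSn m) s) in let y := f (lift ord0 s) in
  if odd s then (y, x) else (x, y).

(** Read the walk from its start. A step that is not a representative reuses an edge seen earlier,
    whose two ends are known, and the parity of the step tells which end comes next. Only the first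
    vertex and one vertex per representative are free. *)
Lemma sum_alternating_walks (rho : {ffun 'I_m -> 'I_m}) :
  is_pattern (@nat_of_ord m) rho ->
  \sum_(f : {ffun 'I_m.+1 -> V} |
        [forall s, alt_edge f (rho s) == alt_edge f s]) (1 : R)
    <= #|V|%:R * #|V|%:R ^+ #|reps rho|.
Proof.
move=> /forallP prho.
have p1 s : rho (rho s) = rho s by have /and3P[/eqP] := prho s.
have p2 s : (rho s <= s)%N by have /and3P[] := prho s.
have [v0 _|V0] := pickP V; last first.
  rewrite big1 ?mulr_ge0 ?exprn_ge0// => f _; by have := V0 (f ord0).
pose Q (i : 'I_m.+1) (y : V) :=
  if unlift ord0 i is Some s then (s \in reps rho) || (y == v0) else true.
pose G (f : {ffun 'I_m.+1 -> V}) : {ffun 'I_m.+1 -> V} := [ffun i => if unlift ord0 i is Some s then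
  (if s \in reps rho then f i else v0) else f i].
apply: (@le_trans _ _ (\sum_(g in family Q) \prod_(i : 'I_m.+1) (1 : R))); last first.
  rewrite -(bigA_distr_big_dep Q (fun _ _ => 1)) /= big_ord_recl.
  rewrite (eq_bigl xpredT); last by move=> y; rewrite /Q unlift_none.
  rewrite sumr_const ler_wpM2l// -[leRHS]prodr_const [leRHS]big_mkcond.
  apply: ler_prod => s _; rewrite sumr_ge0//= /Q liftK.
  have [_|_] := boolP (s \in reps rho); first by rewrite sumr_const.
  by rewrite (big_pred1 v0).
apply: (@sum_le_inj _ _ _ _ G).
- move=> f f' /forallP cf /forallP cf' /ffunP eG.
  have e0 : f ord0 = f' ord0 by have := eG ord0; rewrite !ffunE unlift_none.
  have eS s : s \in reps rho -> f (lift ord0 s) = f' (lift ord0 s).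
    by move=> rs; have := eG (lift ord0 s); rewrite !ffunE liftK rs.
  suff h k : (k <= m)%N -> forall i : 'I_m.+1, (i <= k)%N -> f i = f' i.
    by apply/ffunP => i; apply: (h m) => //; rewrite -ltnS.
  elim: k => [_ i|k IH km i].
    by rewrite leqn0 => /eqP i0; have -> : i = ord0 by apply: val_inj.
  rewrite leq_eqVlt => /orP[/eqP ik|]; last by apply: IH; apply: ltnW.
  have {}IH := IH (ltnW km).
  pose s := Ordinal km.
  have ei : i = lift ord0 s by apply: val_inj; rewrite /= ik.
  have [rs|nrs] := boolP (s \in reps rho); first by rewrite ei eS.
  have lt : (rho s < s)%N.
    rewrite ltn_neqAle p2 andbT; apply: contra nrs => /eqP e.
    by rewrite inE; apply/eqP/val_inj.
  have rsk : (rho s < k)%N by [].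
  have e : alt_edge f s = alt_edge f' s.
    rewrite -(eqP (cf s)) -(eqP (cf' s)) /alt_edge /=.
    by rewrite !(IH (widen_ord _ _)) 1?ltnW// !(IH (lift _ _)).
  by move: e; rewrite /alt_edge ei; case: ifP => _ [].
- move=> f _; apply/familyP => i; rewrite ffunE.
  have -> y : (y \in Q i) = Q i y by [].
  rewrite /Q; case: (unlift ord0 i) => // s.
  by have [_|_] := boolP (s \in reps rho); rewrite //= eqxx.
- by move=> f _; rewrite big1_eq.
- by move=> g; apply: prodr_ge0.
Qed.
End AlternatingWalks.

(** * Mixed moments of independent, centred, bounded entries *)

Section MixedMoments.
Context (R : realType) (d : measure_display) (T : measurableType d).
Variables (P : probability T R) (I : finType) (Y : I -> T -> R) (sg2 B : R).
Hypothesis mY : forall i, measurable_fun setT (Y i).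
Hypothesis bY : forall i w, `|Y i w| <= B.
Hypothesis EY : forall i, Ex P (Y i) = 0.
Hypothesis VY : forall i, Ex P (fun w => Y i w ^+ 2) <= sg2.
Hypothesis indepY : forall c : I -> nat,
  Ex P (fun w => \prod_i Y i w ^+ c i) = \prod_i Ex P (fun w => Y i w ^+ c i).

Let bmY i : bounded_measurable (Y i).
Proof. by split => //; exists B => w; exact: bY. Qed.

Lemma mixed_moment (S : finType) (x : S -> I) :
  `|Ex P (fun w => \prod_s Y (x s) w)| <= repeated_weight sg2 B x.
Proof.
pose c i := #|[set s | x s == i]|.
have -> : (fun w => \prod_s Y (x s) w) = (fun w => \prod_i Y i w ^+ c i).
  apply/funext => w; rewrite (partition_big x xpredT) //=.
  apply: eq_bigr => i _; rewrite (eq_bigr (fun=> Y i w)); last by move=> s /eqP ->.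
  by rewrite prodr_const; congr (_ ^+ _); apply: eq_card => s; rewrite !inE.
rewrite indepY /repeated_weight; case: ifPn => [/forallP rx|]; last first.
  rewrite negb_forall => /existsP[s]; rewrite negb_exists => /forallP hs.
  have c1 : c (x s) = 1%N.
    apply/eqP/cards1P; exists s; apply/setP => s'; rewrite !inE.
    have := hs s'; rewrite negb_and negbK.
    by have [->|_] /= := eqVneq s' s; [rewrite eqxx|move/negbTE].
  by rewrite (bigD1 (x s)) //= c1 EY mul0r normr0.
set A := [set x s | s : S].
have cA i : i \in A -> (2 <= c i)%N.
  move=> /imsetP[s _ ->]; have /existsP[s' /andP[n e]] := rx s.
  have <- : #|[set s; s']| = 2%N by rewrite cards2 eq_sym n.
  by apply/subset_leq_card/fintype.subsetP => r; rewrite !inE => /orP[] /eqP ->.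
have cnA i : i \notin A -> c i = 0%N.
  move=> nA; apply/eqP; rewrite cards_eq0; apply/eqP/setP => s; rewrite !inE.
  by apply/negbTE; apply: contra nA => /eqP <-; exact: imset_f.
have sumc : (\sum_(i in A) c i = #|S|)%N.
  rewrite -sum1_card (partition_big x (mem A)) /=; last by move=> s _; exact: imset_f.
  by apply: eq_bigr => i _; rewrite /c -sum1_card; apply: eq_bigl => s; rewrite !inE.
have sumc2 : (\sum_(i in A) (c i - 2) = #|S| - 2 * #|A|)%N.
  rewrite -sumc; have -> : (\sum_(i in A) c i = \sum_(i in A) (c i - 2) + 2 * #|A|)%N.
    rewrite mulnC -sum_nat_const -big_split /=; apply: eq_bigr => i iA.
    by rewrite subnK// cA.
  by rewrite addnK.
rewrite normr_prod -sumc2 expr_sum -prodr_const -big_split /= [leRHS]big_mkcond.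
apply: ler_prod => i _; rewrite normr_ge0 /=; case: ifPn => [iA|nA]; last first.
  by rewrite cnA//= (_ : (fun w => _) = cst 1)// ?Ex_cst ?normr1//; apply/funext => w; rewrite expr0.
apply: le_trans (Ex_norm P (bmX _ (bmY i))) _.
apply: (@le_trans _ _ (Ex P (fun w => B ^+ (c i - 2) * Y i w ^+ 2))).
  apply: Ex_le.
  - by apply: bm_norm; exact: bmX.
  - by apply: bmM; [exact: bm_cst|exact: bmX].
  move=> w; rewrite -{1}(subnK (cA i iA)) exprD normrM ler_pM//.
    by rewrite normrX lerXn2r// nnegrE ?normr_ge0//; apply: le_trans (bY i w).
  by rewrite ger0_norm// sqr_ge0.
rewrite ExZ; last exact: bmX.
rewrite [leLHS]mulrC; apply: ler_wpM2r; last exact: VY.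
by rewrite exprn_ge0// (le_trans _ (bY i point)).
Qed.

Variables (E : finType) (idx : E -> option I).
Hypothesis idx_inj : forall e e', idx e != None -> idx e = idx e' -> e = e'.

(** The dilation has two deterministic zero blocks. Their positions get the index [None], so that
    every position of the square matrix can be treated alike. *)
Definition masked (e : E) (w : T) : R := if idx e is Some i then Y i w else 0.

Lemma bm_masked e : bounded_measurable (masked e).
Proof. by rewrite /masked; case: (idx e) => // ; exact: bm_cst. Qed.

Lemma mixed_moment_masked (S : finType) (x : S -> E) : 0 <= sg2 -> 0 <= B ->
  `|Ex P (fun w => \prod_s masked (x s) w)| <= repeated_weight sg2 B x.
Proof.
move=> s0 B0.
have [/existsP[s /eqP es]|] := boolP [exists s, idx (x s) == None].
  have -> : (fun w => \prod_s masked (x s) w) = cst 0.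
    by apply/funext => w; rewrite (bigD1 s)//= /masked es mul0r.
  by rewrite Ex_cst normr0 /repeated_weight; case: ifP => // _; rewrite mulr_ge0// exprn_ge0.
rewrite negb_exists => /forallP nN.
have /fin_all_exists[y hy] : forall s, exists i, idx (x s) = Some i.
  by move=> s; have := nN s; case: (idx (x s)) => // i _; exists i.
have -> : (fun w => \prod_s masked (x s) w) = (fun w => \prod_s Y (y s) w).
  by apply/funext => w; apply: eq_bigr => s _; rewrite /masked hy.
have yx s s' : (y s == y s') = (x s == x s').
  apply/eqP/eqP => e; last by apply: Some_inj; rewrite -!hy e.
  by apply: idx_inj; rewrite // !hy e.
by rewrite (eq_repeated_weight sg2 B (y := y)) ?mixed_moment// => s s'; rewrite yx.
Qed.
End MixedMoments.

Section PathSums.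
Variables (R : comPzRingType) (n : nat).

(** The matrix may vary with the step: powers of [H] use a constant sequence, powers of [H *m H^T]
    an alternating one. *)
Fixpoint chain (A : nat -> 'M[R]_n) (k : nat) (x : 'cV[R]_n) : 'cV[R]_n :=
  if k is k'.+1 then A 0%N *m chain (fun s => A s.+1) k' x else x.

Definition ffcons (V : Type) k (v : V) (g : {ffun 'I_k -> V}) : {ffun 'I_k.+1 -> V} :=
  [ffun i => if unlift ord0 i is Some j then g j else v].

Lemma ffcons0 (V : Type) k (v : V) (g : {ffun 'I_k -> V}) : ffcons v g ord0 = v.
Proof. by rewrite ffunE unlift_none. Qed.

Lemma ffconsS (V : Type) k (v : V) (g : {ffun 'I_k -> V}) j :
  ffcons v g (lift ord0 j) = g j.
Proof. by rewrite ffunE liftK. Qed.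

Lemma sum_ffcons (V : finType) k (F : {ffun 'I_k.+1 -> V} -> R) :
  \sum_f F f = \sum_v \sum_(g : {ffun 'I_k -> V}) F (ffcons v g).
Proof.
rewrite pair_bigA /= (reindex (fun p : V * {ffun 'I_k -> V} => ffcons p.1 p.2)) //=.
exists (fun f => (f ord0, [ffun j => f (lift ord0 j)])).
  move=> [v g] _ /=; rewrite ffcons0; congr (_, _).
  by apply/ffunP => j; rewrite ffunE ffconsS.
move=> f _ /=; apply/ffunP => i; case: (unliftP ord0 i) => [j|] ->.
  by rewrite ffconsS ffunE.
by rewrite ffcons0.
Qed.

Lemma path_sum (A : nat -> 'M[R]_n) k (a : 'I_n -> R) (x : 'cV[R]_n) :
  \sum_i a i * chain A k x i 0 =
  \sum_(f : {ffun 'I_k.+1 -> 'I_n}) a (f ord0) * x (f ord_max) 0 *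
    \prod_(s < k) A s (f (widen_ord (leqnSn k) s)) (f (lift ord0 s)).
Proof.
elim: k A a => [|k IH] A a /=.
  rewrite sum_ffcons; apply: eq_bigr => v _.
  rewrite (eq_bigr (fun=> a v * x v 0)); last first.
    have e : ord_max = ord0 :> 'I_1 by apply: val_inj.
    by move=> g _; rewrite big_ord0 mulr1 e ffcons0.
  by rewrite sumr_const card_ffun !card_ord expn0.
pose a' j := \sum_i a i * A 0%N i j.
transitivity (\sum_j a' j * chain (fun s => A s.+1) k x j 0).
  transitivity (\sum_i \sum_j a i * A 0%N i j * chain (fun s => A s.+1) k x j 0).
    apply: eq_bigr => i _; rewrite mxE mulr_sumr.
    by apply: eq_bigr => j _; rewrite mulrA.
  rewrite exchange_big; apply: eq_bigr => j _.
  by rewrite mulr_suml; apply: eq_bigr.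
rewrite IH [RHS]sum_ffcons [RHS]exchange_big; apply: eq_bigr => g _.
rewrite /a' !mulr_suml; apply: eq_bigr => v _.
rewrite big_ord_recl /= ffcons0 ffconsS.
have -> : widen_ord (leqnSn k.+1) ord0 = ord0 by apply: val_inj.
have -> : ord_max = lift ord0 (@ord_max k) by apply: val_inj.
rewrite ffcons0 ffconsS.
rewrite [in RHS](eq_bigr (fun s : 'I_k => A s.+1 (g (widen_ord (leqnSn k) s)) (g (lift ord0 s)))).
  by rewrite !mulrA; congr (_ * _); rewrite -!mulrA; congr (_ * _); rewrite mulrC.
move=> s _; rewrite ffconsS.
have -> : widen_ord (leqnSn k.+1) (lift ord0 s) = lift ord0 (widen_ord (leqnSn k) s).
  by apply: val_inj.
by rewrite ffconsS /bump /= add1n.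
Qed.

Lemma path_sum_exp (A : nat -> 'M[R]_n) k N (a : 'I_n -> R) (x : 'cV[R]_n) :
  (\sum_i a i * chain A k x i 0) ^+ N =
  \sum_(F : {ffun 'I_N -> {ffun 'I_k.+1 -> 'I_n}})
    (\prod_l (a (F l ord0) * x (F l ord_max) 0)) *
    \prod_(s : 'I_N * 'I_k)
       A s.2 (F s.1 (widen_ord (leqnSn k) s.2)) (F s.1 (lift ord0 s.2)).
Proof.
rewrite path_sum -[in LHS](card_ord N) -prodr_const.
rewrite bigA_distr_bigA; apply: eq_bigr => F _.
by rewrite big_split /= pair_bigA.
Qed.

Lemma chain_const (A : 'M[R]_n) k x : chain (fun=> A) k x = iter k (mulmx A) x.
Proof. by elim: k => //= k ->. Qed.

End PathSums.

Section MatrixMoments.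
Context (R : realType) (d : measure_display) (T : measurableType d).
Variables (P : probability T R) (n : nat) (D : 'I_n * 'I_n -> T -> R) (sg2 B : R).
Hypothesis bD : forall e, bounded_measurable (D e).
Hypothesis sg20 : 0 <= sg2.
Hypothesis B0 : 0 <= B.
Hypothesis momD : forall (S : finType) (x : S -> 'I_n * 'I_n),
  `|Ex P (fun w => \prod_s D (x s) w)| <= repeated_weight sg2 B x.

Definition rmx (w : T) : 'M[R]_n := \matrix_(i, j) D (i, j) w.

(** Shared by linear forms and traces: only the coefficients [c] and the count of configurations
    compatible with a pattern differ between the two. *)
Lemma moment_le (F S : finType) (ord : S -> nat) (e : F -> S -> 'I_n * 'I_n)
    (c W : F -> R) (W0 L : R) :
  injective ord -> (forall f, `|c f| <= W f) -> 0 <= W0 -> 0 <= L ->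
  #|S|%:R * n%:R * sg2 <= L ^+ 2 -> #|S|%:R * B <= L ->
  (forall rho : {ffun S -> S}, is_pattern ord rho ->
     \sum_(f | [forall s, e f (rho s) == e f s]) W f
       <= W0 * n%:R ^+ #|reps rho|) ->
  Ex P (fun w => \sum_f c f * \prod_s D (e f s) w) <= W0 * (2 * L) ^+ #|S|.
Proof.
move=> oinj cW W00 L0 hL1 hL2 hrho.
have bp f : bounded_measurable (fun w => \prod_s D (e f s) w) by apply: bm_prod.
rewrite Ex_sum; last by move=> f _; apply: bmM => //; exact: bm_cst.
have Wge0 f : 0 <= W f by apply: le_trans (cW f).
apply: le_trans (pattern_sum oinj Wge0 W00 (ler0n _ n) sg20 B0 L0 hL1 hL2 hrho).
apply: ler_sum => f _; rewrite ExZ//; apply: le_trans (ler_norm _) _.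
by rewrite normrM ler_pM// momD.
Qed.

(** The two ends of a walk are charged differently: the last vertex to the maximum of [x], the first
    one to the Euclidean norm of [a]. Hence the incoherence of [x] is gained while [a] may be any
    unit vector. *)
Lemma open_moment (v0 : 'I_n) (k N : nat) (a : 'I_n -> R) (x : 'cV[R]_n) (M L : R) :
  \sum_i a i ^+ 2 <= 1 -> (forall i, `|x i 0| <= M) -> 0 <= L ->
  (N * k.+1)%:R * n%:R * sg2 <= L ^+ 2 -> (N * k.+1)%:R * B <= L ->
  Ex P (fun w => (\sum_i a i * iter k.+1 (mulmx (rmx w)) x i 0) ^+ N)
    <= M ^+ N * (2 * L) ^+ (N * k.+1).
Proof.
move=> a2 xM L0 hL1 hL2.
have M0 : 0 <= M by apply: le_trans (xM v0).
have cS : #|{: 'I_N * 'I_k.+1}| = (N * k.+1)%N by rewrite card_prod !card_ord.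
pose c (F : {ffun 'I_N -> {ffun 'I_k.+2 -> 'I_n}}) :=
  \prod_l (a (F l ord0) * x (F l ord_max) 0).
have -> : (fun w => (\sum_i a i * iter k.+1 (mulmx (rmx w)) x i 0) ^+ N) =
    (fun w => \sum_F c F * \prod_s D (walk_edge F s) w).
  apply/funext => w; rewrite -chain_const path_sum_exp; apply: eq_bigr => F _.
  by congr (_ * _); apply: eq_bigr => s _; rewrite mxE.
pose alpha v := `|a v|.
have al2 : \sum_v alpha v ^+ 2 <= 1.
  by rewrite (eq_bigr (fun v => a v ^+ 2))// => v _; rewrite real_normK ?num_real.
rewrite -cS; apply: (@moment_le _ _ (@slot_rank N k) (@walk_edge _ N k) c
    (fun F => M ^+ N * \prod_l alpha (F l ord0))) => //; rewrite ?cS//.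
- by move=> s s' /val_inj/enum_rank_inj.
- move=> F; rewrite /c normr_prod.
  have -> : M ^+ N = \prod_(l < N) M by rewrite prodr_const card_ord.
  rewrite -big_split /=.
  by apply: ler_prod => l _; rewrite normr_ge0 normrM mulrC ler_pM.
- by rewrite exprn_ge0.
- move=> rho prho; rewrite -mulr_sumr; apply: ler_wpM2l; first by rewrite exprn_ge0.
  have := sum_open_walks v0 (fun v => normr_ge0 (a v)) al2 prho.
  by rewrite card_ord.
Qed.

Lemma iter_mulmx_chain (H : 'M[R]_n) p x :
  iter p (mulmx (H *m H^T)) x = chain (fun s => if odd s then H^T else H) p.*2 x.
Proof.
elim: p => //= p ->; rewrite mulmxA.
by congr (_ *m chain _ _ _); apply/funext => s; rewrite /= negbK.
Qed.

Lemma trace_moment (p : nat) (L : R) : 0 <= L ->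
  (p.*2)%:R * n%:R * sg2 <= L ^+ 2 -> (p.*2)%:R * B <= L ->
  Ex P (fun w => \sum_i
      iter p (mulmx (rmx w *m (rmx w)^T)) (delta_mx i (0 : 'I_1)) i 0)
    <= n%:R * (2 * L) ^+ p.*2.
Proof.
move=> L0 hL1 hL2.
pose c (f : {ffun 'I_p.*2.+1 -> 'I_n}) : R :=
  \sum_i (f ord0 == i)%:R * (f ord_max == i)%:R.
have -> : (fun w => \sum_i iter p (mulmx (rmx w *m (rmx w)^T)) (delta_mx i (0 : 'I_1)) i 0) =
   (fun w => \sum_f c f * \prod_s D (alt_edge f s) w).
  apply/funext => w.
  under [RHS]eq_bigr do rewrite /c mulr_suml.
  rewrite [RHS]exchange_big; apply: eq_bigr => i _; rewrite iter_mulmx_chain.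
  transitivity (\sum_j (j == i)%:R *
    chain (fun s => if odd s then (rmx w)^T else rmx w) p.*2
      (delta_mx i (0 : 'I_1)) j 0).
    by rewrite (bigD1 i)//= eqxx mul1r big1 ?addr0// => j /negbTE ->; rewrite mul0r.
  rewrite (path_sum _ _ (fun j => (j == i)%:R)); apply: eq_bigr => f _.
  rewrite mxE eqxx andbT; congr (_ * _); apply: eq_bigr => s _.
  by rewrite /alt_edge; case: ifP => _; rewrite !mxE.
have -> : (2 * L) ^+ p.*2 = (2 * L) ^+ #|'I_p.*2| by rewrite card_ord.
apply: (@moment_le _ _ (@nat_of_ord p.*2) (@alt_edge _ _) c (fun=> 1)) => //;
  rewrite ?card_ord//.
- exact: ord_inj.
(* The coefficient is the indicator of a closed walk, hence at most 1; the free first vertex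
   accounts for the factor [n]. *)
- move=> f; rewrite /c (bigD1 (f ord0))//= eqxx mul1r big1 ?addr0; last first.
    by move=> i; rewrite eq_sym => /negbTE ->; rewrite mul0r.
  by case: (_ == _); rewrite ?normr1 ?normr0.
- move=> rho prho; have := sum_alternating_walks R 'I_n prho.
  by rewrite card_ord.
Qed.
End MatrixMoments.

Local Open Scope classical_set_scope.
Local Open Scope ring_scope.

(** * Complex vectors *)

Section ComplexNorms.
Variable R : realType.
Implicit Types (z : R[i]).

Lemma cmodE z : `|z| = (cmod z)%:C%C :> R[i].
Proof. by case: z => a b; rewrite normc_def. Qed.

Lemma cmod_ge0 z : 0 <= cmod z.
Proof. by case: z => a b; rewrite /cmod /= sqrtr_ge0. Qed.

Lemma cmod_sqr z : cmod z ^+ 2 = complex.Re z ^+ 2 + complex.Im z ^+ 2.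
Proof. by case: z => a b; rewrite /cmod /= sqr_sqrtr ?addr_ge0 ?sqr_ge0. Qed.

Lemma cmodM z1 z2 : cmod (z1 * z2) = cmod z1 * cmod z2.
Proof. exact: ComplexField.Normc.normcM. Qed.

Lemma cmodD z1 z2 : cmod (z1 + z2) <= cmod z1 + cmod z2.
Proof.
have := ler_normD z1 z2; rewrite !cmodE.
by rewrite -rmorphD /= lecR.
Qed.

Lemma cmodN z : cmod (- z) = cmod z.
Proof. by have := normrN z; rewrite !cmodE => -[]. Qed.

Lemma cmodB z1 z2 : cmod (z1 - z2) <= cmod z1 + cmod z2.
Proof. by rewrite -(cmodN z2) cmodD. Qed.

Lemma cmod0 : cmod (0 : R[i]) = 0.
Proof. exact: ComplexField.Normc.normc0. Qed.

Lemma cmod_eq0 z : (cmod z == 0) = (z == 0).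
Proof.
apply/eqP/eqP => [|->]; last exact: cmod0.
exact: ComplexField.Normc.eq0_normc.
Qed.

Lemma cmod_real (r : R) : cmod r%:C%C = `|r|.
Proof. by rewrite /cmod /= expr0n /= addr0 sqrtr_sqr. Qed.

Lemma cmod_Re z : `|complex.Re z| <= cmod z.
Proof.
rewrite -(@ler_pXn2r _ 2) ?nnegrE ?cmod_ge0// cmod_sqr real_normK ?num_real//.
by rewrite lerDl sqr_ge0.
Qed.

Lemma cmod_conj z : cmod z^*%C = cmod z.
Proof. by case: z => a b; rewrite /cmod /= sqrrN. Qed.

Lemma cmod_sum (I : Type) (s : seq I) (Q : pred I) (F : I -> R[i]) :
  cmod (\sum_(i <- s | Q i) F i) <= \sum_(i <- s | Q i) cmod (F i).
Proof.
elim/big_rec2: _ => [|i x y _ h]; first by rewrite cmod0.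
by apply: le_trans (cmodD _ _) _; rewrite lerD2l.
Qed.

(** Lagrange's identity: twice the deficit is a sum of squares. *)
Lemma sum_cauchy_schwarz (I : finType) (a b : I -> R) :
  (\sum_i a i * b i) ^+ 2 <= (\sum_i a i ^+ 2) * (\sum_i b i ^+ 2).
Proof.
suff : 0 <= 2 * ((\sum_i a i ^+ 2) * (\sum_i b i ^+ 2) - (\sum_i a i * b i) ^+ 2).
  by rewrite pmulr_rge0// subr_ge0.
have -> : 2 * ((\sum_i a i ^+ 2) * (\sum_i b i ^+ 2) - (\sum_i a i * b i) ^+ 2)
   = \sum_i \sum_j (a i * b j - a j * b i) ^+ 2.
  have e1 : (\sum_i a i ^+ 2) * (\sum_i b i ^+ 2) = \sum_i \sum_j a i ^+ 2 * b j ^+ 2.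
    by rewrite mulr_suml; apply: eq_bigr => i _; rewrite mulr_sumr.
  have e2 : (\sum_i a i ^+ 2) * (\sum_i b i ^+ 2) = \sum_i \sum_j a j ^+ 2 * b i ^+ 2.
    by rewrite e1 exchange_big.
  have e3 : (\sum_i a i * b i) ^+ 2 = \sum_i \sum_j (a i * b i) * (a j * b j).
    by rewrite expr2 mulr_suml; apply: eq_bigr => i _; rewrite mulr_sumr.
  rewrite mulrBr mulr2n mulrDl mul1r {1}e1 e2 e3 -big_split mulr_sumr -sumrB /=.
  apply: eq_bigr => i _; rewrite -big_split mulr_sumr -sumrB /=.
  by apply: eq_bigr => j _; ring.
by apply: sumr_ge0 => i _; apply: sumr_ge0 => j _; rewrite sqr_ge0.
Qed.

Section Vectors.
Variable m : nat.
Implicit Types x y : 'cV[R[i]]_m.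

Lemma norm2_ge0 x : 0 <= norm2 x. Proof. exact: sqrtr_ge0. Qed.

Lemma norm2_sqr x : norm2 x ^+ 2 = \sum_i cmod (x i 0) ^+ 2.
Proof. by rewrite sqr_sqrtr// sumr_ge0// => i _; rewrite sqr_ge0. Qed.

Lemma cmod_sum_mul x y : cmod (\sum_i x i 0 * y i 0) <= norm2 x * norm2 y.
Proof.
apply: le_trans (cmod_sum _ _ _) _.
under eq_bigr do rewrite cmodM.
have h0 : 0 <= \sum_i cmod (x i 0) * cmod (y i 0).
  by apply: sumr_ge0 => i _; rewrite mulr_ge0 ?cmod_ge0.
rewrite -(@ler_pXn2r _ 2) ?nnegrE ?mulr_ge0 ?norm2_ge0// exprMn !norm2_sqr.
exact: sum_cauchy_schwarz.
Qed.

Lemma norm2D x y : norm2 (x + y) <= norm2 x + norm2 y.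
Proof.
rewrite -(@ler_pXn2r _ 2) ?nnegrE ?addr_ge0 ?norm2_ge0//.
rewrite sqrrD !norm2_sqr.
have h1 : \sum_i cmod ((x + y) i 0) ^+ 2 <= \sum_i (cmod (x i 0) + cmod (y i 0)) ^+ 2.
  by apply: ler_sum => i _; rewrite mxE lerXn2r ?nnegrE ?addr_ge0 ?cmod_ge0 ?cmodD.
apply: le_trans h1 _.
under eq_bigr do rewrite sqrrD.
rewrite !big_split /= lerD2r lerD2l -mulr2n lerMn2r /=.
have h0 : 0 <= \sum_i cmod (x i 0) * cmod (y i 0).
  by apply: sumr_ge0 => i _; rewrite mulr_ge0 ?cmod_ge0.
rewrite -(@ler_pXn2r _ 2) ?nnegrE ?mulr_ge0 ?norm2_ge0// exprMn !norm2_sqr.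
exact: sum_cauchy_schwarz.
Qed.

Lemma norm2Z c x : norm2 (c *: x) = cmod c * norm2 x.
Proof.
apply: (pexpIrn (n := 2)); rewrite ?nnegrE ?mulr_ge0 ?cmod_ge0 ?norm2_ge0//.
rewrite exprMn !norm2_sqr mulr_sumr; apply: eq_bigr => i _.
by rewrite mxE cmodM exprMn.
Qed.

Lemma norm2N x : norm2 (- x) = norm2 x.
Proof. by rewrite -scaleN1r norm2Z cmodN (cmod_real 1) normr1 mul1r. Qed.

Lemma norm2B x y : norm2 (x - y) <= norm2 x + norm2 y.
Proof. by rewrite -(norm2N y) norm2D. Qed.

Lemma norm2_eq0 x : (norm2 x == 0) = (x == 0).
Proof.
apply/eqP/eqP => [n0|->]; last first.
  by rewrite /norm2 big1 ?sqrtr0// => i _; rewrite mxE cmod0 expr0n.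
apply/matrixP => i j; rewrite ord1 mxE; apply/eqP; rewrite -cmod_eq0 -sqrf_eq0.
have := norm2_sqr x; rewrite n0 expr0n /= => /esym/eqP.
rewrite psumr_eq0; last by move=> k _; rewrite sqr_ge0.
by move=> /allP/(_ i); rewrite mem_index_enum => /(_ isT).
Qed.

Lemma norm2_gt0 x : (0 < norm2 x) = (x != 0).
Proof. by rewrite lt_neqAle norm2_ge0 andbT eq_sym norm2_eq0. Qed.

Lemma dotE (a : 'cV[R]_m) x : dot a x = \sum_i (a i 0)%:C%C * x i 0.
Proof. by rewrite /dot mxE; apply: eq_bigr => i _; rewrite !mxE. Qed.

Lemma cmod_dot (a : 'cV[R]_m) x : cmod (dot a x) <= norm2 (cplx a) * norm2 x.
Proof.
rewrite dotE (eq_bigr (fun i => (cplx a) i 0 * x i 0)) ?cmod_sum_mul//.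
by move=> i _; rewrite mxE.
Qed.

Lemma dotD (a : 'cV[R]_m) x y : dot a (x + y) = dot a x + dot a y.
Proof. by rewrite /dot mulmxDr mxE. Qed.

Lemma dotB (a : 'cV[R]_m) x y : dot a (x - y) = dot a x - dot a y.
Proof. by rewrite /dot mulmxBr !mxE. Qed.

Lemma dotZ (a : 'cV[R]_m) c x : dot a (c *: x) = c * dot a x.
Proof. by rewrite /dot -scalemxAr mxE. Qed.

Lemma norm2_cplx_sqr (a : 'cV[R]_m) : norm2 (cplx a) ^+ 2 = \sum_i a i 0 ^+ 2.
Proof.
rewrite norm2_sqr; apply: eq_bigr => i _.
by rewrite mxE cmod_real real_normK ?num_real.
Qed.

Lemma dot_cplx (a b : 'cV[R]_m) : dot a (cplx b) = ((a^T *m b) 0 0)%:C%C.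
Proof.
rewrite dotE mxE rmorph_sum; apply: eq_bigr => i _.
by rewrite !mxE rmorphM.
Qed.
End Vectors.

Lemma cplxM m p q (A : 'M[R]_(m, p)) (B : 'M[R]_(p, q)) :
  cplx (A *m B) = cplx A *m cplx B.
Proof. exact: map_mxM. Qed.

Lemma cplxD m p (A B : 'M[R]_(m, p)) : cplx (A + B) = cplx A + cplx B.
Proof. exact: map_mxD. Qed.

Lemma cplxZ m p (r : R) (A : 'M[R]_(m, p)) : cplx (r *: A) = r%:C%C *: cplx A.
Proof. exact: map_mxZ. Qed.

Lemma norm2_mul_real m (H : 'M[R]_m) (h : R) : 0 <= h ->
  (forall x : 'cV[R]_m, \sum_i ((H *m x) i 0) ^+ 2 <= h ^+ 2 * \sum_i x i 0 ^+ 2) ->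
  forall x : 'cV[R[i]]_m, norm2 (cplx H *m x) <= h * norm2 x.
Proof.
move=> h0 hop x.
rewrite -(@ler_pXn2r _ 2) ?nnegrE ?mulr_ge0 ?norm2_ge0// exprMn !norm2_sqr.
pose xr : 'cV[R]_m := \col_i complex.Re (x i 0).
pose xi : 'cV[R]_m := \col_i complex.Im (x i 0).
have e1 : \sum_i cmod (x i 0) ^+ 2 = \sum_i xr i 0 ^+ 2 + \sum_i xi i 0 ^+ 2.
  by rewrite -big_split; apply: eq_bigr => i _; rewrite /= cmod_sqr !mxE.
have e2 : \sum_i cmod ((cplx H *m x) i 0) ^+ 2 =
   \sum_i ((H *m xr) i 0) ^+ 2 + \sum_i ((H *m xi) i 0) ^+ 2.
  rewrite -big_split; apply: eq_bigr => i _; rewrite /= cmod_sqr !mxE.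
  rewrite !raddf_sum; congr (_ ^+ 2 + _ ^+ 2); apply: eq_bigr => j _; rewrite !mxE.
    by case: (x j 0) => a b /=; rewrite mul0r subr0.
  by case: (x j 0) => a b /=; rewrite mul0r addr0.
by rewrite e1 e2 mulrDr lerD.
Qed.
End ComplexNorms.

(** * Multiplicities of eigenvalues *)

Section Sylvester.
Variables (F : comNzRingType) (n m : nat).

(** Sylvester's determinant identity. The block matrix [A] is eliminated once from the right and
    once from the left; the powers of [x] avoid any division by [x]. *)
Lemma det_scalar_sub_mulmx (U : 'M[F]_(n, m)) (V : 'M[F]_(m, n)) (x : F) :
  x ^+ m * \det (x%:M - U *m V) = x ^+ n * \det (x%:M - V *m U).
Proof.
pose A := block_mx x%:M U V 1%:M : 'M[F]_(n + m).
have eA : \det A = \det (x%:M - U *m V).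
  have : \det (A *m block_mx 1%:M 0 (- V) 1%:M) = \det A.
    by rewrite det_mulmx det_lblock !det1 !mulr1.
  rewrite mulmx_block !mulmx1 !mulmx0 !add0r mul1mx subrr mulmxN => <-.
  by rewrite det_ublock det1 mulr1.
have : \det (block_mx 1%:M 0 (- V) x%:M *m A) = x ^+ m * \det A.
  by rewrite det_mulmx det_lblock det1 mul1r det_scalar.
rewrite mulmx_block !mul1mx !mul0mx !addr0 mulmx1 mulNmx mul_mx_scalar mul_scalar_mx addNr.
by rewrite det_ublock det_scalar eA mulNmx [- _ + _]addrC => <-.
Qed.
End Sylvester.

Section Deflation.
Variable F : fieldType.

Lemma char_poly_trmx n (A : 'M[F]_n) : char_poly A^T = char_poly A.
Proof.
rewrite /char_poly -[RHS]det_tr; congr (\det _).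
by rewrite /char_poly_mx linearB /= tr_scalar_mx map_trmx.
Qed.

Lemma root_char_polyP n (A : 'M[F]_n) z :
  reflect (exists2 w : 'cV_n, w != 0 & A *m w = z *: w) (root (char_poly A) z).
Proof.
rewrite -char_poly_trmx -eigenvalue_root_char.
apply: (iffP eigenvalueP) => -[w].
  move=> e w0; exists w^T; first by rewrite trmx_eq0.
  by apply: trmx_inj; rewrite trmx_mul trmxK e linearZ /= trmxK.
move=> w0 e; exists w^T; last by rewrite trmx_eq0.
by rewrite -trmx_mul e linearZ.
Qed.

Lemma char_poly_conj n (Q B : 'M[F]_n) : Q \in unitmx ->
  char_poly (Q *m B *m invmx Q) = char_poly B.
Proof.
move=> uQ; rewrite /char_poly /char_poly_mx.
have e1 : map_mx polyC Q *m map_mx polyC (invmx Q) = 1%:M.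
  by rewrite -map_mxM mulmxV// map_mx1.
have -> : 'X%:M - map_mx polyC (Q *m B *m invmx Q) =
   map_mx polyC Q *m ('X%:M - map_mx polyC B) *m map_mx polyC (invmx Q).
  rewrite mulmxBr mulmxBl !map_mxM; congr (_ - _).
  by rewrite scalar_mxC -mulmxA e1 mulmx1.
rewrite !det_mulmx mulrAC -det_mulmx e1 det1 mul1r.
by [].
Qed.

(** The first row of [Q] is proportional to [v], so in the basis [Q] the matrix is block triangular
    and its lower right block has characteristic polynomial [q]. An eigenvector of that block lifts
    to [f]; the term [c *: v] allows for a Jordan block when [z1 = z2]. *)
Lemma second_eigenvector_row n (B : 'M[F]_n.+1) (v : 'rV[F]_n.+1) z1 z2 q :
  v != 0 -> v *m B = z1 *: v -> char_poly B = ('X - z1%:P) * q -> root q z2 ->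
  exists (f : 'rV[F]_n.+1) (c : F), f *m B = z2 *: f + c *: v /\
    forall a b, a *: v + b *: f = 0 -> a = 0 /\ b = 0.
Proof.
move=> v0 evB; rewrite -[n.+1]/(1 + n)%N in B v v0 evB * => hq rq.
pose Q := row_ebase v; have uQ : Q \in unitmx by exact: row_ebase_unit.
pose c0 := col_ebase v 0 0.
pose e := usubmx Q : 'rV_(1 + n).
have eQ : row_mx 1%:M 0 *m Q = e.
  by rewrite -[Q]vsubmxK mul_row_col mul1mx mul0mx addr0.
have ve : v = c0 *: e.
  have := mulmx_ebase v; rewrite rank_rV v0 /= pid_mx_row => h.
  rewrite -{1}h -/Q [col_ebase v]mx11_scalar -/c0.
  by rewrite mul_scalar_mx -scalemxAl eQ.
have c00 : c0 != 0 by apply: contraNneq v0 => h; rewrite ve h scale0r.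
have eeB : e *m B = z1 *: e.
  apply: (scalerI c00); rewrite scalemxAl -ve evB ve !scalerA mulrC //.
pose K := Q *m B *m invmx Q.
have KQ : K *m Q = Q *m B by rewrite /K mulmxKV.
have uK : row_mx 1%:M 0 *m K = row_mx z1%:M 0.
  rewrite /K !mulmxA eQ eeB -scalemxAl -eQ -mulmxA mulmxV// mulmx1.
  by rewrite scale_row_mx scaler0 scalemx1.
have eK : K = block_mx z1%:M 0 (dlsubmx K) (drsubmx K).
  rewrite -{1}[K]submxK; move: uK; rewrite -{1}[K]submxK mul_row_block.
  by rewrite !mul1mx !mul0mx !addr0 => /eq_row_mx[-> ->].
have cK : char_poly K = ('X - z1%:P) * char_poly (drsubmx K).
  rewrite {1}eK /char_poly /char_poly_mx map_block_mx map_scalar_mx /= map_mx0.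
  rewrite (scalar_mx_block 1 n) opp_block_mx add_block_mx oppr0 !addr0 det_lblock.
  by rewrite -raddfB /= det_scalar1.
have q' : q = char_poly (drsubmx K).
  by apply: (mulfI (negbT (polyXsubC_eq0 z1))); rewrite -cK -hq /K char_poly_conj.
move: rq; rewrite q' -eigenvalue_root_char => /eigenvalueP[g gB g0].
exists (row_mx 0 g *m Q), ((g *m dlsubmx K) 0 0 / c0); split.
  rewrite -mulmxA -KQ {1}eK mulmxA mul_row_block !mul0mx !add0r gB.
  rewrite ve scalerA divfK// -eQ !scalemxAl -mulmxDl; congr (_ *m _).
  rewrite !scale_row_mx add_row_mx !scaler0 add0r addr0.
  by rewrite [in LHS](mx11_scalar (g *m dlsubmx K)) scalemx1.
move=> a b; rewrite ve -eQ scalerA !scalemxAl -mulmxDl => h.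
have {}h : row_mx (a * c0)%:M (b *: g) = 0 :> 'rV[F]_(1 + n).
  have := congr1 (fun M => M *m invmx Q) h; rewrite mul0mx mulmxK// => <-.
  by rewrite !scale_row_mx add_row_mx !scaler0 add0r addr0 scalemx1.
have [h1 h2] : (a * c0)%:M = 0 :> 'M[F]_1 /\ b *: g = 0.
  by apply: eq_row_mx; rewrite h row_mx0.
split.
  have /eqP := congr1 (fun M : 'M[F]_1 => M 0 0) h1.
  by rewrite !mxE eqxx mulr1n mulf_eq0 (negbTE c00) orbF => /eqP.
by move/eqP: h2; rewrite scaler_eq0 (negbTE g0) orbF => /eqP.
Qed.

(* A double eigenvalue provides a kernel of dimension at least two, which meets
   every hyperplane. *)
Lemma double_eigenvalue n (A : 'M[F]_n) z1 z2 q (p : 'rV[F]_n) :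
  char_poly A = ('X - z1%:P) * q -> root q z2 ->
  exists2 x : 'cV[F]_n, x != 0 /\ (p *m x) 0 0 = 0 &
    let y := A *m x - z2 *: x in A *m y = z1 *: y.
Proof.
move=> hq rq.
have rz : root (char_poly A) z1 by rewrite hq rootM root_XsubC eqxx.
case: n A p hq rz => [|n] A p hq rz.
  by have [w] := root_char_polyP A z1 rz; rewrite [w]flatmx0 eqxx.
have rz1 : root (char_poly A^T) z1.
  by rewrite char_poly_trmx.
have /eigenvalueP[v vA v0] : eigenvalue A^T z1 by rewrite eigenvalue_root_char.
have hqT : char_poly A^T = ('X - z1%:P) * q by rewrite char_poly_trmx.
have [f [c [fA indep]]] := second_eigenvector_row v0 vA hqT rq.
have Av : A *m v^T = z1 *: v^T by rewrite -[A]trmxK -trmx_mul vA linearZ.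
have Af : A *m f^T = z2 *: f^T + c *: v^T.
  by rewrite -[A]trmxK -trmx_mul fA linearD !linearZ.
pose s := (p *m v^T) 0 0; pose t := (p *m f^T) 0 0.
(* A nonzero combination annihilated by [p]: [v] itself if [p] already vanishes on it, otherwise the
   coefficients [(- t, s)]. *)
pose ab := if s == 0 then (1, 0) else (- t, s) : F * F.
have ab0 : ab != (0, 0).
  rewrite /ab; case: ifPn => s0; first by rewrite xpair_eqE oner_eq0.
  by rewrite xpair_eqE (negbTE s0) andbF.
exists (ab.1 *: v^T + ab.2 *: f^T); first split.
- apply: contraNneq ab0 => h; have [] := indep ab.1 ab.2.
    by apply: trmx_inj; rewrite linearD !linearZ h trmx0.
  by case: (ab) => x y /= -> ->.
- have -> : (p *m (ab.1 *: v^T + ab.2 *: f^T)) 0 0 = ab.1 * s + ab.2 * t.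
    by rewrite mulmxDr -!scalemxAr [LHS]mxE; congr (_ + _); rewrite mxE.
  rewrite /ab; have [s0|_] := eqVneq s 0; first by rewrite mul1r mul0r addr0.
  by rewrite mulNr mulrC addNr.
move=> y; set x := ab.1 *: _ + _ in y *.
have -> : y = (ab.1 * (z1 - z2) + ab.2 * c) *: v^T.
  rewrite /y /x mulmxDr -!scalemxAr Av Af !scalerDr !scalerA scalerDl mulrBr scalerBl.
  rewrite [z2 * ab.1]mulrC [z2 * ab.2]mulrC opprD addrACA.
  by rewrite [ab.2 * z2 *: f^T + _]addrC addrK.
by rewrite -scalemxAr Av !scalerA mulrC.
Qed.
End Deflation.

(** * Perturbation of a symmetric rank-two matrix *)

Section RankTwo.
Variables (R : realType) (n : nat).
Implicit Types (p : 'cV[R]_n) (H : 'M[R]_n) (lam h : R) (x w : 'cV[R[i]]_n).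

Definition orthonormal_pair (p1 p2 : 'cV[R]_n) :=
  [/\ (p1^T *m p1) 0 0 = 1, (p2^T *m p2) 0 0 = 1, (p1^T *m p2) 0 0 = 0
    & (p2^T *m p1) 0 0 = 0].

Lemma orthonormal_pairC p1 p2 : orthonormal_pair p1 p2 -> orthonormal_pair p2 p1.
Proof. by case. Qed.

Definition signal lam (p1 p2 : 'cV[R]_n) : 'M[R]_n := lam *: (p1 *m p1^T - p2 *m p2^T).

(** Transfers statements about eigenvalues near [lam] to eigenvalues near [- lam]. *)
Lemma signalC lam p1 p2 : signal (- lam) p2 p1 = signal lam p1 p2.
Proof. by rewrite /signal scaleNr -scalerN opprB. Qed.

Definition op_bound H h :=
  forall x : 'cV[R[i]]_n, norm2 (cplx H *m x) <= h * norm2 x.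

Lemma mul_rank_one (p : 'cV[R]_n) x : cplx (p *m p^T) *m x = dot p x *: cplx p.
Proof.
rewrite cplxM -mulmxA; have -> : cplx p^T *m x = (dot p x)%:M.
  by rewrite [LHS]mx11_scalar /dot /cplx map_trmx.
by rewrite mul_mx_scalar.
Qed.

Lemma mul_signal lam p1 p2 x : cplx (signal lam p1 p2) *m x =
  lam%:C%C *: (dot p1 x *: cplx p1 - dot p2 x *: cplx p2).
Proof.
rewrite /signal cplxZ -scalemxAl; congr (_ *: _).
by rewrite /cplx map_mxB mulmxBl -!/(cplx _) !mul_rank_one.
Qed.

Lemma unit_norm2 (p : 'cV[R]_n) : (p^T *m p) 0 0 = 1 -> norm2 (cplx p) = 1.
Proof.
move=> p1; apply: (pexpIrn (n := 2)); rewrite ?nnegrE ?norm2_ge0//.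
rewrite norm2_cplx_sqr expr1n -p1 mxE.
by apply: eq_bigr => i _; rewrite mxE expr2.
Qed.

Lemma cmod_dot_unit (p : 'cV[R]_n) x : (p^T *m p) 0 0 = 1 ->
  cmod (dot p x) <= norm2 x.
Proof. by move=> p1; have := cmod_dot p x; rewrite unit_norm2// mul1r. Qed.

Lemma dot_signal lam p1 p2 x : orthonormal_pair p1 p2 ->
  dot p1 (cplx (signal lam p1 p2) *m x) = lam%:C%C * dot p1 x.
Proof.
case=> [u1 _ u12 _]; rewrite mul_signal dotZ dotB !dotZ !dot_cplx u1 u12.
by rewrite rmorph1 rmorph0 mulr1 mulr0 subr0.
Qed.

(** Pairing the residual [e] with [p1] and [p2] isolates the two components, because both are
    eigenvectors of the symmetric signal. The signal kills [r], so [z *: r] is a combination of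
    these two components and [e], each of norm at most that of [e]. *)
Lemma resolvent_components lam p1 p2 x z : orthonormal_pair p1 p2 ->
  let e := cplx (signal lam p1 p2) *m x - z *: x in
  let r := x - (dot p1 x *: cplx p1 + dot p2 x *: cplx p2) in
  [/\ cmod (lam%:C%C - z) * cmod (dot p1 x) <= norm2 e,
      cmod (lam%:C%C + z) * cmod (dot p2 x) <= norm2 e,
      cmod z * norm2 r <= 3 * norm2 e &
      norm2 x <= cmod (dot p1 x) + cmod (dot p2 x) + norm2 r].
Proof.
case=> [u1 u2 u12 u21] e r.
have d1 : dot p1 e = (lam%:C%C - z) * dot p1 x.
  rewrite /e mul_signal dotB !dotZ dotB !dotZ !dot_cplx u1 u12.
  by rewrite rmorph1 rmorph0 mulr1 mulr0 subr0 mulrBl.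
have d2 : dot p2 e = - ((lam%:C%C + z) * dot p2 x).
  rewrite /e mul_signal dotB !dotZ dotB !dotZ !dot_cplx u2 u21.
  by rewrite rmorph1 rmorph0 mulr1 mulr0 sub0r mulrN -opprD mulrDl.
have b1 : cmod (lam%:C%C - z) * cmod (dot p1 x) <= norm2 e.
  by rewrite -cmodM -d1 cmod_dot_unit.
have b2 : cmod (lam%:C%C + z) * cmod (dot p2 x) <= norm2 e.
  by rewrite -cmodM -cmodN -d2 cmod_dot_unit.
split => //.
- have -> : cmod z * norm2 r = norm2 (z *: r) by rewrite norm2Z.
  have -> : z *: r = ((lam%:C%C - z) * dot p1 x) *: cplx p1
                     - ((lam%:C%C + z) * dot p2 x) *: cplx p2 - e.
    rewrite /e mul_signal /r; apply/matrixP => i j; rewrite !mxE; ring.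
  apply: le_trans (norm2B _ _) _; apply: (@le_trans _ _ (norm2 e + norm2 e + norm2 e)); last by lra.
  rewrite lerD2r; apply: le_trans (norm2B _ _) _.
  by rewrite !norm2Z !cmodM !unit_norm2// !mulr1 lerD.
- have -> : norm2 x = norm2 (dot p1 x *: cplx p1 + dot p2 x *: cplx p2 + r).
    by rewrite /r addrC subrK.
  apply: le_trans (norm2D _ _) _; rewrite lerD2r.
  by apply: le_trans (norm2D _ _) _; rewrite !norm2Z !unit_norm2// !mulr1.
Qed.

Lemma eigen_residual lam p1 p2 H h w z : op_bound H h ->
  cplx (signal lam p1 p2 + H) *m w = z *: w ->
  norm2 (cplx (signal lam p1 p2) *m w - z *: w) <= h * norm2 w.
Proof.
move=> hop <-; rewrite cplxD mulmxDl opprD addrA subrr sub0r norm2N.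
exact: hop.
Qed.

(* A Bauer-Fike bound; the constant is lossy because only the triangle
   inequality is used. *)
Lemma eigenvalue_location lam p1 p2 H h w z : orthonormal_pair p1 p2 ->
  op_bound H h -> w != 0 ->
  cplx (signal lam p1 p2 + H) *m w = z *: w ->
  [\/ cmod (lam%:C%C - z) <= 6 * h, cmod (lam%:C%C + z) <= 6 * h | cmod z <= 6 * h].
Proof.
move=> o hop w0 ew; have N0 : 0 < norm2 w by rewrite norm2_gt0.
have he := eigen_residual hop ew.
have [c1 c2 c3 c4] := resolvent_components lam w z o.
have [|a1] := leP (cmod (lam%:C%C - z)) (6 * h); first by constructor 1.
have [|a2] := leP (cmod (lam%:C%C + z)) (6 * h); first by constructor 2.
have [|a3] := leP (cmod z) (6 * h); first by constructor 3.
exfalso.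
set N := norm2 w in N0 he c4.
set e := norm2 _ in he c1 c2 c3.
set al := cmod (dot p1 w) in c1 c4; set be := cmod (dot p2 w) in c2 c4.
set r := norm2 _ in c3 c4.
have al0 : 0 <= al by exact: cmod_ge0.
have be0 : 0 <= be by exact: cmod_ge0.
have r0 : 0 <= r by exact: norm2_ge0.
have h0 : 0 <= h.
  by have := le_trans (norm2_ge0 _) (hop w); rewrite pmulr_lge0.
have k (a b c : R) : 0 <= b -> 6 * h < a -> a * b <= c -> 6 * h * b <= c.
  by move=> b0 ha hc; apply: le_trans hc; rewrite ler_wpM2r// ltW.
have := k _ _ _ al0 a1 c1; have := k _ _ _ be0 a2 c2; have := k _ _ _ r0 a3 c3.
(* The degenerate case [h = 0] is separate, since the factor [h] cannot be cancelled there. *)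
have [h00|hpos] := leP h 0.
  have hz : h = 0 by lra.
  move: c1 c2 c3 a1 a2 a3 he; rewrite hz mul0r mulr0 => c1 c2 c3 a1 a2 a3 he _ _ _.
  have e0 : e = 0 by have := norm2_ge0 (cplx (signal lam p1 p2) *m w - z *: w); rewrite -/e; lra.
  have z1 (a b : R) : 0 < a -> 0 <= b -> a * b <= 0 -> b = 0.
    by move=> a0 b0; rewrite pmulr_rle0// => ?; lra.
  rewrite e0 ?mulr0 in c1 c2 c3.
  move: c4; rewrite (z1 _ _ a1 al0 c1) (z1 _ _ a2 be0 c2) (z1 _ _ a3 r0 c3); lra.
have s (a c : R) : 6 * h * a <= c -> c <= 3 * (h * N) -> 2 * a <= N.
  move=> x1 x2; have : h * (6 * a) <= h * (3 * N) by lra.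
  by rewrite ler_pM2l//; lra.
(* With the factor 6 the three components are at most [N / 6], [N / 6] and [N / 2], which do not add
   up to [N]. *)
move=> x3 x2 x1.
have y1 : 6 * h * (3 * al) <= 3 * (h * N) by lra.
have y2 : 6 * h * (3 * be) <= 3 * (h * N) by lra.
have y3 : 6 * h * r <= 3 * (h * N) by lra.
have := s _ _ y1 (lexx _); have := s _ _ y2 (lexx _); have := s _ _ y3 (lexx _).
lra.
Qed.

Lemma op_bound_ge0 H h w : op_bound H h -> w != 0 -> 0 <= h.
Proof.
move=> hop w0; have := le_trans (norm2_ge0 _) (hop w).
by rewrite pmulr_lge0// norm2_gt0.
Qed.

Lemma cmod_far lam (z : R[i]) r : cmod (lam%:C%C - z) <= r ->
  2 * `|lam| - r <= cmod (lam%:C%C + z) /\ `|lam| - r <= cmod z.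
Proof.
move=> hz; split.
  have : cmod (lam%:C%C + lam%:C%C) <= cmod (lam%:C%C - z) + cmod (lam%:C%C + z).
    have -> : lam%:C%C + lam%:C%C = (lam%:C%C - z) + (lam%:C%C + z) :> R[i] by ring.
    exact: cmodD.
  by rewrite -(rmorphD (real_complex R)) cmod_real -mulr2n normrMn -mulr_natl; lra.
have : cmod lam%:C%C <= cmod (lam%:C%C - z) + cmod z.
  by apply: le_trans (cmodD _ _); rewrite subrK.
by rewrite cmod_real; lra.
Qed.

Lemma scaled_cancel (L c a b e k : R) :
  0 < L -> 0 <= b -> c * L <= a -> a * b <= e -> e <= k * L -> c * b <= k.
Proof.
move=> L0 b0 ha hb hc; rewrite -(ler_pM2r L0) mulrAC.
by apply: le_trans hc; apply: le_trans hb; rewrite ler_wpM2r.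
Qed.

(** The arithmetic of [simple_eigenvalue], with [L] for [|lam|], [X] and [Y] for the norms of [x]
    and [y], and primes on the quantities of [x]. *)
Lemma two_scale_contradiction (L h X Y e e' a a' b b' r r' c c' : R) :
  0 < L -> 0 <= h -> 100 * h <= L -> 0 < X -> 0 <= Y ->
  0 <= b -> 0 <= b' -> 0 <= r -> 0 <= r' ->
  2 * L - 6 * h <= a -> 2 * L - 6 * h <= a' -> L - 6 * h <= c -> L - 6 * h <= c' ->
  e <= h * Y -> a * b <= e -> c * r <= 3 * e -> Y <= h * X + b + r ->
  e' <= Y + h * X -> a' * b' <= e' -> c' * r' <= 3 * e' -> X <= b' + r' -> False.
Proof.
move=> L0 h0 hL X0 Y0 b0 b0' r0 r0' ha ha' hc hc' he hb hr hY he' hb' hr' hX.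
have hY2 : 100 * (h * Y) <= Y * L.
  by rewrite mulrA [100 * h * Y]mulrC ler_wpM2l.
have hX2 : 100 * (h * X) <= X * L.
  by rewrite mulrA [100 * h * X]mulrC ler_wpM2l// ltW.
have b1 : 19/10 * b <= Y / 100 by apply: scaled_cancel L0 b0 _ hb _; lra.
have r1 : 9/10 * r <= Y * 3 / 100 by apply: scaled_cancel L0 r0 _ hr _; lra.
have YX : Y <= 11/10 * (h * X) by lra.
have b1' : 19/10 * b' <= X * 21/1000 by apply: scaled_cancel L0 b0' _ hb' _; lra.
have r1' : 9/10 * r' <= X * 63/1000 by apply: scaled_cancel L0 r0' _ hr' _; lra.
lra.
Qed.

(** Two eigenvalues near [lam] would give a vector [x] orthogonal to [p1] such that [y = (A - z2) x]
    is zero or an eigenvector for [z1]. The [p1] component of [y] comes from [H x] only and its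
    other components are small because [z1] is near [lam], so [y] has size of order [h] times that
    of [x]. Then [x] is almost an eigenvector of the signal for [z2] without a component along [p1],
    which is impossible. *)
Lemma simple_eigenvalue lam (p1 p2 : 'cV[R]_n) H h z1 z2 Q :
  orthonormal_pair p1 p2 -> op_bound H h -> 0 < `|lam| -> 100 * h <= `|lam| ->
  char_poly (cplx (signal lam p1 p2 + H)) = ('X - z1%:P) * Q -> root Q z2 ->
  cmod (lam%:C%C - z1) <= 6 * h -> cmod (lam%:C%C - z2) <= 6 * h -> False.
Proof.
move=> o hop L0 hL cA rq hz1 hz2.
have [x [x0 px] ey] := double_eigenvalue (cplx p1)^T cA rq.
have {}px : dot p1 x = 0 by [].
move: ey => /=; set y := _ - z2 *: x => ey.
have h0 := op_bound_ge0 hop x0.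
have [f1 g1] := cmod_far hz1; have [f2 g2] := cmod_far hz2.
have ny := eigen_residual hop ey.
have [_ y2 y3 y4] := resolvent_components lam y z1 o.
have [_ x2 x3 x4] := resolvent_components lam x z2 o.
have [u1 _ u12 _] := o.
have y1 : cmod (dot p1 y) <= h * norm2 x.
  have -> : dot p1 y = dot p1 (cplx H *m x).
    by rewrite /y cplxD mulmxDl dotB dotD (dot_signal _ _ o) dotZ px !mulr0 add0r subr0.
  by apply: le_trans (cmod_dot_unit _ u1) (hop x).
have nx : norm2 (cplx (signal lam p1 p2) *m x - z2 *: x) <= norm2 y + h * norm2 x.
  have -> : cplx (signal lam p1 p2) *m x - z2 *: x = y - cplx H *m x.
    by rewrite /y cplxD mulmxDl addrAC addrK.
  by apply: le_trans (norm2B _ _) _; rewrite lerD2l.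
rewrite {1}px cmod0 add0r in x4.
apply: (two_scale_contradiction L0 h0 hL _ (norm2_ge0 y) (cmod_ge0 (dot p2 y))
  (cmod_ge0 (dot p2 x)) (norm2_ge0 _) (norm2_ge0 _) f1 f2 g1 g2 ny y2 y3 _ nx x2 x3 x4).
  by rewrite norm2_gt0.
by apply: le_trans y4 _; rewrite !lerD2r.
Qed.
End RankTwo.

(** * Existence, reality and location of the top eigenvalue *)

Section RealRoot.
Variables (R : realType) (n : nat).
Implicit Types (p : 'cV[R]_n) (H : 'M[R]_n) (lam h x : R).

Lemma horner_det (A B : 'M[R]_n) (t : R) :
  (\det (map_mx polyC A - 'X *: map_mx polyC B)).[t] = \det (A - t *: B).
Proof.
rewrite -/(horner_eval t _) -det_map_mx; congr (\det _).
by apply/matrixP => i j; rewrite !mxE /= /horner_eval !hornerE.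
Qed.

Lemma horner_char_poly (A : 'M[R]_n) (x : R) : (char_poly A).[x] = \det (x%:M - A).
Proof.
rewrite /char_poly /char_poly_mx -/(horner_eval x _) -det_map_mx; congr (\det _).
apply/matrixP => i j; rewrite !mxE /= /horner_eval !hornerE.
by rewrite hornerMn hornerX.
Qed.

(** The signal is a product of an [n] by 2 and a 2 by [n] matrix; Sylvester's identity leaves a
    diagonal 2 by 2 determinant. *)
Lemma det_sub_signal lam (p1 p2 : 'cV[R]_n) x : orthonormal_pair p1 p2 ->
  x ^+ 2 * \det (x%:M - signal lam p1 p2) = x ^+ n * (x ^+ 2 - lam ^+ 2).
Proof.
move=> [u1 u2 u12 u21].
have -> : signal lam p1 p2 = row_mx p1 p2 *m col_mx (lam *: p1^T) (- lam *: p2^T).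
  by rewrite mul_row_col /signal scalerBr -!scalemxAr scaleNr.
rewrite (@det_scalar_sub_mulmx _ n (1 + 1)); congr (_ * _).
rewrite mul_col_row -!scalemxAl.
rewrite (mx11_scalar (p1^T *m p1)) (mx11_scalar (p2^T *m p2)).
rewrite (mx11_scalar (p1^T *m p2)) (mx11_scalar (p2^T *m p1)) u1 u2 u12 u21.
rewrite raddf0 !scaler0 !scalemx1.
rewrite (scalar_mx_block 1 1) opp_block_mx add_block_mx oppr0 !addr0 det_ublock.
rewrite -!raddfB /= !det_scalar1; ring.
Qed.

Lemma cplx_eq0 p : (cplx p == 0) = (p == 0).
Proof. exact: map_mx_eq0. Qed.

Lemma op_boundZ H h t : 0 <= t <= 1 -> op_bound H h -> op_bound (t *: H) h.
Proof.
move=> /andP[t0 t1] hop x; rewrite cplxZ -scalemxAl norm2Z cmod_real ger0_norm//.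
by apply: le_trans (hop x); rewrite ler_piMl// norm2_ge0.
Qed.

(** A sign change would make [x - S - t H] singular for some [t] in [[0, 1]], hence [x] an
    eigenvalue of [S + t H]. The bound [h] also holds for [t H], and [x] lies outside the three
    discs of [eigenvalue_location]. *)
Lemma det_perturbed_sign lam (p1 p2 : 'cV[R]_n) H h x : orthonormal_pair p1 p2 ->
  op_bound H h -> 6 * h < `|lam - x| -> 6 * h < `|lam + x| -> 6 * h < `|x| ->
  0 < \det (x%:M - signal lam p1 p2) * \det (x%:M - (signal lam p1 p2 + H)).
Proof.
move=> o hop x1 x2 x3.
pose S := signal lam p1 p2.
pose P := \det (map_mx polyC (x%:M - S) - 'X *: map_mx polyC H).
have P0 : P.[0] = \det (x%:M - S) by rewrite horner_det scale0r subr0.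
have P1 : P.[1] = \det (x%:M - (S + H)) by rewrite horner_det scale1r opprD addrA.
rewrite -/S -P0 -P1 ltNge; apply/negP => hle.
have [t ht /eqP] := polyrcf.poly_ivt (@ler01 R) hle.
move: ht; rewrite in_itv /= => ht; rewrite horner_det => /eqP.
rewrite -det_tr => /det0P[v v0 hv].
have w0 : cplx v^T != 0 by rewrite cplx_eq0 trmx_eq0.
have hw : (S + t *: H) *m v^T = x *: v^T.
  move/(congr1 trmx): hv; rewrite trmx_mul trmxK trmx0 => /eqP.
  by rewrite -addrA -opprD mulmxBl mul_scalar_mx subr_eq0 => /eqP <-.
have {}hw : cplx (S + t *: H) *m cplx v^T = x%:C%C *: cplx v^T.
  by rewrite -cplxM hw cplxZ.
have := eigenvalue_location o (op_boundZ ht hop) w0 hw.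
rewrite -(rmorphB (real_complex R)) -(rmorphD (real_complex R)) !cmod_real.
by case; rewrite leNgt ?x1 ?x2 ?x3.
Qed.

(** At [lam / 2] and at [2 * lam] the characteristic polynomial has the sign of [x ^+ 2 - lam ^+ 2],
    negative at the first point and positive at the second. *)
Lemma real_eigenvalue lam (p1 p2 : 'cV[R]_n) H h : orthonormal_pair p1 p2 -> 0 < lam ->
  op_bound H h -> 100 * h <= lam ->
  exists2 z : R, lam / 2 <= z & root (char_poly (signal lam p1 p2 + H)) z.
Proof.
move=> o l0 hop hl; set A := _ + H.
have k (x : R) : 0 < x -> 6 * h < `|lam - x| -> 6 * h < `|lam + x| -> 6 * h < `|x| ->
    0 < (x ^+ 2 - lam ^+ 2) * (char_poly A).[x].
  move=> x0 x1 x2 x3; have := det_perturbed_sign o hop x1 x2 x3.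
  rewrite horner_char_poly -/A => hs.
  have e := det_sub_signal lam x o.
  have c0 : 0 < x ^+ 2 / x ^+ n by rewrite divr_gt0 ?exprn_gt0.
  have -> : x ^+ 2 - lam ^+ 2 = x ^+ 2 / x ^+ n * \det (x%:M - signal lam p1 p2).
    by rewrite mulrAC e mulrAC divff ?mul1r// expf_neq0// gt_eqF.
  by rewrite -mulrA mulr_gt0.
have far y : lam / 2 <= y -> 6 * h < `|y|.
  by move=> hy; rewrite ger0_norm; lra.
have ha : 0 < ((lam / 2) ^+ 2 - lam ^+ 2) * (char_poly A).[lam / 2].
  by apply: k; [lra|apply: far; lra|apply: far; lra|apply: far; lra].
have hb : 0 < ((2 * lam) ^+ 2 - lam ^+ 2) * (char_poly A).[2 * lam].
  by apply: k; [lra|rewrite distrC; apply: far; lra|apply: far; lra|apply: far; lra].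
have l2 : 0 < lam ^+ 2 by rewrite exprn_gt0.
have sa : (char_poly A).[lam / 2] <= 0.
  rewrite leNgt; apply/negP => pa; move: ha; rewrite pmulr_lgt0//.
  have -> : (lam / 2) ^+ 2 = lam ^+ 2 / 4 by field.
  lra.
have sb : 0 <= (char_poly A).[2 * lam].
  rewrite leNgt; apply/negP => pb; move: hb; rewrite nmulr_lgt0//.
  have -> : (2 * lam) ^+ 2 = 4 * lam ^+ 2 by ring.
  lra.
have hab : lam / 2 <= 2 * lam by lra.
have [z hz rz] := polyrcf.poly_ivt hab (mulr_le0_ge0 sa sb).
by exists z => //; move: hz; rewrite in_itv /= => /andP[].
Qed.
End RealRoot.

Section TopEigenvalue.
Variables (R : realType) (n : nat).
Implicit Types (A H : 'M[R]_n) (lam h x : R).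

Lemma char_poly_cplx A :
  char_poly (cplx A) = map_poly (real_complex R) (char_poly A).
Proof. by rewrite /cplx map_char_poly. Qed.

Lemma root_char_poly_conj A z :
  root (char_poly (cplx A)) z -> root (char_poly (cplx A)) z^*%C.
Proof.
rewrite char_poly_cplx => hz.
have <- : map_poly (@conjc R) (map_poly (real_complex R) (char_poly A)) =
          map_poly (real_complex R) (char_poly A).
  rewrite -map_poly_comp; apply: eq_map_poly => x /=; exact: conjc_real.
exact: (rmorph_root (@conjc R)).
Qed.

(** By the symmetry of the spectrum [z0] and [- z0] are both eigenvalues, so the two largest have
    modulus at least [z0 >= lam / 2] and must be near [lam] or [- lam]. If [l1] were near [- lam],
    so would be [l2], whose real part is not larger, against simplicity there. If [l1] were not
    real, its conjugate would be a second eigenvalue near [lam]. *)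
Lemma top_eigenvalue lam (p1 p2 : 'cV[R]_n) H h l1 l2 :
  orthonormal_pair p1 p2 -> 0 < lam -> op_bound H h -> 100 * h <= lam ->
  (forall z, root (char_poly (signal lam p1 p2 + H)) z ->
             root (char_poly (signal lam p1 p2 + H)) (- z)) ->
  top_two_eigenvalues (cplx (signal lam p1 p2 + H)) l1 l2 ->
  complex.Im l1 = 0 /\ `|complex.Re l1 - lam| <= 6 * h.
Proof.
move=> o lam0 hop hl sym [s [cA smax re21]].
set A := signal lam p1 p2 + H in sym cA.
have hroot z : root (char_poly (cplx A)) z = (z \in [:: l1, l2 & s]).
  by rewrite cA root_prod_XsubC.
have [z0 z0l rz0] := real_eigenvalue o lam0 hop hl.
have real_root x : root (char_poly A) x -> x%:C%C \in [:: l1, l2 & s].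
  by move=> rx; rewrite -hroot char_poly_cplx; exact: (rmorph_root (real_complex R)).
have m1 := real_root _ rz0; have m2 := real_root _ (sym _ rz0).
have cz (x : R[i]) : x = z0%:C%C \/ x = (- z0)%:C%C -> cmod x = z0.
  by case=> ->; rewrite cmod_real ?normrN ger0_norm//; lra.
have big : z0 <= cmod l1 /\ z0 <= cmod l2.
  have from_s (x : R[i]) : x \in s -> x = z0%:C%C \/ x = (- z0)%:C%C ->
      z0 <= cmod l1 /\ z0 <= cmod l2.
    by move=> /smax sm hx; rewrite -(cz x hx).
  move: m1 m2; rewrite !inE.
  move=> /or3P[/eqP a1|/eqP a1|/from_s/(_ (or_introl erefl))//]
    /or3P[/eqP a2|/eqP a2|/from_s/(_ (or_intror erefl))//].
  - have [] : z0 = - z0 by move: a1; rewrite -a2 => -[].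
    by move=> ?; exfalso; lra.
  - by rewrite -a1 -a2 !cmod_real normrN ger0_norm; lra.
  - by rewrite -a1 -a2 !cmod_real normrN ger0_norm; lra.
  - have [] : z0 = - z0 by move: a1; rewrite -a2 => -[].
    by move=> ?; exfalso; lra.
have loc z : root (char_poly (cplx A)) z -> z0 <= cmod z ->
    cmod (lam%:C%C - z) <= 6 * h \/ cmod (lam%:C%C + z) <= 6 * h.
  move=> /root_char_polyP[w w0 hw] hz.
  have h0 := op_bound_ge0 hop w0.
  have [|//|hz'] := eigenvalue_location o hop w0 hw; [by left|by right|].
  by exfalso; lra.
have r1 : root (char_poly (cplx A)) l1 by rewrite hroot inE eqxx.
have r2 : root (char_poly (cplx A)) l2 by rewrite hroot !inE eqxx orbT.
have q1 : char_poly (cplx A) = ('X - l1%:P) * \prod_(z <- l2 :: s) ('X - z%:P).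
  by rewrite cA big_cons.
have hL : 100 * h <= `|lam| by rewrite ger0_norm// ltW.
have hL0 : 0 < `|lam| by rewrite ger0_norm// ltW.
have ReD (x y : R[i]) : complex.Re (x + y) = complex.Re x + complex.Re y by case: x y => ? ? [].
have ReB (x y : R[i]) : complex.Re (x - y) = complex.Re x - complex.Re y by case: x y => ? ? [].
have near z : cmod (lam%:C%C - z) <= 6 * h -> `|complex.Re z - lam| <= 6 * h.
  by move=> hz; apply: le_trans hz; rewrite distrC; have := cmod_Re (lam%:C%C - z); rewrite ReB.
have far z : cmod (lam%:C%C + z) <= 6 * h -> `|lam + complex.Re z| <= 6 * h.
  by move=> hz; apply: le_trans hz; have := cmod_Re (lam%:C%C + z); rewrite ReD.
have [near1|far1] := loc _ r1 big.1; last first.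
  exfalso; have [near2|far2] := loc _ r2 big.2.
    have := near _ near2; have := far _ far1; rewrite !ler_norml => /andP[a1 a2] /andP[a3 a4].
    move: re21 z0l; clear -a1 a2 a3 a4 hl lam0; move=> *; lra.
  have o' := orthonormal_pairC o.
  have hL' : 100 * h <= `|- lam| by rewrite normrN.
  have hL0' : 0 < `|- lam| by rewrite normrN.
  have q1' : char_poly (cplx (signal (- lam) p2 p1 + H)) =
      ('X - l1%:P) * \prod_(z <- l2 :: s) ('X - z%:P).
    by rewrite signalC.
  apply: (simple_eigenvalue o' hop hL0' hL' q1' (z2 := l2)).
  - by rewrite root_prod_XsubC inE eqxx.
  - by rewrite rmorphN /= -opprD cmodN.
  - by rewrite rmorphN /= -opprD cmodN.
split; last exact: near.
apply/eqP; apply: contraT => im0; exfalso.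
have neq : l1^*%C != l1.
  apply: contra im0; case: (l1) => a b /eqP[] hb; apply/eqP => /=; lra.
have rc := root_char_poly_conj r1.
apply: (simple_eigenvalue o hop hL0 hL q1 (z2 := l1^*%C)) => //.
- move: rc; rewrite hroot inE (negbTE neq) /= => hs.
  by rewrite root_prod_XsubC.
- have -> : lam%:C%C - l1^*%C = (lam%:C%C - l1)^*%C.
    by rewrite rmorphB /= oppr0.
  by rewrite cmod_conj.
Qed.
End TopEigenvalue.

(** * Neumann expansion of the top eigenvector *)

Section Neumann.
Variables (R : realType) (n : nat).
Implicit Types (p : 'cV[R]_n) (A H : 'M[R]_n) (lam h x : R).

Definition lin (a x : 'cV[R]_n) : R := (a^T *m x) 0 0.

Lemma linE (a x : 'cV[R]_n) : lin a x = \sum_i a i 0 * x i 0.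
Proof. by rewrite /lin mxE; apply: eq_bigr => i _; rewrite mxE. Qed.

Lemma linD (a x y : 'cV[R]_n) : lin a (x + y) = lin a x + lin a y.
Proof. by rewrite /lin mulmxDr mxE. Qed.

Lemma linB (a x y : 'cV[R]_n) : lin a (x - y) = lin a x - lin a y.
Proof. by rewrite /lin mulmxBr !mxE. Qed.

Lemma linZ (a x : 'cV[R]_n) c : lin a (c *: x) = c * lin a x.
Proof. by rewrite /lin -scalemxAr mxE. Qed.

Lemma lin_delta (i : 'I_n) (x : 'cV[R]_n) : lin (delta_mx i 0) x = x i 0.
Proof.
rewrite linE (bigD1 i)//= mxE !eqxx mul1r big1 ?addr0// => j /negbTE ji.
by rewrite mxE ji mul0r.
Qed.

Lemma lin_signal lam (p1 p2 w : 'cV[R]_n) :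
  signal lam p1 p2 *m w = lam *: (lin p1 w *: p1 - lin p2 w *: p2).
Proof.
rewrite /signal -scalemxAl mulmxBl -!mulmxA.
by rewrite [p1^T *m w]mx11_scalar [p2^T *m w]mx11_scalar !mul_mx_scalar.
Qed.

Lemma iter_mulmxD H k (x y : 'cV[R]_n) :
  iter k (mulmx H) (x + y) = iter k (mulmx H) x + iter k (mulmx H) y.
Proof. by elim: k => //= k ->; rewrite mulmxDr. Qed.

Lemma iter_mulmxZ H k c (x : 'cV[R]_n) :
  iter k (mulmx H) (c *: x) = c *: iter k (mulmx H) x.
Proof. by elim: k => //= k ->; rewrite scalemxAr. Qed.

(** An exact finite identity: [w = r^-1 (S w + H w)] is substituted [K] times in the last term only,
    so no convergence is involved. *)
Lemma neumann H S (w a : 'cV[R]_n) (r : R) K : r != 0 ->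
  (S + H) *m w = r *: w ->
  lin a w = \sum_(k < K) r^-1 ^+ k.+1 * lin a (iter k (mulmx H) (S *m w))
            + r^-1 ^+ K * lin a (iter K (mulmx H) w).
Proof.
move=> r0 ew; elim: K => [|K IH]; first by rewrite big_ord0 add0r expr0 mul1r.
rewrite IH big_ord_recr /= -addrA; congr (_ + _).
have {1}-> : w = r^-1 *: (S *m w + H *m w).
  by rewrite -mulmxDl ew scalerA mulVf// scale1r.
rewrite iter_mulmxZ linZ iter_mulmxD linD -iterSr /= mulrA -exprSr.
by rewrite mulrDr.
Qed.

Lemma norm_lin (a x : 'cV[R]_n) : `|lin a x| <= norm2 (cplx a) * norm2 (cplx x).
Proof. by have := cmod_dot a (cplx x); rewrite dot_cplx cmod_real. Qed.

Lemma norm_iter H h k (x : 'cV[R]_n) : 0 <= h -> op_bound H h ->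
  norm2 (cplx (iter k (mulmx H) x)) <= h ^+ k * norm2 (cplx x).
Proof.
move=> h0 hop; elim: k => [|k IH] /=; first by rewrite expr0 mul1r.
rewrite cplxM exprS -mulrA; apply: le_trans (hop _) _.
exact: ler_wpM2l.
Qed.

Lemma sum_geometric (e : R) K : 0 <= e <= 2^-1 ->
  \sum_(k < K) e ^+ k.+1 <= 2 * e.
Proof.
move=> /andP[e0 e1].
apply: (@le_trans _ _ (\sum_(k < K) e * 2^-1 ^+ k)).
  apply: ler_sum => k _; rewrite exprS; apply: ler_wpM2l => //.
  by rewrite lerXn2r// nnegrE.
rewrite -mulr_sumr mulrC; apply: ler_wpM2r => //.
have -> : \sum_(k < K) 2^-1 ^+ k = 2 - 2 * 2^-1 ^+ K :> R.
  elim: K => [|K IH]; first by rewrite big_ord0 expr0; ring.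
  by rewrite big_ord_recr /= IH exprS; field.
have : 0 <= 2^-1 ^+ K :> R by rewrite exprn_ge0.
lra.
Qed.

Lemma eigenvector_close lam (p1 p2 : 'cV[R]_n) H h r (w : 'cV[R]_n) :
  orthonormal_pair p1 p2 -> 0 < lam -> op_bound H h -> 100 * h <= lam ->
  `|r - lam| <= 6 * h -> norm2 (cplx w) = 1 ->
  (signal lam p1 p2 + H) *m w = r *: w ->
  exists s : R, [/\ s = 1 \/ s = -1, `|lin p1 w - s| <= 5 * (h / lam),
     `|lin p1 w| <= 1, `|lin p2 w| <= h / lam
     & norm2 (cplx w - s%:C%C *: cplx p1) <= 10 * (h / lam)].
Proof.
move=> o lam0 hop hl hr w1 ew.
have ewc : cplx (signal lam p1 p2 + H) *m cplx w = r%:C%C *: cplx w.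
  by rewrite -cplxM ew cplxZ.
have he := eigen_residual hop ewc.
have [_ c2 c3 c4] := resolvent_components lam (cplx w) r%:C%C o.
have [u1 u2 _ _] := o.
have l1 : `|lin p1 w| <= 1.
  by apply: le_trans (norm_lin _ _) _; rewrite w1 mulr1 unit_norm2.
have h0 : 0 <= h.
  by apply: (op_bound_ge0 (w := cplx w) hop); rewrite -norm2_gt0 w1.
have hr' : cmod (lam%:C%C - r%:C%C) <= 6 * h.
  by rewrite -(rmorphB (real_complex R)) cmod_real distrC.
have [f g] := cmod_far hr'; rewrite (ger0_norm (ltW lam0)) in f g.
rewrite -(rmorphD (real_complex R)) cmod_real in f; rewrite cmod_real in g.
pose r' := cplx w - (dot p1 (cplx w) *: cplx p1 + dot p2 (cplx w) *: cplx p2).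
rewrite -/r' !dot_cplx -(rmorphD (real_complex R)) !cmod_real -!/(lin _ _) w1 in c2 c3 c4.
rewrite w1 mulr1 in he.
set eta := h / lam.
have eh : h = eta * lam by rewrite /eta divfK// gt_eqF.
have eta0 : 0 <= eta by rewrite divr_ge0// ltW.
have eta1 : eta <= 1/100 by rewrite /eta ler_pdivrMr//; lra.
have b2 : `|lin p2 w| <= eta.
  have : 19/10 * `|lin p2 w| <= eta.
    by apply: (scaled_cancel lam0 _ _ c2); [exact: normr_ge0|lra|rewrite -eh].
  by have := normr_ge0 (lin p2 w); lra.
have b3 : norm2 r' <= 7/2 * eta.
  have : 9/10 * norm2 r' <= 3 * eta.
    by apply: (scaled_cancel lam0 _ _ c3); [exact: norm2_ge0|lra|rewrite -mulrA -eh; lra].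
  by lra.
(* The component along [p2] and the remainder take at most [1 + 7/2] times [eta] from the unit norm
   of [w]. *)
have nc : `|lin p1 w| >= 1 - 9/2 * eta by lra.
have [s s1 hs] : exists2 s : R, s = 1 \/ s = -1 & `|lin p1 w - s| <= 5 * eta.
  have [p0|p0] := leP 0 (lin p1 w).
    exists 1; first by left.
    by rewrite ger0_norm// in nc l1; rewrite ler_norml; apply/andP; split; lra.
  exists (-1); first by right.
  by rewrite ltr0_norm// in nc l1; rewrite ler_norml; apply/andP; split; lra.
exists s; split => //.
have -> : cplx w - s%:C%C *: cplx p1 =
   ((lin p1 w - s)%:C%C *: cplx p1 + (lin p2 w)%:C%C *: cplx p2) + r'.
  by rewrite /r' !dot_cplx -!/(lin _ _); apply/matrixP => i j; rewrite !mxE rmorphB /=; ring.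
apply: le_trans (norm2D _ _) _.
have := norm2D ((lin p1 w - s)%:C%C *: cplx p1) ((lin p2 w)%:C%C *: cplx p2).
rewrite !norm2Z !cmod_real !unit_norm2// !mulr1; lra.
Qed.

End Neumann.

Section LinearForms.
Variables (R : realType) (n : nat).
Implicit Types (p : 'cV[R]_n) (A H : 'M[R]_n) (lam h x : R).

(** The term [k = 0] is the signal up to a relative error of order [h / lam], the middle terms form
    a geometric series with the factor [M], and the remainder is left to the operator norm. The
    condition on [lin a p1] and [lin a p2] holds for vectors supported in one block of the dilation,
    where [phi_plus] and [phi_minus] agree up to sign; it lets the [p2] term be charged to
    [lin a p1]. *)
Lemma linear_form lam (p1 p2 : 'cV[R]_n) H h r (w a : 'cV[R]_n) M q s :
  0 < lam -> 0 <= h -> op_bound H h -> 1000 * h <= lam ->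
  `|r - lam| <= 6 * h -> norm2 (cplx w) = 1 -> norm2 (cplx a) = 1 ->
  (signal lam p1 p2 + H) *m w = r *: w ->
  `|lin p1 w - s| <= 5 * (h / lam) -> `|lin p1 w| <= 1 -> `|lin p2 w| <= h / lam ->
  `|s| = 1 -> `|lin a p2| = `|lin a p1| ->
  (0 < q)%N -> 2^-1 ^+ q <= M ->
  (forall k, (0 < k <= q)%N -> `|lin a (iter k (mulmx H) p1)| <= M * h ^+ k) ->
  (forall k, (0 < k <= q)%N -> `|lin a (iter k (mulmx H) p2)| <= M * h ^+ k) ->
  `|lin a w - s * lin a p1| <= (14 * `|lin a p1| + 8 * M) * (h / lam).
Proof.
move=> lam0 h0 hop hl hr w1 a1 ew hal al1 hbe s1 e12 q0 hq hp1 hp2.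
set al := lin p1 w in hal al1; set be := lin p2 w in hbe.
set eta := h / lam in hal hbe *.
have eh : h = eta * lam by rewrite /eta divfK// gt_eqF.
have eta0 : 0 <= eta by rewrite divr_ge0// ltW.
have eta1 : eta <= 1/1000 by rewrite /eta ler_pdivrMr//; lra.
have M0 : 0 <= M by apply: le_trans hq; rewrite exprn_ge0.
have [hr1 hr2] : lam - 6 * h <= r /\ r <= lam + 6 * h.
  by move: hr; rewrite ler_norml => /andP[? ?]; lra.
have r0 : 0 < r by lra.
have rn0 : r != 0 by rewrite gt_eqF.
set e := h / r.
have ee : e <= 11/10 * eta.
  rewrite /e ler_pdivrMr//.
  have : eta * ((11/10 - 1) * lam) >= eta * (11/10 * (6 * h)) by apply: ler_wpM2l => //; lra.
  have : 11 / 10 * eta * (lam - 6 * h) <= 11/10 * eta * r by apply: ler_wpM2l => //; lra.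
  rewrite {3}eh; lra.
have e0 : 0 <= e by rewrite divr_ge0// ltW.
have lr : `|lam / r - 1| <= 7 * eta.
  have -> : lam / r - 1 = (lam - r) / r by field.
  rewrite normrM normfV [X in _ / X]gtr0_norm// distrC.
  apply: (@le_trans _ _ (6 * e)); last by lra.
  by rewrite /e mulrA ler_wpM2r// invr_ge0 ltW.
have [lrA lrB] : 0 <= lam / r /\ lam / r <= 11/10.
  split.
    by rewrite divr_ge0 ?ltW.
  move: lr; rewrite ler_norml => /andP[? ?]; lra.
rewrite (neumann a q rn0 ew).
case: q q0 hq hp1 hp2 => // q _ hq hp1 hp2.
pose F k := r^-1 ^+ k.+1 * lin a (iter k (mulmx H) (signal lam p1 p2 *m w)).
have -> : \sum_(k < q.+1) r^-1 ^+ k.+1 * lin a (iter k (mulmx H) (signal lam p1 p2 *m w)) =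
    F 0%N + \sum_(k < q) F k.+1 by rewrite big_ord_recl.
have -> : F 0%N = r^-1 * (lam * (al * lin a p1 - be * lin a p2)).
  by rewrite /F expr1 lin_signal linZ linB !linZ.
set T := \sum_(i < q) _; set Rm := _ * lin a (iter _ _ w).
have hT : `|T| <= 5 * eta * M.
  apply: le_trans (ler_norm_sum _ _ _) _.
  apply: (@le_trans _ _ (\sum_(k < q) (22/10 * M) * e ^+ k.+1)).
    apply: ler_sum => k _.
    rewrite /F lin_signal iter_mulmxZ linZ -/al -/be.
    have -> : al *: p1 - be *: p2 = al *: p1 + (- be) *: p2 by rewrite scaleNr.
    rewrite iter_mulmxD !iter_mulmxZ linD !linZ.
    have k1 := hp1 k.+1; have k2 := hp2 k.+1.
    set y1 := lin a _ in k1 *; set y2 := lin a _ in k2 *.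
    have {}k1 : `|y1| <= M * h ^+ k.+1 by apply: k1 => /=; exact: ltn_trans (ltn_ord k) _.
    have {}k2 : `|y2| <= M * h ^+ k.+1 by apply: k2 => /=; exact: ltn_trans (ltn_ord k) _.
    have -> : r^-1 ^+ k.+2 * (lam * (al * y1 + - be * y2)) =
       (lam / r) * (r^-1 ^+ k.+1 * (al * y1 + - be * y2)).
      by rewrite exprS; ring.
    rewrite normrM (ger0_norm lrA) normrM ger0_norm; last by rewrite exprn_ge0// invr_ge0 ltW.
    have hy : `|al * y1 + - be * y2| <= 2 * (M * h ^+ k.+1).
      apply: le_trans (ler_normD _ _) _; rewrite !normrM normrN.
      have : `|al| * `|y1| <= 1 * (M * h ^+ k.+1) by apply: ler_pM.
      have : `|be| * `|y2| <= 1 * (M * h ^+ k.+1) by apply: ler_pM => //; lra.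
      lra.
    have -> : e ^+ k.+1 = r^-1 ^+ k.+1 * h ^+ k.+1 by rewrite /e exprMn mulrC.
    have -> : 22 / 10 * M * (r^-1 ^+ k.+1 * h ^+ k.+1) = 11/10 * (r^-1 ^+ k.+1 * (2 * (M * h ^+ k.+1))) by field.
    have ri0 : 0 <= r^-1 ^+ k.+1 by rewrite exprn_ge0// invr_ge0 ltW.
    by apply: ler_pM => //; [rewrite mulr_ge0|exact: ler_wpM2l].
  rewrite -mulr_sumr.
  have hg : \sum_(k < q) e ^+ k.+1 <= 2 * e.
    by apply: sum_geometric; rewrite e0 /= (le_trans ee)//; clear -eta1; lra.
  have h1 : 22/10 * M * \sum_(k < q) e ^+ k.+1 <= 22/10 * M * (2 * e).
    by apply: ler_wpM2l => //; lra.
  apply: le_trans h1 _.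
  have h2 : M * e <= M * (11/10 * eta) by apply: ler_wpM2l.
  have h3 : 0 <= M * eta by rewrite mulr_ge0.
  lra.
(* One factor [e] is kept for the rate; the others are at most 1/2 each and together fall below
   [2 * M]. *)
have hR : `|Rm| <= 3 * eta * M.
  have ri0 : 0 <= r^-1 ^+ q.+1 by rewrite exprn_ge0// invr_ge0 ltW.
  rewrite /Rm normrM (ger0_norm ri0).
  have hh : `|lin a (iter q.+1 (mulmx H) w)| <= h ^+ q.+1.
    apply: le_trans (norm_lin _ _) _; rewrite a1 mul1r.
    by apply: le_trans (norm_iter _ _ h0 hop) _; rewrite w1 mulr1.
  apply: (@le_trans _ _ (e ^+ q.+1)).
    by rewrite /e exprMn mulrC; apply: ler_wpM2r.
  have h1 : e ^+ q <= 2^-1 ^+ q by rewrite lerXn2r ?nnegrE//; lra.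
  rewrite exprS.
  have h2 : e * e ^+ q <= e * (2 * M).
    apply: ler_wpM2l => //; apply: le_trans h1 _.
    by move: hq; rewrite exprS; lra.
  have h3 : M * e <= M * (11/10 * eta) by apply: ler_wpM2l.
  have h4 : 0 <= M * eta by rewrite mulr_ge0.
  lra.
set c := lin a p1 in e12 *; set c2 := lin a p2 in e12 *.
have -> : r^-1 * (lam * (al * c - be * c2)) + T + Rm - s * c =
  ((lam / r - 1) * (al * c) + (al - s) * c - (lam / r) * (be * c2)) + T + Rm by ring.
apply: le_trans (ler_normD _ _) _.
apply: le_trans (lerD (ler_normD _ _) (lexx _)) _.
(* The coefficient 14 rounds up [7 + 5 + 11/10]: [r] against [lam], [al] against [s], and the
   component along [p2]. The coefficient 8 is [5 + 3], from [T] and [Rm]. *)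
have k1 : `|(lam / r - 1) * (al * c)| <= 7 * eta * `|c|.
  by rewrite !normrM; apply: ler_pM => //; rewrite ?mulr_ge0// ler_piMl.
have k2 : `|(al - s) * c| <= 5 * eta * `|c| by rewrite normrM; apply: ler_wpM2r.
have k3 : `|(lam / r) * (be * c2)| <= 11/10 * (eta * `|c|).
  rewrite normrM (ger0_norm lrA) [X in _ * X]normrM e12; apply: ler_pM => //.
  exact: ler_wpM2r.
have k4 : `|(lam / r - 1) * (al * c) + (al - s) * c - (lam / r) * (be * c2)| <= 14 * (eta * `|c|).
  apply: le_trans (ler_normB _ _) _.
  have := ler_normD ((lam / r - 1) * (al * c)) ((al - s) * c).
  have : 0 <= eta * `|c| by rewrite mulr_ge0.
  move: k1 k2 k3; clear; lra.
move: hT hR k4; clear; lra.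
Qed.
End LinearForms.

(** * Deterministic error bounds for dilations *)

Section Dilations.
Variables (R : realType) (n1 n2 : nat).
Implicit Types (us : 'cV[R]_n1) (vs : 'cV[R]_n2).

Definition phi_plus us vs : 'cV[R]_(n1 + n2) := (Num.sqrt 2)^-1 *: col_mx us vs.
Definition phi_minus us vs : 'cV[R]_(n1 + n2) := (Num.sqrt 2)^-1 *: col_mx us (- vs).

Lemma sqrt2_inv_sqr : (Num.sqrt 2)^-1 * (Num.sqrt 2)^-1 = 2^-1 :> R.
Proof. by rewrite -invfM -expr2 sqr_sqrtr. Qed.

Lemma mulmx_sqrt2_inv m p q (X : 'M[R]_(m, p)) (Y : 'M[R]_(p, q)) :
  ((Num.sqrt 2)^-1 *: X) *m ((Num.sqrt 2)^-1 *: Y) = 2^-1 *: (X *m Y).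
Proof. by rewrite -scalemxAl -scalemxAr scalerA sqrt2_inv_sqr. Qed.

Lemma dilation_signal (lam : R) us vs (H1 H2 : 'M[R]_(n1, n2)) :
  dilation (lam *: (us *m vs^T) + H1) (lam *: (us *m vs^T) + H2) =
  signal lam (phi_plus us vs) (phi_minus us vs) + dilation H1 H2.
Proof.
have trZ m p (c : R) (X : 'M[R]_(m, p)) : (c *: X)^T = c *: X^T by rewrite linearZ.
have trN m p (X : 'M[R]_(m, p)) : (- X)^T = - X^T by rewrite linearN.
rewrite /dilation /signal /phi_plus /phi_minus !trZ !mulmx_sqrt2_inv.
rewrite !tr_col_mx !mul_col_row -scalerBr opp_block_mx add_block_mx scalerA.
rewrite !trN !mulmxN !mulNmx !opprK !subrr scale_block_mx add_block_mx !scaler0 !addr0.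
rewrite linearD /= trZ trmx_mul trmxK -!mulr2n.
by congr block_mx; congr (_ + _); rewrite -(scaler_nat 2 (_ *m _)) scalerA divfK.
Qed.

Lemma norm2_unit_dot m (x : 'cV[R]_m) : norm2 (cplx x) = 1 -> (x^T *m x) 0 0 = 1.
Proof.
move=> x1; have := norm2_cplx_sqr x; rewrite x1 expr1n mxE => ->.
by apply: eq_bigr => i _; rewrite mxE expr2.
Qed.

Lemma phi_orthonormal us vs : norm2 (cplx us) = 1 -> norm2 (cplx vs) = 1 ->
  orthonormal_pair (phi_plus us vs) (phi_minus us vs).
Proof.
move=> /norm2_unit_dot u1 /norm2_unit_dot v1.
have trZ m p (c : R) (X : 'M[R]_(m, p)) : (c *: X)^T = c *: X^T by rewrite linearZ.
have trN m p (X : 'M[R]_(m, p)) : (- X)^T = - X^T by rewrite linearN.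
rewrite /orthonormal_pair /phi_plus /phi_minus !trZ !mulmx_sqrt2_inv.
rewrite !tr_col_mx !mul_row_col !trN !mulNmx !mulmxN opprK !mxE.
rewrite !mxE in u1 v1; rewrite u1 v1; split; try lra.
Qed.

(** Changing the sign of the lower half of an eigenvector changes the sign of its eigenvalue. *)
Lemma dilation_char_poly_sym (M1 M2 : 'M[R]_(n1, n2)) z :
  root (char_poly (dilation M1 M2)) z -> root (char_poly (dilation M1 M2)) (- z).
Proof.
move=> /root_char_polyP[w w0]; rewrite -[w]vsubmxK /dilation mul_block_col !mul0mx add0r addr0.
rewrite scale_col_mx => /eq_col_mx[e1 e2].
apply/root_char_polyP; exists (col_mx (usubmx w) (- dsubmx w)).
  apply: contraNneq w0 => /eqP; rewrite col_mx_eq0 oppr_eq0 => h.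
  by rewrite -[w]vsubmxK col_mx_eq0.
rewrite mul_block_col !mul0mx add0r addr0 mulmxN e1 e2 scale_col_mx.
by rewrite scalerN !scaleNr opprK.
Qed.

Lemma norm2_usubmx (x : 'cV[R[i]]_(n1 + n2)) : norm2 (usubmx x) <= norm2 x.
Proof.
rewrite -(@ler_pXn2r _ 2) ?nnegrE ?norm2_ge0// !norm2_sqr big_split_ord /=.
rewrite (eq_bigr (fun i => cmod (x (lshift n2 i) 0) ^+ 2)); last by move=> i _; rewrite mxE.
by rewrite lerDl sumr_ge0// => i _; rewrite sqr_ge0.
Qed.

Lemma norm2_dsubmx (x : 'cV[R[i]]_(n1 + n2)) : norm2 (dsubmx x) <= norm2 x.
Proof.
rewrite -(@ler_pXn2r _ 2) ?nnegrE ?norm2_ge0// !norm2_sqr big_split_ord /=.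
rewrite (eq_bigr (fun i => cmod (x (rshift n1 i) 0) ^+ 2)); last by move=> i _; rewrite mxE.
by rewrite lerDr sumr_ge0// => i _; rewrite sqr_ge0.
Qed.
End Dilations.

Section Normalization.
Variables (R : realType) (m : nat).

Lemma min_pm_le (N : 'cV[R[i]]_m -> R) x y (s : R) : s = 1 \/ s = -1 ->
  min_pm N x y <= N (x - s%:C%C *: cplx y).
Proof.
case=> ->; rewrite /min_pm ge_min.
  by rewrite rmorph1 scale1r lexx.
by rewrite rmorphN rmorph1 scaleN1r opprK lexx orbT.
Qed.

Lemma min_dot_le a x (y : 'cV[R]_m) (s : R) : s = 1 \/ s = -1 ->
  Num.min (cmod (dot a (x - cplx y))) (cmod (dot a (x + cplx y)))
    <= cmod (dot a (x - s%:C%C *: cplx y)).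
Proof. exact: (min_pm_le (fun z => cmod (dot a z))). Qed.

Lemma sqrt2_inv_bounds : (7/10 : R) <= (Num.sqrt (2 : R))^-1 <= 1.
Proof.
have h := @sqrt2_inv_sqr R; set c := (Num.sqrt 2)^-1 in h *.
have c0 : 0 <= c by rewrite invr_ge0 sqrtr_ge0.
apply/andP; split; rewrite -(@ler_pXn2r _ 2) ?nnegrE// expr2.
  by rewrite expr2 h; lra.
by rewrite expr2 h; lra.
Qed.

(** With [N] the norm of [x] and [c] the inverse of the square root of 2, replacing [c] by [N] adds
    an error parallel to [t]. Normalization therefore costs a linear form only a multiple of
    [|a^T t|], besides the factor 2 that bounds [N^-1]. *)
Lemma normalize_close (x : 'cV[R[i]]_m) (t : 'cV[R]_m) (s eta : R) :
  norm2 (cplx t) = 1 -> s = 1 \/ s = -1 -> 0 <= eta -> eta <= 1/1000 ->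
  norm2 (x - (s * (Num.sqrt 2)^-1)%:C%C *: cplx t) <= 10 * eta ->
  norm2 (normalize x - s%:C%C *: cplx t) <= 40 * eta /\
  forall (a : 'cV[R]_m) delta,
    cmod (dot a x - (s * (Num.sqrt 2)^-1 * (a^T *m t) 0 0)%:C%C) <= delta ->
    cmod (dot a (normalize x - s%:C%C *: cplx t)) <= 2 * delta + 20 * eta * `|(a^T *m t) 0 0|.
Proof.
move=> t1 hs eta0 eta1; set c := (Num.sqrt 2)^-1 => hx.
have /andP[c1 c2] : 7/10 <= c <= 1 := sqrt2_inv_bounds.
have s1 : `|s| = 1 by case: hs => ->; rewrite ?normrN normr1.
set N := norm2 x.
have hN : `|N - c| <= 10 * eta.
  have e1 : norm2 ((s * c)%:C%C *: cplx t) = c.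
    by rewrite norm2Z t1 cmod_real normrM s1 mulr1 mul1r ger0_norm//; lra.
  rewrite ler_norml; apply/andP; split.
    have := norm2B x (x - (s * c)%:C%C *: cplx t); rewrite subKr e1 -/N; lra.
  have := norm2D (x - (s * c)%:C%C *: cplx t) ((s * c)%:C%C *: cplx t).
  by rewrite subrK e1 -/N; lra.
have N6 : 6/10 <= N by move: hN; rewrite ler_norml => /andP[? ?]; lra.
have N0 : 0 < N by lra.
have iN : 0 <= N^-1 <= 2.
  by rewrite invr_ge0 (ltW N0)/= -[2]invrK lef_pV2 ?posrE//; lra.
have /andP[iN1 iN2] := iN.
have key : normalize x - s%:C%C *: cplx t = (N^-1)%:C%C *:
   ((x - (s * c)%:C%C *: cplx t) - (s * (N - c))%:C%C *: cplx t).
  have e : (s * c)%:C%C + (s * (N - c))%:C%C = (s * N)%:C%C :> R[i].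
    by rewrite -(rmorphD (real_complex R)) -mulrDr addrC subrK.
  rewrite -addrA -opprD -scalerDl e scalerBr scalerA -(rmorphM (real_complex R)).
  by rewrite [N^-1 * _]mulrC mulfK// gt_eqF.
have hk : `|s * (N - c)| <= 10 * eta by rewrite normrM s1 mul1r.
rewrite key norm2Z cmod_real ger0_norm//; split.
  apply: (@le_trans _ _ (2 * (20 * eta))); last by lra.
  apply: ler_pM => //; first exact: norm2_ge0.
  apply: le_trans (norm2B _ _) _; rewrite norm2Z t1 cmod_real mulr1.
  by move: hx hk; clear; lra.
move=> a delta hd; rewrite dotZ cmodM cmod_real ger0_norm// dotB !dotZ dotB dotZ dot_cplx.
rewrite -!rmorphM.
set g := (a^T *m t) 0 0 in hd *.
have -> : 2 * delta + 20 * eta * `|g| = 2 * (delta + 10 * eta * `|g|) by ring.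
apply: ler_pM => //; first exact: cmod_ge0.
apply: le_trans (cmodB _ _) _; apply: lerD => //.
by rewrite cmod_real normrM; apply: ler_wpM2r.
Qed.
End Normalization.

Section Deterministic.
Variables (R : realType) (n1 n2 : nat).

Lemma norm2_sum1 m (a : 'cV[R]_m) : \sum_i a i 0 ^+ 2 = 1 -> norm2 (cplx a) = 1.
Proof. by move=> h; rewrite -[LHS]ger0_norm ?norm2_ge0// -sqrtr_sqr norm2_cplx_sqr h sqrtr1. Qed.

Lemma norm2_unit_sum m (a : 'cV[R]_m) : norm2 (cplx a) = 1 -> \sum_i a i 0 ^+ 2 = 1.
Proof. by move=> h; rewrite -norm2_cplx_sqr h expr1n. Qed.

Lemma sum_sqr_col_mx0 (a : 'cV[R]_n1) :
  \sum_i (col_mx a (0 : 'cV[R]_n2)) i 0 ^+ 2 = \sum_i a i 0 ^+ 2.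
Proof.
rewrite big_split_ord /= [X in _ + X]big1 ?addr0 => [|i _]; last by rewrite col_mxEd mxE expr0n.
by apply: eq_bigr => i _; rewrite col_mxEu.
Qed.

Lemma sum_sqr_col_0mx (b : 'cV[R]_n2) :
  \sum_i (col_mx (0 : 'cV[R]_n1) b) i 0 ^+ 2 = \sum_i b i 0 ^+ 2.
Proof.
rewrite big_split_ord /= big1 ?add0r => [|i _]; last by rewrite col_mxEu mxE expr0n.
by apply: eq_bigr => i _; rewrite col_mxEd.
Qed.

Lemma sum_sqr_delta m (i : 'I_m) : \sum_j (delta_mx i 0 : 'cV[R]_m) j 0 ^+ 2 = 1.
Proof.
rewrite (bigD1 i)//= mxE !eqxx expr1n big1 ?addr0// => j /negbTE ji.
by rewrite mxE ji expr0n.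
Qed.

Lemma lin_col_mx (a x : 'cV[R]_n1) (b y : 'cV[R]_n2) :
  lin (col_mx a b) (col_mx x y) = lin a x + lin b y.
Proof. by rewrite /lin tr_col_mx mul_row_col mxE. Qed.

Lemma lin0 m (x : 'cV[R]_m) : lin 0 x = 0.
Proof. by rewrite /lin trmx0 mul0mx mxE. Qed.

Lemma linN m (a x : 'cV[R]_m) : lin a (- x) = - lin a x.
Proof. by rewrite /lin mulmxN mxE. Qed.

Lemma dot_delta m (i : 'I_m) (x : 'cV[R[i]]_m) : dot (delta_mx i 0) x = x i 0.
Proof.
rewrite dotE (bigD1 i)//= mxE !eqxx mul1r big1 ?addr0// => j /negbTE ji.
by rewrite mxE ji mul0r.
Qed.

Lemma norminf_le m (x : 'cV[R[i]]_m) c : 0 <= c -> (forall i, cmod (x i 0) <= c) ->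
  norminf x <= c.
Proof.
move=> c0 h; rewrite /norminf; elim/big_ind: _ => // y z hy hz.
by rewrite ge_max hy.
Qed.

Lemma cplx_inj m p : injective (@cplx R m p).
Proof. by move=> A B /matrixP h; apply/matrixP => i j; have := h i j; rewrite !mxE => -[]. Qed.

(** [test] stands for the finitely many fixed directions along which powers of the noise are
    controlled. The entrywise bounds are the linear-form bounds at the basis vectors, where the
    signal itself is at most [2 * M]. *)
Lemma deterministic_bound (lam h M : R) (q : nat) (us : 'cV[R]_n1) (vs : 'cV[R]_n2)
    (H1 H2 : 'M[R]_(n1, n2)) (u : 'cV[R[i]]_n1) (v : 'cV[R[i]]_n2)
    (test : 'cV[R]_(n1 + n2) -> Prop) :
  0 < lam -> 0 <= h -> 1000 * h <= lam ->
  norm2 (cplx us) = 1 -> norm2 (cplx vs) = 1 ->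
  op_bound (dilation H1 H2) h -> (0 < q)%N -> 2^-1 ^+ q <= M ->
  (forall i, `|us i 0| <= 2 * M) -> (forall i, `|vs i 0| <= 2 * M) ->
  (forall c k, test c -> (0 < k <= q)%N ->
     `|lin c (iter k (mulmx (dilation H1 H2)) (phi_plus us vs))| <= M * h ^+ k /\
     `|lin c (iter k (mulmx (dilation H1 H2)) (phi_minus us vs))| <= M * h ^+ k) ->
  (forall i, test (col_mx (delta_mx i 0) 0)) ->
  (forall i, test (col_mx 0 (delta_mx i 0))) ->
  dilation_estimate (lam *: (us *m vs^T) + H1) (lam *: (us *m vs^T) + H2) u v ->
  [/\ Num.max (min_pm (@norm2 R n1) u us) (min_pm (@norm2 R n2) v vs) <= 40 * (h / lam),
      Num.max (min_pm (@norminf R n1) u us) (min_pm (@norminf R n2) v vs)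
        <= 200 * M * (h / lam),
      forall a, norm2 (cplx a) = 1 -> test (col_mx a 0) ->
        Num.min (cmod (dot a (u - cplx us))) (cmod (dot a (u + cplx us)))
          <= 50 * (`|(a^T *m us) 0 0| + M) * (h / lam)
    & forall b, norm2 (cplx b) = 1 -> test (col_mx 0 b) ->
        Num.min (cmod (dot b (v - cplx vs))) (cmod (dot b (v + cplx vs)))
          <= 50 * (`|(b^T *m vs) 0 0| + M) * (h / lam)].
Proof.
move=> lam0 h0 hl u1 v1 hop q0 hq usM vsM htest testu testv.
set c := (Num.sqrt (2 : R))^-1.
have /andP[c1 c2] : 7/10 <= c <= 1 := sqrt2_inv_bounds R.
have c0 : 0 <= c by move: c1; clear; lra.
have o := phi_orthonormal u1 v1.
have hl2 : 100 * h <= lam by move: h0 hl; clear; lra.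
rewrite /dilation_estimate dilation_signal => -[l1 [l2 [w [ht ew w1 wre [-> ->]]]]].
have sym z : root (char_poly (signal lam (phi_plus us vs) (phi_minus us vs) + dilation H1 H2)) z ->
  root (char_poly (signal lam (phi_plus us vs) (phi_minus us vs) + dilation H1 H2)) (- z).
  by rewrite -dilation_signal; exact: dilation_char_poly_sym.
have [im0 hr] := top_eigenvalue o lam0 hop hl2 sym ht.
set r := complex.Re l1 in hr.
have el1 : l1 = r%:C%C by rewrite /r; case: (l1) im0 => x y /= ->.
pose wr : 'cV[R]_(n1 + n2) := \col_i complex.Re (w i 0).
have ewr : w = cplx wr.
  apply/matrixP => i j; rewrite ord1 !mxE; have := wre im0 i.
  by case: (w i 0) => x y /= ->.
rewrite ewr in w1 *.
have {}ew : (signal lam (phi_plus us vs) (phi_minus us vs) + dilation H1 H2) *m wr = r *: wr.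
  by apply: cplx_inj; rewrite cplxM cplxZ -el1 -ewr.
have [s [hs hal al1 hbe hclose]] := eigenvector_close o lam0 hop hl2 hr w1 ew.
have s1 : `|s| = 1 by case: hs => ->; rewrite ?normrN normr1.
set eta := h / lam in hal hbe hclose *.
have eta0 : 0 <= eta by rewrite divr_ge0// ltW.
have eta1 : eta <= 1/1000 by rewrite /eta ler_pdivrMr//; move: hl; clear; lra.
have M0 : 0 <= M by apply: le_trans hq; rewrite exprn_ge0.
have Me0 : 0 <= M * eta by rewrite mulr_ge0.
have form A : norm2 (cplx A) = 1 -> test A ->
    `|lin A (phi_minus us vs)| = `|lin A (phi_plus us vs)| ->
    `|lin A wr - s * lin A (phi_plus us vs)| <= (14 * `|lin A (phi_plus us vs)| + 8 * M) * eta.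
  move=> A1 tA eA; apply: (linear_form lam0 h0 hop hl hr w1 A1 ew hal al1 hbe s1 eA q0 hq).
  - by move=> k hk; have [] := htest A k tA hk.
  - by move=> k hk; have [] := htest A k tA hk.
have usubE : usubmx (cplx wr) = cplx (usubmx wr) by rewrite /cplx map_usubmx.
have dsubE : dsubmx (cplx wr) = cplx (dsubmx wr) by rewrite /cplx map_dsubmx.
have linu a : lin (col_mx a 0) wr = lin a (usubmx wr).
  by rewrite -{1}[wr]vsubmxK lin_col_mx lin0 addr0.
have linv b : lin (col_mx 0 b) wr = lin b (dsubmx wr).
  by rewrite -{1}[wr]vsubmxK lin_col_mx lin0 add0r.
have pu a : lin (col_mx a 0) (phi_plus us vs) = c * lin a us.
  by rewrite linZ lin_col_mx lin0 addr0.
have pu' a : lin (col_mx a 0) (phi_minus us vs) = c * lin a us.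
  by rewrite linZ lin_col_mx lin0 addr0.
have pv b : lin (col_mx 0 b) (phi_plus us vs) = c * lin b vs.
  by rewrite linZ lin_col_mx lin0 add0r.
have pv' b : lin (col_mx 0 b) (phi_minus us vs) = - (c * lin b vs).
  by rewrite linZ lin_col_mx lin0 add0r linN mulrN.
have closeu : norm2 (usubmx (cplx wr) - (s * c)%:C%C *: cplx us) <= 10 * eta.
  apply: le_trans hclose.
  have -> : usubmx (cplx wr) - (s * c)%:C%C *: cplx us =
            usubmx (cplx wr - s%:C%C *: cplx (phi_plus us vs)).
    have phiE : usubmx (cplx (phi_plus us vs)) = c%:C%C *: cplx us.
      by rewrite cplxZ linearZ /= /cplx map_col_mx col_mxKu.
    rewrite linearB /= (linearZ _ (cplx (phi_plus us vs))) /= phiE scalerA.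
    by rewrite (rmorphM (real_complex R)).
  exact: norm2_usubmx.
have closev : norm2 (dsubmx (cplx wr) - (s * c)%:C%C *: cplx vs) <= 10 * eta.
  apply: le_trans hclose.
  have -> : dsubmx (cplx wr) - (s * c)%:C%C *: cplx vs =
            dsubmx (cplx wr - s%:C%C *: cplx (phi_plus us vs)).
    have phiE : dsubmx (cplx (phi_plus us vs)) = c%:C%C *: cplx vs.
      by rewrite cplxZ linearZ /= /cplx map_col_mx col_mxKd.
    rewrite linearB /= (linearZ _ (cplx (phi_plus us vs))) /= phiE scalerA.
    by rewrite (rmorphM (real_complex R)).
  exact: norm2_dsubmx.
have [nu fu] := normalize_close u1 hs eta0 eta1 closeu.
have [nv fv] := normalize_close v1 hs eta0 eta1 closev.
have arith g : `|c * g| <= `|g|.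
  by rewrite normrM (ger0_norm c0) ler_piMl.
(* The constant 50 rounds up [2 * 14 + 20] for [|g|] and [2 * 8] for [M]. *)
have delta g (x : R[i]) : cmod x <= 2 * ((14 * `|c * g| + 8 * M) * eta) + 20 * eta * `|g| ->
    cmod x <= 50 * (`|g| + M) * eta.
  move=> hx; apply: le_trans hx _.
  have k : `|c * g| * eta <= `|g| * eta by apply: ler_wpM2r.
  have k' : 0 <= `|g| * eta by rewrite mulr_ge0.
  by move: k k' Me0; clear; lra.
have boundu a : norm2 (cplx a) = 1 -> test (col_mx a 0) ->
    cmod (dot a (normalize (usubmx (cplx wr)) - s%:C%C *: cplx us)) <= 50 * (`|lin a us| + M) * eta.
  move=> a1 ta; apply: delta; apply: fu.
  have := form (col_mx a 0) _ ta _; rewrite linu pu pu' => hf.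
  rewrite usubE dot_cplx -(rmorphB (real_complex R)) cmod_real -mulrA.
  by apply: hf => //; apply: norm2_sum1; rewrite sum_sqr_col_mx0 norm2_unit_sum.
have boundv b : norm2 (cplx b) = 1 -> test (col_mx 0 b) ->
    cmod (dot b (normalize (dsubmx (cplx wr)) - s%:C%C *: cplx vs)) <= 50 * (`|lin b vs| + M) * eta.
  move=> b1 tb; apply: delta; apply: fv.
  have := form (col_mx 0 b) _ tb _; rewrite linv pv pv' normrN => hf.
  rewrite dsubE dot_cplx -(rmorphB (real_complex R)) cmod_real -mulrA.
  by apply: hf => //; apply: norm2_sum1; rewrite sum_sqr_col_0mx norm2_unit_sum.
have inf0 : 0 <= 200 * M * eta by move: Me0; clear; lra.
have infb g : `|g| <= 2 * M -> 50 * (`|g| + M) * eta <= 200 * M * eta.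
  move=> hg; have : `|g| * eta <= 2 * M * eta by apply: ler_wpM2r.
  by move: Me0; clear; lra.
split.
- by rewrite ge_max !(le_trans (min_pm_le _ _ _ hs)).
- rewrite ge_max; apply/andP; split; apply: le_trans (min_pm_le _ _ _ hs) _;
    apply: norminf_le => // i; rewrite -dot_delta.
    apply: le_trans (boundu _ _ (testu i)) _; first by rewrite norm2_sum1 ?sum_sqr_delta.
    by rewrite lin_delta infb.
  apply: le_trans (boundv _ _ (testv i)) _; first by rewrite norm2_sum1 ?sum_sqr_delta.
  by rewrite lin_delta infb.
- move=> a a1 ta; apply: le_trans (min_dot_le _ _ _ hs) _; exact: boundu.
- move=> b b1 tb; apply: le_trans (min_dot_le _ _ _ hs) _; exact: boundv.
Qed.
End Deterministic.

(** * Operator norm from a trace of powers *)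

Section TraceBound.
Variables (R : realType) (n : nat).
Implicit Types (x y : 'cV[R]_n).

Lemma lin_ge0 x : 0 <= lin x x.
Proof. by rewrite linE sumr_ge0// => i _; rewrite -expr2 sqr_ge0. Qed.

Lemma lin_cauchy_schwarz x y : lin x y ^+ 2 <= lin x x * lin y y.
Proof.
rewrite !linE; apply: le_trans (sum_cauchy_schwarz _ _) _.
by under eq_bigr do rewrite expr2; under [X in _ * X <= _]eq_bigr do rewrite expr2.
Qed.

Lemma lin_mulmx (A : 'M[R]_n) x y : lin x (A *m y) = lin (A^T *m x) y.
Proof. by rewrite /lin trmx_mul trmxK mulmxA. Qed.

Variables (H : 'M[R]_n).
Let G := H *m H^T.

Let trG : G^T = G. Proof. by rewrite /G trmx_mul trmxK. Qed.

Lemma lin_iter_gram a b x y : lin x (iter (a + b) (mulmx G) y) =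
  lin (iter a (mulmx G) x) (iter b (mulmx G) y).
Proof.
elim: a x => // a IH x; rewrite addSn iterS lin_mulmx trG IH.
by rewrite -iterSr.
Qed.

(** Repeated Cauchy-Schwarz: for symmetric [G], the square of [x^T G^m x] is at most [x^T G^(2m) x]
    times [x^T x]. Doubling [m] takes the place of diagonalizing [G] and is the reason why exponents
    are powers of two. *)
Lemma gram_power_le j x :
  lin x (G *m x) ^+ (2 ^ j) <= lin x (iter (2 ^ j) (mulmx G) x) * lin x x ^+ (2 ^ j - 1).
Proof.
have g0 : 0 <= lin x (G *m x) by rewrite /G -mulmxA lin_mulmx lin_ge0.
elim: j => [|j IH]; first by rewrite expn0 subnn expr0 mulr1 expr1.
have e2 : (2 ^ j.+1 = 2 ^ j + 2 ^ j)%N by rewrite expnS mul2n addnn.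
set m := (2 ^ j)%N in IH e2 *; rewrite e2.
have m0 : (0 < m)%N by rewrite expn_gt0.
rewrite exprD -expr2.
have h1 : (lin x (G *m x) ^+ m) ^+ 2 <= (lin x (iter m (mulmx G) x) * lin x x ^+ (m - 1)) ^+ 2.
  rewrite lerXn2r// nnegrE ?exprn_ge0//.
  by apply: le_trans IH; rewrite exprn_ge0.
apply: le_trans h1 _; rewrite exprMn.
have -> : lin x x ^+ (m + m - 1) = lin x x * (lin x x ^+ (m - 1)) ^+ 2.
  by rewrite -exprM -exprS; congr (_ ^+ _); lia.
rewrite mulrA; apply: ler_wpM2r; first by rewrite sqr_ge0.
by rewrite lin_iter_gram mulrC; exact: lin_cauchy_schwarz.
Qed.

(** The left side is the squared norm of [G^m x]; Cauchy-Schwarz in each row bounds it by the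
    squared Frobenius norm of [G^m], which is the trace of [G^(2m)]. *)
Lemma gram_trace_le m x : lin x (iter (m + m) (mulmx G) x) <=
  (\sum_i iter (m + m) (mulmx G) (delta_mx i (0 : 'I_1)) i 0) * lin x x.
Proof.
rewrite lin_iter_gram linE mulr_suml; apply: ler_sum => i _.
rewrite -(lin_delta i (iter (m + m) _ _)) lin_iter_gram -expr2.
have -> : iter m (mulmx G) x i 0 = lin (iter m (mulmx G) (delta_mx i 0)) x.
  by rewrite -lin_delta -{1}[m]addn0 lin_iter_gram.
exact: lin_cauchy_schwarz.
Qed.

Lemma gram_diag_ge0 m i : 0 <= iter (m + m) (mulmx G) (delta_mx i (0 : 'I_1)) i 0.
Proof.
by rewrite -lin_delta lin_iter_gram lin_ge0.
Qed.

(** The trace bounds [x^T G x], that is, the norm of [H^T]. It passes to [H] because [y = H x]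
    satisfies [y^T y = (H^T y)^T x]. *)
Lemma trace_op_bound j tau : 0 <= tau ->
  \sum_i iter (2 ^ j.+1) (mulmx G) (delta_mx i (0 : 'I_1)) i 0 <= tau ^+ (2 ^ j.+1).*2 ->
  op_bound H tau.
Proof.
move=> tau0 htr; apply: norm2_mul_real => // x.
have gle y : lin y (G *m y) <= tau ^+ 2 * lin y y.
  have g0 : 0 <= lin y (G *m y) by rewrite /G -mulmxA lin_mulmx lin_ge0.
  have m0 : (0 < 2 ^ j.+1)%N by rewrite expn_gt0.
  rewrite -(@ler_pXn2r _ (2 ^ j.+1)) ?nnegrE ?mulr_ge0 ?exprn_ge0 ?lin_ge0//.
  apply: le_trans (gram_power_le _ _) _.
  have e2 : (2 ^ j.+1 = 2 ^ j + 2 ^ j)%N by rewrite expnS mul2n addnn.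
  have h1 : lin y (iter (2 ^ j.+1) (mulmx G) y) <= tau ^+ (2 ^ j.+1).*2 * lin y y.
    apply: le_trans (ler_wpM2r (lin_ge0 y) htr).
    by rewrite e2; exact: gram_trace_le.
  apply: le_trans (ler_wpM2r _ h1) _; first by rewrite exprn_ge0// lin_ge0.
  rewrite exprMn -exprM mul2n -mulrA -exprS.
  by have -> : (2 ^ j.+1 - 1).+1 = (2 ^ j.+1)%N by lia.
rewrite (eq_bigr (fun i => (H *m x) i 0 * (H *m x) i 0)) => [|i _]; last by rewrite expr2.
rewrite [X in _ * X](eq_bigr (fun i => x i 0 * x i 0)) => [|i _]; last by rewrite expr2.
rewrite -!linE; set y := H *m x.
have y0 := lin_ge0 y.
have [yz|ypos] := leP (lin y y) 0.
  by apply: le_trans yz _; rewrite mulr_ge0 ?exprn_ge0 ?lin_ge0.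
have h1 : lin y y ^+ 2 <= tau ^+ 2 * lin y y * lin x x.
  have -> : lin y y = lin (H^T *m y) x by rewrite {2}/y lin_mulmx.
  apply: le_trans (lin_cauchy_schwarz _ _) _; apply: ler_wpM2r (lin_ge0 x) _ _ _.
  have -> : lin (H^T *m y) (H^T *m y) = lin y (G *m y).
    by rewrite /G -mulmxA [RHS]lin_mulmx.
  rewrite -[lin (H^T *m y) x]lin_mulmx; exact: gle.
by move: h1; rewrite expr2 mulrAC ler_pM2r.
Qed.
End TraceBound.

(** * Truncation and joint independence *)

Section Truncation.
Context (R : realType) (d : measure_display) (T : measurableType d).
Variable P : probability T R.

Definition trunc (B y : R) : R := y * \1_[set z | `|z| <= B] y.

Lemma truncE B y : `|y| <= B -> trunc B y = y.
Proof. by move=> h; rewrite /trunc indicE mem_set ?mulr1. Qed.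

Lemma trunc_le B y : 0 <= B -> `|trunc B y| <= B.
Proof.
move=> B0; rewrite /trunc indicE; have [h|_] := boolP (y \in _).
  by rewrite mulr1; move: h; rewrite inE.
by rewrite mulr0 normr0.
Qed.

Lemma trunc_sqr_le B y : trunc B y ^+ 2 <= y ^+ 2.
Proof.
rewrite /trunc indicE; case: (y \in _); first by rewrite mulr1.
by rewrite mulr0 expr0n sqr_ge0.
Qed.

Lemma truncN B y : trunc B (- y) = - trunc B y.
Proof.
rewrite /trunc !indicE mulNr; congr (- (_ * (nat_of_bool _)%:R)).
by apply/idP/idP; rewrite !inE /= normrN.
Qed.

Lemma measurable_abs_le (B : R) : measurable [set z : R | `|z| <= B].
Proof. by apply: measurable_set_le => //; exact: measurableT_comp. Qed.

Lemma bm_trunc B : 0 <= B -> bounded_measurable (trunc B).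
Proof.
move=> B0; split; last by exists B => y; exact: trunc_le.
apply: measurable_funM => //.
exact: measurable_indic (measurable_abs_le B).
Qed.

(** Truncation could shift the mean; here it changes [X] only on a null set. *)
Lemma Ex_trunc_ae (X : {RV P >-> R}) B : 0 <= B -> ('E_P[X] = 0)%E ->
  {ae P, forall w, `|X w| <= B} -> Ex P (fun w => trunc B (X w)) = 0.
Proof.
move=> B0; rewrite unlock => EX ae.
have -> : Ex P (fun w => trunc B (X w)) = fine (\int[P]_w (X w)%:E).
  congr fine; apply: ae_eq_integral => //.
  - apply/measurable_EFinP.
    by have [] := bm_comp (measurable_funPT X) (bm_trunc B0).
  - exact/measurable_EFinP.
  - by apply: filterS ae => w h _; rewrite truncE.
by rewrite EX.
Qed.

(** [trunc B] is odd, so under a symmetric law its expectation equals its own negative. *)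
Lemma Ex_trunc_symmetric (X : {RV P >-> R}) B : 0 <= B -> symmetric_law X ->
  Ex P (fun w => trunc B (X w)) = 0.
Proof.
move=> B0 sX.
pose Y : {RV P >-> R} := (- X)%R.
have eq : Ex P (fun w => trunc B (X w)) = Ex P (fun w => trunc B (Y w)).
  have bt := bm_trunc B0.
  have mt : measurable_fun setT (EFin \o trunc B) by apply/measurable_EFinP; case: bt.
  have iX : P.-integrable setT ((EFin \o trunc B) \o X).
    exact: (bm_integrable P (bm_comp (measurable_funPT X) bt)).
  have iY : P.-integrable setT ((EFin \o trunc B) \o Y).
    exact: (bm_integrable P (bm_comp (measurable_funPT Y) bt)).
  rewrite /Ex /Rintegral; congr fine.
  have := integral_distribution mt iX; rewrite /= => <-.
  have := integral_distribution mt iY; rewrite /= => <-.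
  by apply: eq_measure_integral => A mA _; exact: sX.
have eN : Ex P (fun w => trunc B (Y w)) = - Ex P (fun w => trunc B (X w)).
  rewrite -mulN1r -ExZ; last exact: (bm_comp (measurable_funPT X) (bm_trunc B0)).
  by congr Ex; apply/funext => w; rewrite mulN1r -truncN.
by move: eq; rewrite eN; lra.
Qed.

Lemma Ex_trunc_sqr (X : {RV P >-> R}) B sigma : 0 <= B -> ('E_P[X] = 0)%E ->
  ('V_P[X] <= (sigma ^+ 2)%:E)%E ->
  Ex P (fun w => trunc B (X w) ^+ 2) <= sigma ^+ 2.
Proof.
move=> B0 EX; rewrite /variance covariance.unlock EX /= expectation.unlock => VX.
have b2 := bmX 2 (bm_comp (measurable_funPT X) (bm_trunc B0)).
rewrite -lee_fin -(ExE P b2) unlock; apply: le_trans VX.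
apply: ge0_le_integral => //.
- by move=> w _; rewrite lee_fin sqr_ge0.
- by apply/measurable_EFinP; case: b2.
- apply/measurable_EFinP; apply: measurable_funM; apply: measurable_funB => //; exact: measurable_cst.
- move=> w _; rewrite lee_fin; apply: le_trans (trunc_sqr_le B (X w)) _.
  by rewrite -[X w]subr0 expr2; exact: lexx.
Qed.

Lemma prob_exceed_ae (X : {RV P >-> R}) B :
  {ae P, forall w, `|X w| <= B} -> P [set w | (B < `|X w|)%R] = 0%E.
Proof.
move=> [N [mN PN0 subN]].
have mA : measurable [set w | B < `|X w|].
  apply: measurable_set_lt => //; exact: measurableT_comp.
apply: (subset_measure0 mA mN) => // w /= h; apply: subN => /=; apply/negP.
by rewrite -ltNge.
Qed.

Lemma union_bound (J : finType) (Bad : J -> set T) (p : J -> R) :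
  (forall j, measurable (Bad j)) -> (forall j, (P (Bad j) <= (p j)%:E)%E) ->
  exists A, [/\ measurable A, (forall w j, A w -> ~ Bad j w)
    & ((1 - \sum_j p j)%:E <= P A)%E].
Proof.
move=> mB hp; pose A := \bigcap_(j in [set: J]) ~` Bad j.
have mA : measurable A by apply: fin_bigcap_measurable => // j _; exact: measurableC.
exists A; split => //; first by move=> w j Aw; exact: Aw.
rewrite (Ex_indic P mA) lee_fin.
have bb j : bounded_measurable (\1_(Bad j) : T -> R) by exact: bm_indic.
have bs : bounded_measurable (fun w => \sum_j -1 * \1_(Bad j) w : R).
  by apply: bm_sum => j _; apply: bmM => //; exact: bm_cst.
apply: (@le_trans _ _ (Ex P (fun w => 1 + \sum_j -1 * \1_(Bad j) w))).
  rewrite ExD//; last exact: bm_cst.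
  rewrite Ex_cst Ex_sum; last by move=> j _; apply: bmM => //; exact: bm_cst.
  rewrite lerD2l -sumrN; apply: ler_sum => j _.
  by rewrite ExZ// mulN1r lerN2 -lee_fin -Ex_indic.
apply: Ex_le.
- by apply: bmD => //; exact: bm_cst.
- exact: bm_indic.
move=> w; rewrite -mulr_sumr mulN1r.
have s0 : 0 <= \sum_j (\1_(Bad j) w : R) by apply: sumr_ge0 => j _; rewrite indicE.
have [Aw|nA] := pselect (A w); first by rewrite indicE mem_set// gerBl.
have [j bj] : exists j, Bad j w.
  apply: contrapT => h; apply: nA => j _ bj; apply: h; by exists j.
rewrite indicE memNset//= subr_le0 (bigD1 j)//= indicE mem_set// lerDl.
by apply: sumr_ge0 => i _; rewrite indicE.
Qed.
End Truncation.

Section JointIndependence.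
Context (R : realType) (d : measure_display) (T : measurableType d).
Variables (P : probability T R) (I J : finType).
Variables (X : I -> {RV P >-> R}) (Y : J -> {RV P >-> R}).
Hypothesis iX : mutually_independent X.
Hypothesis iY : mutually_independent Y.
Hypothesis iXY : independent_families X Y.

Definition joint (k : I + J) : T -> R :=
  match k with inl i => X i | inr j => Y j end.

Lemma measurable_joint k : measurable_fun setT (joint k).
Proof. by case: k => ?; exact: measurable_funPT. Qed.

Lemma sigma_of_bigcap (K : finType) (Z : K -> {RV P >-> R}) (U : K -> set R) :
  (forall k, measurable (U k)) ->
  sigma_of Z (\bigcap_(k in [set: K]) (Z k @^-1` U k)).
Proof.
move=> mU; rewrite /sigma_of; set G := [set A | _].
have := @fin_bigcap_measurable _ (g_sigma_algebraType G) K [set: K] (fun k => Z k @^-1` U k).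
apply => //.
by move=> k _; apply: sub_sigma_algebra; exists k, (U k).
Qed.

Lemma prod_rule (K : finType) (Z : K -> {RV P >-> R}) (U : K -> set R) :
  mutually_independent Z -> (forall k, measurable (U k)) ->
  P (\bigcap_(k in [set: K]) (Z k @^-1` U k)) = (\prod_k P (Z k @^-1` U k))%E.
Proof.
move=> iZ mU; have := iZ finset.setT U mU.
have -> : [set j | j \in (finset.setTfor K)] = [set: K].
  by apply/seteqP; split => // j _ /=; rewrite finset.in_setT.
by move=> ->; apply: eq_bigl => k; rewrite finset.in_setT.
Qed.

Lemma prod_indic_bigcap (K : finType) (V : K -> set T) w :
  \prod_k (\1_(V k) w : R) = \1_(\bigcap_(k in [set: K]) V k) w.
Proof.
have [h|h] := pselect ((\bigcap_(k in [set: K]) V k) w).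
  rewrite [RHS]indicE mem_set// big1// => k _; rewrite indicE mem_set//.
  exact: h.
rewrite [RHS]indicE memNset//.
have [k nk] : exists k, ~ V k w.
  by apply: contrapT => h'; apply: h => k _; apply: contrapT => nk; apply: h'; exists k.
by rewrite (bigD1 k)//= indicE memNset// mul0r.
Qed.

Lemma joint_indep (U : I + J -> set R) : (forall k, measurable (U k)) ->
  Ex P (fun x => \prod_k \1_(U k) (joint k x)) =
  \prod_k Ex P (fun x => \1_(U k) (joint k x)).
Proof.
move=> mU.
pose V (k : I + J) := joint k @^-1` U k.
have mV k : measurable (V k).
  by rewrite -[V k]setTI; apply: measurable_joint.
have eV k : (fun x => \1_(U k) (joint k x) : R) = \1_(V k).
  by apply/funext => x; rewrite !indicE /V.
pose A := \bigcap_(i in [set: I]) (X i @^-1` U (inl i)).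
pose B := \bigcap_(j in [set: J]) (Y j @^-1` U (inr j)).
have mA : measurable A.
  by apply: fin_bigcap_measurable => // i _; exact: (mV (inl i)).
have mB : measurable B.
  by apply: fin_bigcap_measurable => // j _; exact: (mV (inr j)).
have -> : (fun x => \prod_k \1_(U k) (joint k x)) = (\1_(A `&` B) : T -> R).
  apply/funext => x; rewrite big_sumType /= indicI /=.
  by rewrite -!prod_indic_bigcap.
have hAB : P (A `&` B) = (P A * P B)%E.
  by apply: iXY; apply: sigma_of_bigcap => k; exact: mU.
have hA : P A = (\prod_i P (X i @^-1` U (inl i)))%E by apply: prod_rule => // i; exact: mU.
have hB : P B = (\prod_j P (Y j @^-1` U (inr j)))%E by apply: prod_rule => // j; exact: mU.
apply: EFin_inj; rewrite -Ex_indic//; last exact: measurableI.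
rewrite hAB hA hB big_sumType /= EFinM -!prodEFin.
by congr (_ * _)%E; apply: eq_bigr => k _; rewrite eV -Ex_indic//; exact: mV.
Qed.
End JointIndependence.

(** * Tail bounds *)

Section Logarithms.
Variables (R : realType) (n : nat).
Hypothesis n1 : (1 < n)%N.

(** For positive [n], the least [q] with [n < 2 ^ q]. It is both the length of the Neumann series
    and the unit in which the orders of moments are measured. *)
Definition log_ceil : nat := (trunc_log 2 n).+1.

Lemma ltn_log_ceil : (n < 2 ^ log_ceil)%N.
Proof. by have /andP[] := trunc_log_bounds (isT : (1 < 2)%N) (ltnW n1). Qed.

Lemma log_ceil_gt1 : (1 < log_ceil)%N.
Proof. by rewrite /log_ceil ltnS trunc_log_gt0. Qed.

Lemma log_ceil_le : (log_ceil <= n)%N.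
Proof.
have /andP[h _] := trunc_log_bounds (isT : (1 < 2)%N) (ltnW n1).
by apply: leq_trans h; exact: ltn_expl.
Qed.

Lemma log_ceil_ln : log_ceil%:R <= 4 * ln (n%:R : R).
Proof.
have /andP[h _] := trunc_log_bounds (isT : (1 < 2)%N) (ltnW n1).
have n0 : 0 < n%:R :> R by rewrite ltr0n ltnW.
have h1 : (trunc_log 2 n)%:R * ln (2 : R) <= ln (n%:R : R).
  rewrite mulr_natl -lnXn// ler_ln ?posrE ?exprn_gt0//.
  by rewrite -natrX ler_nat.
have l2 : 1/2 <= ln (2 : R).
  have : ln (1 + - 2^-1 : R) <= - 2^-1 by apply: le_ln1Dx; lra.
  have -> : 1 + - 2^-1 = 2^-1 :> R by field.
  rewrite lnV ?posrE//; lra.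
have t1 : 1 <= (trunc_log 2 n)%:R :> R by rewrite ler1n trunc_log_gt0.
have h2 : (trunc_log 2 n)%:R * (1/2) <= (trunc_log 2 n)%:R * ln (2 : R).
  by apply: ler_wpM2l => //; lra.
rewrite /log_ceil -natr1; move: t1 h1 h2; clear; lra.
Qed.

Lemma half_exp_le m : (14 * log_ceil <= m)%N -> (2^-1 : R) ^+ m <= (n%:R ^+ 14)^-1.
Proof.
move=> hm; have n0 : 0 < n%:R :> R by rewrite ltr0n ltnW.
apply: (@le_trans _ _ ((2^-1 : R) ^+ (log_ceil * 14))).
  by rewrite ler_wiXn2l//; [lra|rewrite mulnC].
rewrite exprM -!exprVn lerXn2r ?nnegrE ?exprn_ge0 ?invr_ge0// ?ler0n//.
rewrite exprVn lef_pV2 ?posrE ?exprn_gt0// -natrX ler_nat ltnW//.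
exact: ltn_log_ceil.
Qed.
End Logarithms.

Section NoiseParameters.
Variables (R : realType) (n : nat) (sigma B : R).
Hypotheses (n1 : (1 < n)%N) (sigma0 : 0 <= sigma) (B0 : 0 < B).
Let nu := noise_level sigma B n.

Lemma ln_nat_gt0 : 0 < ln (n%:R : R).
Proof. by rewrite ln_gt0// ltr1n. Qed.

Lemma noise_level_gt0 : 0 < nu.
Proof. by rewrite /nu /noise_level lt_max [X in _ || X]mulr_gt0 ?ln_nat_gt0// orbT. Qed.

(* Moments of order [m <= 32 * log_ceil n] are used, and
   [log_ceil n <= 4 * ln n]. *)
Definition moment_scale : R := 128 * noise_level sigma B n.

Lemma moment_scale_gt0 : 0 < moment_scale.
Proof. by rewrite /moment_scale pmulr_rgt0 ?noise_level_gt0// ltr0n. Qed.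

(** The two conditions on [L] in [moment_le], met by one [L] for all moment orders in use. *)
Lemma noise_parameters m : (m <= 32 * log_ceil n)%N ->
  m%:R * n%:R * sigma ^+ 2 <= moment_scale ^+ 2 /\ m%:R * B <= moment_scale.
Proof.
rewrite /moment_scale -/nu => hm; have l0 := ln_nat_gt0; have nu0 := noise_level_gt0.
have hm' : m%:R <= 128 * ln (n%:R : R).
  apply: (@le_trans _ _ ((32 * log_ceil n)%N%:R)); first by rewrite ler_nat.
  by rewrite natrM; have := log_ceil_ln R n1; lra.
split.
  have a1 : sigma * Num.sqrt (n%:R * ln n%:R) <= nu by rewrite /nu /noise_level le_max lexx.
  have a2 : (sigma * Num.sqrt (n%:R * ln n%:R)) ^+ 2 <= nu ^+ 2.
    by rewrite lerXn2r// nnegrE ?mulr_ge0 ?sqrtr_ge0// ltW.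
  rewrite exprMn sqr_sqrtr in a2; last by rewrite mulr_ge0// ltW.
  apply: (@le_trans _ _ (128 * (sigma ^+ 2 * (n%:R * ln n%:R)))).
    have -> : 128 * (sigma ^+ 2 * (n%:R * ln n%:R)) = 128 * ln n%:R * (n%:R * sigma ^+ 2) by ring.
    by rewrite -mulrA; apply: ler_wpM2r; rewrite // mulr_ge0// sqr_ge0.
  rewrite exprMn; have : 0 <= nu ^+ 2 by rewrite sqr_ge0.
  lra.
have a1 : B * ln n%:R <= nu by rewrite /nu /noise_level le_max lexx orbT.
have : m%:R * B <= 128 * ln n%:R * B by apply: ler_wpM2r => //; exact: ltW.
lra.
Qed.
End NoiseParameters.

Section TailBounds.
Context (R : realType) (d : measure_display) (T : measurableType d).
Variables (P : probability T R) (n : nat) (D : 'I_n * 'I_n -> T -> R) (sigma B : R).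
Hypotheses (n1 : (1 < n)%N) (sigma0 : 0 <= sigma) (B0 : 0 < B).
Hypothesis bD : forall e, bounded_measurable (D e).
Hypothesis momD : forall (S : finType) (x : S -> 'I_n * 'I_n),
  `|Ex P (fun w => \prod_s D (x s) w)| <= repeated_weight (sigma ^+ 2) B x.

Local Notation q := (log_ceil n).
Local Notation tau := (4 * moment_scale n sigma B).

Lemma bm_iter_mulmx (A : T -> 'M[R]_n) k (x : 'cV[R]_n) :
  (forall i j, bounded_measurable (fun w => A w i j)) ->
  forall i, bounded_measurable (fun w => iter k (mulmx (A w)) x i 0).
Proof.
move=> bA; elim: k => [|k IH] i /=; first exact: bm_cst.
under eq_fun do rewrite mxE.
by apply: bm_sum => j _; exact: bmM.
Qed.

Lemma bm_rmx i j : bounded_measurable (fun w => rmx D w i j).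
Proof. by under eq_fun do rewrite mxE. Qed.

Lemma bm_open a k x : bounded_measurable (fun w => lin a (iter k (mulmx (rmx D w)) x)).
Proof.
under eq_fun do rewrite linE; apply: bm_sum => i _; apply: bmM; first exact: bm_cst.
by apply: bm_iter_mulmx; exact: bm_rmx.
Qed.

Lemma open_tail (a x : 'cV[R]_n) (M : R) k : (0 < k <= q)%N ->
  \sum_i a i 0 ^+ 2 <= 1 -> 0 < M -> (forall i, `|x i 0| <= M) ->
  (P [set w | (M * tau ^+ k < `|lin a (iter k (mulmx (rmx D w)) x)|)%R]
    <= ((n%:R ^+ 14)^-1)%:E)%E.
Proof.
move=> /andP[k0 kq] a1 M0 xM.
have nu0 := moment_scale_gt0 sigma n1 B0.
have tau0 : 0 < tau by rewrite mulr_gt0.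
(* The even number [N] satisfies [14 * q <= N * k <= 14 * q + 2 * k], and [k <= q]. *)
pose p := ((7 * q) %/ k).+1; pose N := p.*2.
have Nk1 : (14 * q <= N * k)%N.
  have := ltn_ceil (7 * q) k0; rewrite -/p /N -muln2; lia.
have Nk2 : (N * k <= 32 * q)%N.
  have := leq_divM (7 * q) k; rewrite /N /p -muln2; lia.
have [hL1 hL2] := noise_parameters n1 sigma0 B0 Nk2.
have L0 := ltW nu0.
have th0 : 0 < M * tau ^+ k by rewrite mulr_gt0// exprn_gt0.
apply: le_trans (markov_pow P (bm_open a k x) (_ : ~~ odd N) th0) _; first by rewrite odd_double.
rewrite lee_fin; apply: le_trans (half_exp_le R n1 Nk1).
rewrite ler_pdivrMr ?exprn_gt0//.
have v0 : 'I_n by exact: Ordinal (ltnW n1).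
have -> : (fun w => lin a (iter k (mulmx (rmx D w)) x) ^+ N) =
    (fun w => (\sum_i a i 0 * iter k (mulmx (rmx D w)) x i 0) ^+ N).
  by apply/funext => w; rewrite linE.
have hm := @open_moment R d T P n D (sigma ^+ 2) B bD (sqr_ge0 _) (ltW B0) momD v0
  k.-1 N (fun i => a i 0) x M _ a1 xM L0.
rewrite prednK// in hm; have {}hm := hm hL1 hL2.
apply: le_trans hm _.
rewrite [in leRHS]exprMn [leRHS]mulrCA -exprM [(k * N)%N]mulnC; apply: ler_wpM2l.
  by rewrite exprn_ge0// ltW.
have -> : 2 * moment_scale n sigma B = 2^-1 * tau by field.
by rewrite exprMn.
Qed.

Local Notation trace_power j := (fun w => \sum_i
  iter (2 ^ j.+1) (mulmx (rmx D w *m (rmx D w)^T)) (delta_mx i (0 : 'I_1)) i 0).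

Lemma bm_trace_power j : bounded_measurable (trace_power j).
Proof.
apply: bm_sum => i _; apply: bm_iter_mulmx => {}i i'.
under eq_fun do rewrite mxE; apply: bm_sum => l _; apply: bmM; first exact: bm_rmx.
by under eq_fun do rewrite mxE; exact: bm_rmx.
Qed.

(** The least power of two that is at least [7 * q] is below [14 * q], so the walks have a length
    between [14 * q] and [28 * q]. The extra factor [n] is the free starting vertex in the trace. *)
Lemma trace_tail : exists j,
  (P [set w | (tau ^+ (2 ^ j.+1).*2 < trace_power j w)%R]
    <= (n%:R * (n%:R ^+ 14)^-1)%:E)%E.
Proof.
have nu0 := moment_scale_gt0 sigma n1 B0.
have tau0 : 0 < tau by rewrite mulr_gt0.
have q1 := log_ceil_gt1 n1.
have /andP[hj1 hj2] := @up_log_bounds 2 (7 * q) isT (ltac:(lia)).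
set j' := up_log 2 (7 * q) in hj1 hj2.
have j0 : (0 < j')%N by case: (j') hj2 => //; lia.
exists j'.-1; rewrite prednK//.
have e2 : (2 ^ j' = 2 * 2 ^ j'.-1)%N by rewrite -expnS prednK.
pose m := (2 ^ j').*2; rewrite -/m.
have m1 : (14 * q <= m)%N by rewrite /m -muln2; lia.
have m2 : (m <= 32 * q)%N by rewrite /m -muln2; lia.
have [hL1 hL2] := noise_parameters n1 sigma0 B0 m2.
have L0 := ltW nu0.
have bt : bounded_measurable (trace_power j'.-1) := bm_trace_power _.
have ft w : 0 <= trace_power j'.-1 w.
  by apply: sumr_ge0 => i _; rewrite prednK// e2 mul2n -addnn gram_diag_ge0.
have := markov_nonneg P bt ft (exprn_gt0 m tau0); rewrite prednK// => /le_trans; apply.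
rewrite lee_fin ler_pdivrMr ?exprn_gt0//.
have := @trace_moment R d T P n D (sigma ^+ 2) B bD (sqr_ge0 _) (ltW B0) momD (2 ^ j') _ L0 hL1 hL2.
rewrite -/m => /le_trans; apply; rewrite -mulrA; apply: ler_wpM2l => //.
have -> : 2 * moment_scale n sigma B = 2^-1 * tau by field.
rewrite exprMn; apply: ler_wpM2r; first by rewrite exprn_ge0// ltW.
exact: half_exp_le.
Qed.
End TailBounds.

(** * The dilated noise matrix *)

Section Dilated.
Variables (n1 n2 : nat).

Local Notation entry := (('I_n1 * 'I_n2) + ('I_n1 * 'I_n2))%type.

Definition dilation_index (e : 'I_(n1 + n2) * 'I_(n1 + n2)) : option entry :=
  match fintype.split e.1, fintype.split e.2 with
  | inl i, inr j => Some (inl (i, j))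
  | inr j, inl i => Some (inr (i, j))
  | _, _ => None
  end.

Lemma dilation_index_inj e e' :
  dilation_index e != None -> dilation_index e = dilation_index e' -> e = e'.
Proof.
case: e e' => [x y] [x' y']; rewrite /dilation_index /=.
move: (fintype.splitK x) (fintype.splitK y) (fintype.splitK x') (fintype.splitK y').
case: (fintype.split x) => i; case: (fintype.split y) => j //;
case: (fintype.split x') => i'; case: (fintype.split y') => j' //= <- <- <- <- _ [-> ->] //.
Qed.

Lemma rmx_masked (R : realType) (d : measure_display) (T : measurableType d)
    (Y : entry -> T -> R) w :
  rmx (masked Y dilation_index) w =
  dilation (\matrix_(i, j) Y (inl (i, j)) w) (\matrix_(i, j) Y (inr (i, j)) w).
Proof.
apply/matrixP => x y; rewrite mxE /masked /dilation_index /dilation /block_mx !mxE /=.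
by case: (fintype.split x) => i; rewrite !mxE; case: (fintype.split y) => j; rewrite !mxE.
Qed.
End Dilated.

Section TruncatedNoise.
Context (R : realType) (d : measure_display) (T : measurableType d).
Variables (P : probability T R) (n1 n2 : nat) (cb sigma B : R).
Variables H1 H2 : 'I_n1 -> 'I_n2 -> {RV P >-> R}.
Hypotheses (cb0 : 0 < cb) (sigma0 : 0 <= sigma) (B0 : 0 < B).
Hypothesis noise1 : noise_assumption cb sigma B H1.
Hypothesis noise2 : noise_assumption cb sigma B H2.
Hypothesis indep : independent_families (entries H1) (entries H2).

Definition noise_entry (k : ('I_n1 * 'I_n2) + ('I_n1 * 'I_n2)) : {RV P >-> R} :=
  match k with inl e => entries H1 e | inr e => entries H2 e end.

Definition trunc_entry k (w : T) : R := trunc B (noise_entry k w).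

Definition trunc_dilation := masked trunc_entry (@dilation_index n1 n2).

Lemma noise_entryP k :
  [/\ ('E_P[noise_entry k] = 0)%E, ('V_P[noise_entry k] <= (sigma ^+ 2)%:E)%E
    & {ae P, forall w, `|noise_entry k w| <= B} \/
      (symmetric_law (noise_entry k) /\
       (P [set w | (B < `|noise_entry k w|)%R] <= (cb / (n1 + n2)%:R ^+ 12)%:E)%E)].
Proof.
case: k => -[i j]; rewrite /noise_entry /entries /=.
  by have [_ e v h] := noise1; split; [exact: e|exact: v|exact: h].
by have [_ e v h] := noise2; split; [exact: e|exact: v|exact: h].
Qed.

Lemma prob_noise_entry k :
  (P [set w | (B < `|noise_entry k w|)%R] <= (cb / (n1 + n2)%:R ^+ 12)%:E)%E.
Proof.
have [_ _ [h|[_ //]]] := noise_entryP k.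
rewrite prob_exceed_ae// lee_fin divr_ge0 ?exprn_ge0//; exact: ltW.
Qed.

Lemma measurable_trunc_entry k : measurable_fun setT (trunc_entry k).
Proof. by have [] := bm_comp (measurable_funPT (noise_entry k)) (bm_trunc (ltW B0)). Qed.

Lemma trunc_entry_le k w : `|trunc_entry k w| <= B.
Proof. exact: trunc_le (ltW B0). Qed.

Lemma bm_trunc_dilation e : bounded_measurable (trunc_dilation e).
Proof. exact: (bm_masked measurable_trunc_entry trunc_entry_le). Qed.

Lemma trunc_dilation_moment (S : finType) (x : S -> 'I_(n1 + n2) * 'I_(n1 + n2)) :
  `|Ex P (fun w => \prod_s trunc_dilation (x s) w)| <= repeated_weight (sigma ^+ 2) B x.
Proof.
apply: (mixed_moment_masked measurable_trunc_entry trunc_entry_le);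
  [move=> k|move=> k|move=> c|exact: dilation_index_inj|exact: sqr_ge0|exact: ltW].
- have [e0 _ [h|[h _]]] := noise_entryP k.
    by apply: Ex_trunc_ae => //; exact: ltW.
  by apply: Ex_trunc_symmetric => //; exact: ltW.
- have [e0 v _] := noise_entryP k.
  by apply: Ex_trunc_sqr => //; exact: ltW.
have [i1 _ _ _] := noise1; have [i2 _ _ _] := noise2.
apply: (Ex_prod_indep (X := fun k => noise_entry k : T -> R) (g := fun k y => trunc B y ^+ c k)).
- by move=> k; exact: measurable_funPT.
- move=> U mU; have := joint_indep i1 i2 indep mU.
  have e k : joint (entries H1) (entries H2) k = noise_entry k by case: k.
  under eq_fun do under eq_bigr do rewrite e.
  by move=> ->; apply: eq_bigr => k _; rewrite e.
- by move=> k; apply: bmX; exact: bm_trunc (ltW B0).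
Qed.

Lemma trunc_dilation_eq w : (forall k, ~ (B < `|noise_entry k w|)) ->
  rmx trunc_dilation w = dilation (random_mx H1 w) (random_mx H2 w).
Proof.
move=> h; rewrite /trunc_dilation rmx_masked.
have e k : trunc_entry k w = noise_entry k w.
  by rewrite /trunc_entry truncE// leNgt; apply/negP/h.
congr dilation; apply/matrixP => i j; rewrite !mxE e //.
Qed.
End TruncatedNoise.

(** * Failure probability and assembly *)

Section Bookkeeping.
Variable R : realType.

Lemma norm2_dim_gt0 m (x : 'cV[R]_m) : norm2 (cplx x) = 1 -> (0 < m)%N.
Proof.
case: m x => // x; rewrite /norm2 big_ord0 sqrtr0 => h.
by have := oner_neq0 R; rewrite -h eqxx.
Qed.

Lemma divf_exp_le (a c N : R) k l : 0 < N -> a <= c * N ^+ k ->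
  a / N ^+ (k + l) <= c / N ^+ l.
Proof.
move=> N0 h; rewrite ler_pdivrMr ?exprn_gt0// exprD.
by rewrite [N ^+ k * _]mulrC mulrA divfK// gt_eqF// exprn_gt0.
Qed.

(** The three terms come from the truncation of the [2 * n1 * n2] entries, from the operator norm,
    and from the linear forms, counted by test vector, power and sign. The number of entries is at
    most [N ^ 2], which turns the exponent 12 into 10. *)
Lemma failure_sum (cb N : R) (n1 n2 q : nat) : 0 < cb -> (0 < n1)%N -> (0 < n2)%N ->
  (q <= n1 + n2)%N -> N = (n1 + n2)%:R ->
  (n1 * n2 + n1 * n2)%:R * (cb / N ^+ 12) + (N * (N ^+ 14)^-1 +
    ((n1 + (n2 + 2)) * q * 2)%:R * (N ^+ 14)^-1) <= (cb + 5) / N ^+ 10.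
Proof.
move=> cb0 n10 n20 hq eN.
have N1 : 1 <= N by rewrite eN ler1n addn_gt0 n10.
have N0 : 0 < N by lra.
have t1 : (n1 * n2 + n1 * n2)%:R * (cb / N ^+ 12) <= cb / N ^+ 10.
  rewrite mulrA; apply: (@divf_exp_le _ _ _ 2 10) => //.
  rewrite mulrC ler_pM2l// eN -natrX ler_nat; nia.
have t2 : N * (N ^+ 14)^-1 <= 1 / N ^+ 10.
  apply: (@divf_exp_le _ _ _ 4 10) => //; rewrite mul1r exprS.
  by apply: ler_peMr; [exact: ltW|exact: exprn_ege1].
have t3 : ((n1 + (n2 + 2)) * q * 2)%:R * (N ^+ 14)^-1 <= 4 / N ^+ 10.
  apply: (@divf_exp_le _ _ _ 4 10) => //.
  apply: (@le_trans _ _ (4 * N ^+ 2)).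
    rewrite eN -!natrX -natrM ler_nat.
    have : ((n1 + (n2 + 2)) * q <= (2 * (n1 + n2)) * (n1 + n2))%N by apply: leq_mul => //; lia.
    by rewrite expnS expn1; lia.
  by rewrite ler_pM2l// ler_weXn2l.
move: t1 t2 t3; rewrite !mulrDl; clear; lra.
Qed.

(** A unit vector with [n1 + n2] coordinates has one of size at least the inverse square root of
    [n1 + n2], hence so is [M]. Thus [2^-1 ^+ log_ceil (n1 + n2)], the size of the Neumann
    remainder, lies below the incoherence level. The factor 2 rounds up the square root of 2. *)
Lemma incoherence_ge (n1 n2 : nat) (us : 'cV[R]_n1) (vs : 'cV[R]_n2) (mu : R) :
  norm2 (cplx us) = 1 -> norm2 (cplx vs) = 1 -> incoherence_bound us vs mu ->
  let M := Num.sqrt (mu / (n1 + n2)%:R) in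
  [/\ 2^-1 ^+ log_ceil (n1 + n2) <= M, forall i, `|us i 0| <= 2 * M
    & forall i, `|vs i 0| <= 2 * M].
Proof.
move=> u1 v1 [mu0 hp hm] M.
have n1p := norm2_dim_gt0 u1; have n2p := norm2_dim_gt0 v1.
have n1lt : (1 < n1 + n2)%N by lia.
have M0 : 0 <= M by exact: sqrtr_ge0.
have [w1 _ _ _] := phi_orthonormal u1 v1.
have N1 : 1 < (n1 + n2)%:R :> R by rewrite ltr1n.
have big : 1 <= (n1 + n2)%:R * M ^+ 2.
  have -> : (n1 + n2)%:R * M ^+ 2 = \sum_(i < n1 + n2) M ^+ 2.
    by rewrite sumr_const card_ord mulr_natl.
  rewrite -w1 mxE.
  apply: ler_sum => i _; rewrite mxE -expr2 -real_normK ?num_real//.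
  by rewrite lerXn2r ?nnegrE//; exact: hp.
have /andP[c1 c2] := sqrt2_inv_bounds R; set c := (Num.sqrt (2 : R))^-1 in c1 c2.
split.
- have h : (2^-1 : R) ^+ log_ceil (n1 + n2) <= ((n1 + n2)%:R)^-1.
    rewrite exprVn lef_pV2 ?posrE ?exprn_gt0//; last by lra.
    by rewrite -natrX ler_nat ltnW// ltn_log_ceil.
  apply: le_trans h _; rewrite leNgt; apply/negP => hM.
  have hN : (n1 + n2)%:R * M < 1.
    by rewrite mulrC -ltr_pdivlMr ?div1r//; lra.
  have hM1 : M <= 1.
    have : M <= (n1 + n2)%:R * M by rewrite ler_peMl// ltW.
    lra.
  have : (n1 + n2)%:R * M ^+ 2 <= (n1 + n2)%:R * M.
    by apply: ler_wpM2l => //; rewrite expr2 ler_piMl.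
  lra.
- move=> i; have := hp (lshift n2 i); rewrite mxE col_mxEu -/c -/M.
  rewrite normrM (ger0_norm (_ : 0 <= c)); last by lra.
  move=> hi; have : 7/10 * `|us i 0| <= c * `|us i 0| by apply: ler_wpM2r.
  move: hi; have := normr_ge0 (us i 0); lra.
- move=> i; have := hp (rshift n1 i); rewrite mxE col_mxEd -/c -/M.
  rewrite normrM (ger0_norm (_ : 0 <= c)); last by lra.
  move=> hi; have : 7/10 * `|vs i 0| <= c * `|vs i 0| by apply: ler_wpM2r.
  move: hi; have := normr_ge0 (vs i 0); lra.
Qed.
End Bookkeeping.

Section GoodEvent.
Context (R : realType) (d : measure_display) (T : measurableType d).
Variables (P : probability T R) (n1 n2 : nat) (cb sigma B mu : R).
Variables H1 H2 : 'I_n1 -> 'I_n2 -> {RV P >-> R}.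
Variables (us : 'cV[R]_n1) (vs : 'cV[R]_n2) (a : 'cV[R]_n1) (b : 'cV[R]_n2).
Hypotheses (cb0 : 0 < cb) (sigma0 : 0 <= sigma) (B0 : 0 < B).
Hypothesis u1 : norm2 (cplx us) = 1.
Hypothesis v1 : norm2 (cplx vs) = 1.
Hypothesis a1 : norm2 (cplx a) = 1.
Hypothesis b1 : norm2 (cplx b) = 1.
Hypothesis inc : incoherence_bound us vs mu.
Hypothesis noise1 : noise_assumption cb sigma B H1.
Hypothesis noise2 : noise_assumption cb sigma B H2.
Hypothesis indep : independent_families (entries H1) (entries H2).

Local Notation n := (n1 + n2)%N.
Local Notation tau := (4 * moment_scale n sigma B).
Local Notation M := (Num.sqrt (mu / n%:R)).
Local Notation q := (log_ceil n).

(** Basis vectors of either block serve the entrywise bounds; [a] and [b] serve the two linear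
    forms. *)
Definition test_vector (t : 'I_n1 + ('I_n2 + bool)) : 'cV[R]_n :=
  match t with
  | inl i => col_mx (delta_mx i 0) 0
  | inr (inl j) => col_mx 0 (delta_mx j 0)
  | inr (inr true) => col_mx a 0
  | inr (inr false) => col_mx 0 b
  end.

Lemma test_vector_unit t : \sum_i test_vector t i 0 ^+ 2 <= 1.
Proof.
case: t => [i|[j|[]]] /=.
- by rewrite sum_sqr_col_mx0 sum_sqr_delta.
- by rewrite sum_sqr_col_0mx sum_sqr_delta.
- by rewrite sum_sqr_col_mx0 norm2_unit_sum.
- by rewrite sum_sqr_col_0mx norm2_unit_sum.
Qed.

Lemma good_event : exists A, [/\ measurable A,
  (((1 - (cb + 5) / n%:R ^+ 10)%:E) <= P A)%E &
  forall w, A w ->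
    op_bound (dilation (random_mx H1 w) (random_mx H2 w)) tau /\
    forall t k, (0 < k <= q)%N ->
    `|lin (test_vector t)
        (iter k (mulmx (dilation (random_mx H1 w) (random_mx H2 w)))
           (phi_plus us vs))| <= M * tau ^+ k /\
    `|lin (test_vector t)
        (iter k (mulmx (dilation (random_mx H1 w) (random_mx H2 w)))
           (phi_minus us vs))| <= M * tau ^+ k].
Proof.
have n1p := norm2_dim_gt0 u1; have n2p := norm2_dim_gt0 v1.
have n1lt : (1 < n)%N by lia.
have [Mq _ _] := incoherence_ge u1 v1 inc.
have M0 : 0 < M by apply: lt_le_trans Mq; rewrite exprn_gt0.
have [_ hp hm] := inc.
pose D := @trunc_dilation R d T P n1 n2 B H1 H2.
have bD e : bounded_measurable (D e) by exact: bm_trunc_dilation.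
have momD := trunc_dilation_moment B0 noise1 noise2 indep.
have [j htr] := trace_tail n1lt sigma0 B0 bD momD.
(* One index per bad event: an entry beyond [B], a large trace, or a large linear form for a test
   vector, a power and a choice of eigenvector. The index [k] in ['I_q] stands for the power
   [k.+1]. *)
pose J := ((('I_n1 * 'I_n2) + ('I_n1 * 'I_n2)) +
  (unit + (('I_n1 + ('I_n2 + bool)) * 'I_q * bool)))%type.
pose phi (s : bool) := if s then phi_plus us vs else phi_minus us vs.
have phiM s i : `|phi s i 0| <= M by case: s; [exact: hp|exact: hm].
pose Bad (x : J) : set T := match x with
  | inl k => [set w | B < `|noise_entry H1 H2 k w|]
  | inr (inl _) => [set w | tau ^+ (2 ^ j.+1).*2 < \sum_i
      iter (2 ^ j.+1) (mulmx (rmx D w *m (rmx D w)^T)) (delta_mx i (0 : 'I_1)) i 0]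
  | inr (inr (t, k, s)) => [set w | M * tau ^+ k.+1 <
      `|lin (test_vector t) (iter k.+1 (mulmx (rmx D w)) (phi s))|]
  end.
pose p (x : J) : R := match x with
  | inl k => cb / n%:R ^+ 12
  | inr (inl _) => n%:R * (n%:R ^+ 14)^-1
  | inr (inr _) => (n%:R ^+ 14)^-1
  end.
have mBad x : measurable (Bad x).
  case: x => [k|[u|[[t k] s]]] /=; apply: measurable_set_lt => //.
  - by apply: measurableT_comp => //; exact: measurable_funPT.
  - by have [] := bm_trace_power bD j.
  - by have [] := bm_norm (bm_open bD (test_vector t) k.+1 (phi s)).
have pBad x : (P (Bad x) <= (p x)%:E)%E.
  case: x => [k|[u|[[t k] s]]].
  - exact: (prob_noise_entry cb0 noise1 noise2).
  - exact: htr.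
  - apply: (open_tail n1lt sigma0 B0 bD momD _ (test_vector_unit t) M0 (phiM s)).
    exact: ltn_ord.
have [A [mA hA PA]] := union_bound mBad pBad.
exists A; split => //.
  apply: le_trans PA; rewrite lee_fin lerD2l lerN2.
  apply: le_trans (failure_sum cb0 n1p n2p (log_ceil_le n1lt) erefl).
  rewrite big_sumType /= sumr_const card_sum !card_prod !card_ord.
  rewrite big_sumType /= !sumr_const !card_prod !card_sum card_bool !card_ord card_unit mulr1n.
  by rewrite !mulr_natl.
move=> w Aw.
have eD : rmx D w = dilation (random_mx H1 w) (random_mx H2 w).
  apply: trunc_dilation_eq => k; exact: (hA w (inl k) Aw).
rewrite -eD; split.
  apply: (@trace_op_bound _ _ _ j); first by rewrite mulr_ge0// ltW// moment_scale_gt0.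
  by rewrite leNgt; apply/negP; exact: (hA w (inr (inl tt)) Aw).
move=> t k /andP[k0 kq].
have kq' : (k.-1 < q)%N by rewrite prednK.
have h s := hA w (inr (inr (t, Ordinal kq', s))) Aw.
rewrite -(prednK k0); split; rewrite leNgt; apply/negP; [exact: (h true)|exact: (h false)].
Qed.
End GoodEvent.

Theorem theorem5 (R : realType) (cb : R) (hcb : 0 < cb) :
  exists c1 C C' : R, [/\ 0 < c1, 0 < C & 0 < C'] /\
  forall (n1 n2 : nat) (lambda mu sigma B : R)
    (us : 'cV[R]_n1) (vs : 'cV[R]_n2) (a : 'cV[R]_n1) (b : 'cV[R]_n2)
    (d : measure_display) (T : measurableType d) (P : probability T R)
    (H1 H2 : 'I_n1 -> 'I_n2 -> {RV P >-> R})
    (u : T -> 'cV[R[i]]_n1) (v : T -> 'cV[R[i]]_n2),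
  let n := (n1 + n2)%N in
  let Ms := lambda *: (us *m vs^T) in
  let rho := noise_level sigma B n / lambda in
  0 < lambda -> 0 <= sigma -> 0 < B ->
  norm2 (cplx us) = 1 -> norm2 (cplx vs) = 1 ->
  norm2 (cplx a) = 1 -> norm2 (cplx b) = 1 ->
  is_incoherence us vs mu ->
  noise_assumption cb sigma B H1 -> noise_assumption cb sigma B H2 ->
  independent_families (entries H1) (entries H2) ->
  (forall w, dilation_estimate (Ms + random_mx H1 w) (Ms + random_mx H2 w)
               (u w) (v w)) ->
  rho <= c1 ->
  with_probability_at_least P (1 - C' / n%:R ^+ 10)
    [set w |
      [/\ Num.max (min_pm (@norm2 R n1) (u w) us)
                  (min_pm (@norm2 R n2) (v w) vs) <= C * rho,
          Num.max (min_pm (@norminf R n1) (u w) us)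
                  (min_pm (@norminf R n2) (v w) vs)
            <= C * rho * Num.sqrt (mu / n%:R),
          Num.min (cmod (dot a (u w - cplx us))) (cmod (dot a (u w + cplx us)))
            <= C * (`|(a^T *m us) 0 0| + Num.sqrt (mu / n%:R)) * rho
        & Num.min (cmod (dot b (v w - cplx vs))) (cmod (dot b (v w + cplx vs)))
            <= C * (`|(b^T *m vs) 0 0| + Num.sqrt (mu / n%:R)) * rho]].
Proof.
(* The noise operator norm is at most [tau = 4 * 128 * noise_level sigma B n]. The first constant
   ensures [1000 * tau <= lambda], the second multiplies [4 * 128] by the largest factor in
   [deterministic_bound], and the third is that of [failure_sum]. *)
exists (1000 * (4 * 128))^-1, (200 * (4 * 128)), (cb + 5).
have k512 : 0 < 4 * 128 :> R by rewrite pmulr_rgt0 ltr0n.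
split.
  split; first by rewrite invr_gt0 pmulr_rgt0 ?ltr0n.
    by rewrite pmulr_rgt0 ?ltr0n.
  by rewrite addr_gt0 ?ltr0n.
move=> n1 n2 lambda mu sigma B us vs a b d T P H1 H2 u v n Ms rho.
move=> l0 s0 B0 u1 v1 a1 b1 [inc _] no1 no2 indep est hrho.
have [A [mA PA hA]] := good_event hcb s0 B0 u1 v1 a1 b1 inc no1 no2 indep.
exists A; split => // w Aw.
have [hop htest] := hA w Aw.
have n1p := norm2_dim_gt0 u1.
have n2p := norm2_dim_gt0 v1.
have n1lt : (1 < n1 + n2)%N by lia.
have t0 := moment_scale_gt0 sigma n1lt B0.
set tau := 4 * _ in hop htest.
have tauE : tau = (4 * 128) * noise_level sigma B n.
  by rewrite /tau /moment_scale mulrA.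
have tau0 : 0 <= tau by apply: mulr_ge0; [rewrite ler0n|exact: ltW].
have etaE : tau / lambda = (4 * 128) * rho by rewrite tauE /rho mulrA.
have htau : 1000 * tau <= lambda.
  have k1000 : 0 < 1000 * (4 * 128) :> R by rewrite pmulr_rgt0 ?ltr0n.
  rewrite tauE mulrA -ler_pdivlMl; last exact: k1000.
  by move: hrho; rewrite /rho ler_pdivrMr.
have [Mq usM vsM] := incoherence_ge u1 v1 inc.
have q0 : (0 < log_ceil (n1 + n2))%N by [].
pose test c := exists t, c = test_vector a b t.
have htest' c k : test c -> (0 < k <= log_ceil (n1 + n2))%N ->
  `|lin c (iter k (mulmx (dilation (random_mx H1 w) (random_mx H2 w))) (phi_plus us vs))|
     <= Num.sqrt (mu / (n1 + n2)%:R) * tau ^+ k /\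
  `|lin c (iter k (mulmx (dilation (random_mx H1 w) (random_mx H2 w))) (phi_minus us vs))|
     <= Num.sqrt (mu / (n1 + n2)%:R) * tau ^+ k.
  by move=> [t ->]; exact: htest.
have [e1 e2 e3 e4] := deterministic_bound l0 tau0 htau u1 v1 hop q0 Mq usM vsM htest'
  (fun i => ex_intro _ (inl i) erefl) (fun j => ex_intro _ (inr (inl j)) erefl) (est w).
have {}e3 := e3 a a1 (ex_intro _ (inr (inr true)) erefl).
have {}e4 := e4 b b1 (ex_intro _ (inr (inr false)) erefl).
rewrite -/n in e2 e3 e4.
set eta := tau / lambda in etaE e1 e2 e3 e4.
have eta0 : 0 <= eta by rewrite divr_ge0// ltW.
have CE : 200 * (4 * 128) * rho = 200 * eta by rewrite etaE [RHS]mulrA.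
have widen x : 0 <= x -> 50 * x * eta <= 200 * (4 * 128) * x * rho.
  move=> x0; rewrite [leRHS]mulrAC CE [leLHS]mulrAC; apply: ler_wpM2r => //.
  by apply: ler_wpM2r => //; rewrite ler_nat.
have M0 : 0 <= Num.sqrt (mu / n%:R) by exact: sqrtr_ge0.
split.
- apply: le_trans e1 _; rewrite CE; apply: ler_wpM2r => //; by rewrite ler_nat.
- by apply: le_trans e2 _; rewrite CE mulrAC.
- by apply: le_trans e3 _; apply: widen; rewrite addr_ge0.
- by apply: le_trans e4 _; apply: widen; rewrite addr_ge0.
Qed.
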